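(* Let $f\in H^\infty$ have no zeros in $\mathbb{D}$ and satisfy $\|f\|_{H^\infty}\le1$, and let $\nu=\nu_f$ be its associated Herglotz–Nevanlinna measure. Assume there exists a constant $C=C(f)>0$ such that for any pair of contiguous arcs $I,I'\subset\partial\mathbb{D}$ with $|I|=|I'|$, $$\left|\frac{\nu(I)}{|I|}-\frac{\nu(I')}{|I'|}\right|\le C\inf\exp\left(-\frac{\nu(J)}{|J|}\right),$$ where the infimum is taken over all arcs $J\subset\partial\mathbb{D}$ with $J\supset I\cup I'$. Then $f$ is cyclic in $\mathcal{B}$.
   Context: If $f\in H^\infty$ has no zeros in $\mathbb{D}$, write $f=FS_\mu$ with $F$ outer and $S_\mu(z)=\exp(-\int\frac{\zeta+z}{\zeta-z}d\mu(\zeta))$ singular inner; its Herglotz–Nevanlinna measure is $d\nu_f=-\log|f(\zeta)|\,dm(\zeta)+d\mu(\zeta)$, where $m$ is normalized Lebesgue measure and $|f(\zeta)|$ denotes boundary values. $|I|$ is the normalized length of an arc; contiguous arcs are arcs with disjoint interiors sharing an endpoint. $\mathcal{B}$ is the Bloch space of analytic $f$ with $|f(0)|+\sup_z(1-|z|)|f'(z)|<\infty$, identified with the dual of $W^1=\{g: |g(0)|+\int_{\mathbb{D}}|g'|dA<\infty\}$ via the pairing $\lim_{r\to1^-}\int_{\partial\mathbb{D}}f(r\zeta)\overline{g(r\zeta)}dm(\zeta)$, with the weak-star topology; $f$ is cyclic in $\mathcal{B}$ if the weak-star closure of its polynomial multiples is $\mathcal{B}$. *)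

(* Defs.v *)
From HB Require Import structures.
From mathcomp Require Import all_boot all_order all_algebra complex.
From mathcomp Require Import all_classical all_reals all_analysis.
Set Implicit Arguments. Unset Strict Implicit. Unset Printing Implicit Defensive.
Import Order.TTheory GRing.Theory Num.Theory.
Import numFieldNormedType.Exports.
Local Open Scope classical_set_scope.
Local Open Scope ring_scope.
Local Open Scope complex_scope.

Section Defs.
Variable R : realType.

Definition cnorm (z : R[i]) : R :=
  Num.sqrt (complex.Re z ^+ 2 + complex.Im z ^+ 2).

Definition disk : set R[i] := [set z | cnorm z < 1].

Definition cexp (w : R[i]) : R[i] :=
  (expR (complex.Re w))%:C * Complex (cos (complex.Im w)) (sin (complex.Im w)).

(* boundary point of the unit circle with parameter t in [0,1):
   zeta = e^{2 pi i t}; normalized Lebesgue measure m on the circle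
   corresponds to Lebesgue measure on [0,1) *)
Definition ucirc (t : R) : R[i] := Complex (cos (2 * pi * t)) (sin (2 * pi * t)).

Definition has_cderiv (f : R[i] -> R[i]) (z d : R[i]) : Prop :=
  forall e : R, 0 < e -> exists2 delta : R, 0 < delta &
    forall h : R[i], h != 0 -> cnorm h < delta ->
      cnorm ((f (z + h) - f z) / h - d) < e.

Definition deriv_on_disk (f f' : R[i] -> R[i]) : Prop :=
  forall z, disk z -> has_cderiv f z (f' z).

Definition analytic_disk (f : R[i] -> R[i]) : Prop :=
  exists f', deriv_on_disk f f'.

Definition Hinf_unit_ball (f : R[i] -> R[i]) : Prop :=
  analytic_disk f /\ forall z, disk z -> cnorm (f z) <= 1.

Definition bloch (f : R[i] -> R[i]) : Prop :=
  exists f', deriv_on_disk f f' /\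
    exists M : R, forall z, disk z -> (1 - cnorm z) * cnorm (f' z) <= M.

Definition diskR2 : set (R * R) := [set p | p.1 ^+ 2 + p.2 ^+ 2 < 1].

(* W^1 = { g analytic : |g(0)| + \int_D |g'| dA < oo } (dA = normalized area
   measure dx dy / pi) *)
Definition W1 (g : R[i] -> R[i]) : Prop :=
  exists g', deriv_on_disk g g' /\
    ((cnorm (g 0))%:E +
     (pi^-1)%:E * \int[(@lebesgue_measure R \x @lebesgue_measure R)%E]_(p in diskR2)
        (cnorm (g' (Complex p.1 p.2)))%:E < +oo)%E.

Definition pair_integrand (f g : R[i] -> R[i]) (r t : R) : R[i] :=
  f (r%:C * ucirc t) * (g (r%:C * ucirc t))^*.

Definition bpair (f g : R[i] -> R[i]) : R[i] :=
  Complex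
    (lim ((fun r => Rintegral (@lebesgue_measure R) `[0, 1[
              (fun t => complex.Re (pair_integrand f g r t))) @ (1:R)^'-))
    (lim ((fun r => Rintegral (@lebesgue_measure R) `[0, 1[
              (fun t => complex.Im (pair_integrand f g r t))) @ (1:R)^'-)).

(* f is cyclic in B: every element g of B lies in the weak-star
   (sigma(B, W^1)) closure of { p f : p polynomial }, i.e. every basic
   weak-star neighbourhood of g meets { p f } *)
Definition cyclic_bloch (f : R[i] -> R[i]) : Prop :=
  forall g, bloch g ->
  forall (n : nat) (gs : 'I_n -> R[i] -> R[i]), (forall k, W1 (gs k)) ->
  forall eps : R, 0 < eps ->
  exists p : {poly R[i]},
    forall k, cnorm (bpair (fun z => p.[z] * f z - g z) (gs k)) < eps.

Definition herglotz (z : R[i]) (t : R) : R[i] := (ucirc t + z) / (ucirc t - z).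

(* nu (a measure on the circle, transported to parameters in [0,1)) is the
   Herglotz-Nevanlinna measure of f: nu is a finite positive measure and
   f(z) = c * exp(- \int (zeta+z)/(zeta-z) dnu(zeta)) with |c| = 1,
   which is f = F S_mu with nu = -log|f| dm + mu. *)
Definition HN_measure (f : R[i] -> R[i]) (nu : {measure set R -> \bar R}) : Prop :=
  (nu (~` `[0%R, 1%R[%classic) = 0)%E /\ (nu `[0%R, 1%R[%classic < +oo)%E /\
  exists c : R[i], cnorm c = 1 /\
    forall z, disk z ->
      f z = c * cexp (- Complex
        (Rintegral nu `[0, 1[ (fun t => complex.Re (herglotz z t)))
        (Rintegral nu `[0, 1[ (fun t => complex.Im (herglotz z t)))).

(* the arc { e^{2 pi i s} : a <= s < a + l } as a subset of the parameter
   space [0,1); its normalized length is l (for 0 < l <= 1) *)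
Definition carc (a l : R) : set R :=
  [set t | 0 <= t < 1 /\ exists k : int, a <= t + k%:~R < a + l].

Definition avg (nu : {measure set R -> \bar R}) (a l : R) : R :=
  fine (nu (carc a l)) / l.

End Defs.

(* Main.v *)
Require Import Defs.
From HB Require Import structures.
From mathcomp Require Import all_boot all_order all_algebra complex.
From mathcomp Require Import all_classical all_reals all_analysis.
From mathcomp Require Import measurable_realfun ring lra.
Set Implicit Arguments. Unset Strict Implicit. Unset Printing Implicit Defensive.
Import Order.TTheory GRing.Theory Num.Theory.
Import numFieldNormedType.Exports.
Local Open Scope classical_set_scope.
Local Open Scope ring_scope.
Local Open Scope complex_scope.

(** Let H(z) be the integral of (u + z) / (u - z) against nu, so that |f| = exp (- Re H)
    and f' = - H' f. For z = r u0, let J be an arc centred at u0 of length l >= 1 - r.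
    Decomposing the circle into dyadic shells around u0 and comparing nu on each shell
    with a multiple of Lebesgue measure, the hypothesis gives
    (1 - r) |H'(z)| <= A exp (- nu(J) / |J|) and, if l is comparable to 1 - r,
    |Re H(z) - nu(J) / |J|| <= A. Hence
    (1 - |z|) |f'(z)| <= B |f(z)| |f(rho z)| for 0 <= rho <= 1.
    This self-bound keeps the Bloch norms of f(z) / f(r z) bounded as r -> 1. Functions
    bounded in the Bloch norm that are small on a large disk pair to something small
    with a fixed g in W^1, by Green's formula with a logarithmic weight. So the
    polynomial multiples P q f, with q close to 1 / f(r z) and P close to a dilate of the
    given Bloch function, converge to that function weak-star. *)

(** The self-bound carries two powers of |f| because q behaves like 1 / f(r z): in f' q one factor
    cancels it, while q' brings 1 / f(r z)^2, which takes both. So the exponential in the hypothesis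
    has to become |f(rho z)| for every rho, not only |f(z)|; the freedom in the length of J supplies
    this, J being matched to 1 - rho r. The obstacle is that averages over arcs longer than J may be
    smaller than nu(J) / |J|, so that the hypothesis is weaker on far shells. But halving a centred
    arc raises exp (nu(J) / |J|) by at most an additive constant, so the loss on the k-th shell is a
    factor linear in k, while the size of the kernel times the length of the shell decays like 2^-k.
    Subtracting a multiple of Lebesgue measure costs nothing, since the kernel of H' has mean zero
    and the Poisson kernel has mean one. It is essential to use only the net mass of the difference
    and its oscillation, for the mass of nu on an arc may be large. Polynomials approximate an
    analytic function together with its derivative on smaller disks; continuity of derivatives,
    measurability and Green's formula are all obtained through them. *)

(** * Complex modulus and points of the unit circle *)

Section ComplexNorm.
Context {R : realType}.
Implicit Types (z w : R[i]) (x : R).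

Lemma cnormE z : cnorm z = ComplexField.Normc.normc z.
Proof. by case: z. Qed.

Lemma cnorm_ge0 z : 0 <= cnorm z. Proof. exact: sqrtr_ge0. Qed.

Lemma cnormM z w : cnorm (z * w) = cnorm z * cnorm w.
Proof. by rewrite !cnormE ComplexField.Normc.normcM. Qed.

Lemma cnormV z : cnorm z^-1 = (cnorm z)^-1.
Proof. by rewrite !cnormE ComplexField.Normc.normcV. Qed.

Lemma cnormf z w : cnorm (z / w) = cnorm z / cnorm w.
Proof. by rewrite cnormM cnormV. Qed.

Lemma cnormD z w : cnorm (z + w) <= cnorm z + cnorm w.
Proof. by rewrite !cnormE; exact: le_normcD. Qed.

Lemma cnormN z : cnorm (- z) = cnorm z.
Proof. by rewrite !cnormE normcN. Qed.

Lemma cnormB z w : cnorm (z - w) <= cnorm z + cnorm w.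
Proof. by rewrite (le_trans (cnormD _ _))// cnormN. Qed.

Lemma cdistC z w : cnorm (z - w) = cnorm (w - z).
Proof. by rewrite -cnormN opprB. Qed.

Lemma cnorm_le_sub z w : cnorm z <= cnorm w + cnorm (z - w).
Proof. by rewrite -{1}(subrK w z) addrC cnormD. Qed.

Lemma cnorm0 : cnorm (0 : R[i]) = 0.
Proof. by rewrite cnormE ComplexField.Normc.normc0. Qed.

Lemma cnorm_real x : cnorm x%:C = `|x|.
Proof. by rewrite /cnorm /= expr0n addr0 sqrtr_sqr. Qed.

Lemma cnorm1 : cnorm (1 : R[i]) = 1.
Proof. by rewrite (_ : 1 = 1%:C)// cnorm_real normr1. Qed.

Lemma cnorm_eq0 z : (cnorm z == 0) = (z == 0).
Proof.
apply/eqP/eqP => [|->]; last exact: cnorm0.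
by rewrite cnormE => /ComplexField.Normc.eq0_normc.
Qed.

Lemma cnorm_gt0 z : (0 < cnorm z) = (z != 0).
Proof. by rewrite lt_def cnorm_ge0 andbT cnorm_eq0. Qed.

Lemma cnormX z n : cnorm (z ^+ n) = cnorm z ^+ n.
Proof. by elim: n => [|n ih]; rewrite ?expr0 ?cnorm1// !exprS cnormM ih. Qed.

Lemma cnormJ z : cnorm (z^*) = cnorm z.
Proof. by case: z => a b; rewrite /cnorm /= sqrrN. Qed.

Lemma cnorm_sqr z : cnorm z ^+ 2 = complex.Re z ^+ 2 + complex.Im z ^+ 2.
Proof. by rewrite sqr_sqrtr// addr_ge0// sqr_ge0. Qed.

Lemma normRe_le z : `|complex.Re z| <= cnorm z.
Proof.
by rewrite -(@ler_pXn2r _ 2)// ?nnegrE ?cnorm_ge0// cnorm_sqr real_normK ?num_real//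
  lerDl sqr_ge0.
Qed.

Lemma normIm_le z : `|complex.Im z| <= cnorm z.
Proof.
by rewrite -(@ler_pXn2r _ 2)// ?nnegrE ?cnorm_ge0// cnorm_sqr real_normK ?num_real//
  lerDr sqr_ge0.
Qed.

Lemma cnorm_le_ReIm z : cnorm z <= `|complex.Re z| + `|complex.Im z|.
Proof.
rewrite -(@ler_pXn2r _ 2)// ?nnegrE ?cnorm_ge0 ?addr_ge0// cnorm_sqr sqrrD.
rewrite !real_normK ?num_real//.
have : 0 <= `|complex.Re z| * `|complex.Im z| by rewrite mulr_ge0.
lra.
Qed.

Lemma cReD z w : complex.Re (z + w) = complex.Re z + complex.Re w.
Proof. by case: z; case: w. Qed.
Lemma cImD z w : complex.Im (z + w) = complex.Im z + complex.Im w.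
Proof. by case: z; case: w. Qed.
Lemma cReN z : complex.Re (- z) = - complex.Re z.
Proof. by case: z. Qed.
Lemma cImN z : complex.Im (- z) = - complex.Im z.
Proof. by case: z. Qed.
Lemma cReM z w : complex.Re (z * w) =
  complex.Re z * complex.Re w - complex.Im z * complex.Im w.
Proof. by case: z; case: w. Qed.
Lemma cImM z w : complex.Im (z * w) =
  complex.Re z * complex.Im w + complex.Im z * complex.Re w.
Proof. by case: z => a b; case: w. Qed.

Lemma cReJ z : complex.Re (z^*) = complex.Re z. Proof. by case: z. Qed.
Lemma cImJ z : complex.Im (z^*) = - complex.Im z. Proof. by case: z. Qed.

Lemma mulc_conj z : z * z^* = (cnorm z ^+ 2)%:C.
Proof.
rewrite cnorm_sqr; case: z => a b /=; apply/eqP; rewrite eq_complex /=.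
by apply/andP; split; apply/eqP; ring.
Qed.

Lemma cnorm_ucirc (t : R) : cnorm (ucirc t) = 1.
Proof. by rewrite /cnorm /= cos2Dsin2 sqrtr1. Qed.

Lemma ucirc_neq0 (t : R) : ucirc t != 0.
Proof. by rewrite -cnorm_gt0 cnorm_ucirc. Qed.

Lemma ucircD (s t : R) : ucirc (s + t) = ucirc s * ucirc t.
Proof.
apply/eqP; rewrite eq_complex /= mulrDr cosD sinD.
by apply/andP; split; apply/eqP; ring.
Qed.

Lemma ucircN (t : R) : ucirc (- t) = (ucirc t)^*.
Proof. by rewrite /ucirc mulrN cosN sinN. Qed.

Lemma ucirc0 : ucirc (0 : R) = 1.
Proof. by rewrite /ucirc mulr0 cos0 sin0. Qed.

Lemma ucirc1 : ucirc (1 : R) = 1.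
Proof. by rewrite /ucirc mulr1 mulr_natl cos2pi sin2pi. Qed.

Lemma ucirc_int (k : int) : ucirc (k%:~R : R) = 1.
Proof.
have nat n : ucirc (n%:R : R) = 1.
  by elim: n => [|n ih]; rewrite ?ucirc0// -[n.+1]addn1 natrD ucircD ih ucirc1 mulr1.
case: k => n; first exact: nat.
by rewrite NegzE mulrNz ucircN nat conjc1.
Qed.

Lemma ucircDint (t : R) (k : int) : ucirc (t + k%:~R) = ucirc t.
Proof. by rewrite ucircD ucirc_int mulr1. Qed.

Lemma disk_real_ucirc (r t : R) : 0 <= r -> r < 1 -> disk (r%:C * ucirc t).
Proof. by move=> r0 r1; rewrite /disk /= cnormM cnorm_ucirc cnorm_real mulr1 ger0_norm. Qed.

End ComplexNorm.

(** * Complex differentiability and its algebra *)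

Section CDeriv.
Context {R : realType}.
Implicit Types (f g : R[i] -> R[i]) (z w d : R[i]).

(** Clearing the quotient admits h = 0, so increments that may vanish, as in products and
    compositions, need no case distinction. *)
Lemma has_cderivP f z d : has_cderiv f z d <->
  forall e : R, 0 < e -> exists2 delta : R, 0 < delta & forall h : R[i],
    cnorm h < delta -> cnorm (f (z + h) - f z - d * h) <= e * cnorm h.
Proof.
split=> [fd e e0|fd e e0].
- have [del del0 H] := fd e e0; exists del => // h hd.
  have [->|h0] := eqVneq h 0; first by rewrite addr0 subrr mulr0 subr0 cnorm0 mulr0.
  rewrite (_ : _ - _ = ((f (z + h) - f z) / h - d) * h); last by field.
  by rewrite cnormM ler_wpM2r ?cnorm_ge0// ltW// H.
- have [del del0 H] := fd (e / 2) (divr_gt0 e0 (ltr0Sn _ 1)); exists del => // h h0 hd.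
  rewrite (_ : _ - d = (f (z + h) - f z - d * h) / h); last by field.
  rewrite cnormf ltr_pdivrMr ?cnorm_gt0//; apply: le_lt_trans (H _ hd) _.
  by rewrite ltr_pM2r ?cnorm_gt0//; lra.
Qed.

Lemma has_cderiv_lip f z d : has_cderiv f z d ->
  exists2 delta : R, 0 < delta & forall h : R[i],
    cnorm h < delta -> cnorm (f (z + h) - f z) <= (cnorm d + 1) * cnorm h.
Proof.
move=> /has_cderivP/(_ 1 ltr01)[del del0 H]; exists del => // h hd.
rewrite -(subrK (d * h) (f _ - _)); apply: le_trans (cnormD _ _) _.
by have := H _ hd; rewrite cnormM; lra.
Qed.

Lemma has_cderiv_cont f z d : has_cderiv f z d -> forall e : R, 0 < e ->
  exists2 delta : R, 0 < delta & forall h : R[i],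
    cnorm h < delta -> cnorm (f (z + h) - f z) < e.
Proof.
move=> /has_cderiv_lip[del del0 H] e e0.
have d1 : 0 < cnorm d + 1 by rewrite ltr_wpDl ?cnorm_ge0.
exists (Num.min del (e / (cnorm d + 1))); first by rewrite lt_min del0 divr_gt0.
move=> h; rewrite lt_min => /andP[hd he]; apply: le_lt_trans (H _ hd) _.
by rewrite mulrC -ltr_pdivlMr.
Qed.

Lemma has_cderiv_ext f g z d : (exists2 r : R, 0 < r & forall w, cnorm (w - z) < r -> f w = g w) ->
  has_cderiv f z d -> has_cderiv g z d.
Proof.
move=> [r r0 fg] fd e e0; have [del del0 H] := fd e e0.
exists (Num.min del r); first by rewrite lt_min del0.
move=> h h0; rewrite lt_min => /andP[hd hr]; rewrite -!fg ?H//.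
  by rewrite subrr cnorm0.
by rewrite addrAC subrr add0r.
Qed.

Lemma has_cderiv_cst c z : has_cderiv (fun=> c) z 0.
Proof.
move=> e e0; exists 1 => // h _ _.
by rewrite subrr mul0r subrr cnorm0.
Qed.

Lemma has_cderiv_id z : has_cderiv id z 1.
Proof.
move=> e e0; exists 1 => // h h0 _.
by rewrite (addrC z) addrK divff// subrr cnorm0.
Qed.

Lemma has_cderivD f g z d1 d2 : has_cderiv f z d1 -> has_cderiv g z d2 ->
  has_cderiv (fun w => f w + g w) z (d1 + d2).
Proof.
move=> H1 H2 e e0.
have e2 : 0 < e / 2 by rewrite divr_gt0.
have [u u0 Hu] := H1 _ e2; have [v v0 Hv] := H2 _ e2.
exists (Num.min u v); first by rewrite lt_min u0 v0.
move=> h h0; rewrite lt_min => /andP[hu hv].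
have := Hu _ h0 hu; have := Hv _ h0 hv.
rewrite (_ : _ / h - (d1 + d2) = ((f (z + h) - f z) / h - d1) + ((g (z + h) - g z) / h - d2)); last by field.
by move=> *; apply: le_lt_trans (cnormD _ _) _; lra.
Qed.

Lemma has_cderivM f g z d1 d2 : has_cderiv f z d1 -> has_cderiv g z d2 ->
  has_cderiv (fun w => f w * g w) z (d1 * g z + f z * d2).
Proof.
move=> H1 H2; apply/has_cderivP => e e0.
pose K := cnorm (g z) + cnorm (f z) + cnorm d1 + 2.
have K0 : 0 < K by rewrite /K; have := cnorm_ge0 (g z); have := cnorm_ge0 (f z); have := cnorm_ge0 d1; lra.
pose e' := e / K.
have e'0 : 0 < e' by rewrite divr_gt0.
have [u u0 Hu] := (has_cderivP _ _ _).1 H1 _ e'0.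
have [v v0 Hv] := (has_cderivP _ _ _).1 H2 _ e'0.
have [l l0 Hl] := has_cderiv_lip H1.
have [c c0 Hc] := has_cderiv_cont H2 e'0.
exists (Num.min (Num.min u v) (Num.min l c)); first by rewrite !lt_min u0 v0 l0 c0.
move=> h; rewrite !lt_min => /andP[/andP[hu hv] /andP[hl hc]].
rewrite (_ : _ - _ = (f (z + h) - f z - d1 * h) * g z + (f z * (g (z + h) - g z - d2 * h))
   + (f (z + h) - f z) * (g (z + h) - g z)); last by ring.
apply: le_trans (cnormD _ _) _; apply: le_trans (lerD (cnormD _ _) (lexx _)) _.
rewrite !cnormM.
have h0 := cnorm_ge0 h.
have b1 : cnorm (f (z + h) - f z - d1 * h) * cnorm (g z) <= e' * cnorm h * cnorm (g z).
  by rewrite ler_wpM2r ?cnorm_ge0 ?Hu.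
have b2 : cnorm (f z) * cnorm (g (z + h) - g z - d2 * h) <= cnorm (f z) * (e' * cnorm h).
  by rewrite ler_wpM2l ?cnorm_ge0 ?Hv.
have b3 : cnorm (f (z + h) - f z) * cnorm (g (z + h) - g z) <= (cnorm d1 + 1) * cnorm h * e'.
  by rewrite ler_pM ?cnorm_ge0 ?Hl// ltW ?Hc.
have -> : e * cnorm h = e' * K * cnorm h by rewrite /e' divfK// gt_eqF.
apply: le_trans (lerD (lerD b1 b2) b3) _; rewrite /K.
have : 0 <= e' * cnorm h by rewrite mulr_ge0// ltW.
lra.
Qed.

Lemma has_cderivV f z d : f z != 0 -> has_cderiv f z d ->
  has_cderiv (fun w => (f w)^-1) z (- d / f z ^+ 2).
Proof.
move=> fz H; apply/has_cderivP => e e0.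
have fz0 : 0 < cnorm (f z) by rewrite cnorm_gt0.
set a := cnorm (f z) in fz0.
pose K := 2 / a ^+ 2 + 2 * (cnorm d) * (cnorm d + 1) / a ^+ 3.
have fh2 : 0 < a / 2 by rewrite divr_gt0.
pose L := cnorm d + 1.
have L0 : 0 < L by rewrite /L ltr_wpDl ?cnorm_ge0.
have e1 : 0 < e * a ^+ 2 / 4 by rewrite divr_gt0// mulr_gt0// exprn_gt0.
have e2 : 0 < e * a ^+ 3 / (4 * L ^+ 2).
  by rewrite !(divr_gt0, mulr_gt0, exprn_gt0).
have [c c0 Hc] := has_cderiv_cont H fh2.
have [u u0 Hu] := (has_cderivP _ _ _).1 H _ e1.
have [l l0 Hl] := has_cderiv_lip H.
exists (Num.min (Num.min c u) (Num.min l (e * a ^+ 3 / (4 * L ^+ 2)))).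
  by rewrite !lt_min c0 u0 l0 e2.
move=> h; rewrite !lt_min => /andP[/andP[hc hu] /andP[hl he]].
have fa : a / 2 <= cnorm (f (z + h)).
  have := cnorm_le_sub (f z) (f (z + h)); rewrite -/a cdistC; have := Hc _ hc; lra.
have fa0 : 0 < cnorm (f (z + h)) by apply: lt_le_trans fa.
have fzh : f (z + h) != 0 by rewrite -cnorm_gt0.
rewrite (_ : _ - _ = - (f (z + h) - f z - d * h) / (f z * f (z + h))
   + d * h * (f (z + h) - f z) / (f z ^+ 2 * f (z + h))); last by field; rewrite fz fzh.
apply: le_trans (cnormD _ _) _; rewrite !cnormf cnormN !(cnormX, cnormM) -/a.
have h0 := cnorm_ge0 h.
have b1 : cnorm (f (z + h) - f z - d * h) / (a * cnorm (f (z + h))) <= e / 2 * cnorm h.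
  rewrite ler_pdivrMr ?mulr_gt0//; apply: le_trans (Hu _ hu) _.
  have -> : e * a ^+ 2 / 4 * cnorm h = e / 2 * cnorm h * (a * (a / 2)) by field.
  by rewrite ler_wpM2l ?ler_wpM2l// ?mulr_ge0// ?divr_ge0// ltW.
have b2 : cnorm d * cnorm h * cnorm (f (z + h) - f z) / (a ^+ 2 * cnorm (f (z + h))) <= e / 2 * cnorm h.
  rewrite ler_pdivrMr ?mulr_gt0 ?exprn_gt0//.
  have p1 : cnorm d * cnorm h * cnorm (f (z + h) - f z) <= L * cnorm h * (L * cnorm h).
    by rewrite ler_pM ?mulr_ge0 ?cnorm_ge0 ?ler_wpM2r ?Hl// /L; lra.
  apply: le_trans p1 _.
  have p2 : L * cnorm h * (L * cnorm h) <= L * cnorm h * (L * (e * a ^+ 3 / (4 * L ^+ 2))).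
    by rewrite ler_wpM2l ?ler_wpM2l ?mulr_ge0// ltW.
  apply: le_trans p2 _.
  have -> : L * cnorm h * (L * (e * a ^+ 3 / (4 * L ^+ 2))) = e / 2 * cnorm h * (a ^+ 2 * (a / 2)).
    by field; rewrite gt_eqF.
  by rewrite ler_wpM2l ?ler_wpM2l ?mulr_ge0 ?exprn_ge0 ?divr_ge0// ltW.
by apply: le_trans (lerD b1 b2) _; lra.
Qed.

Lemma has_cderivZ f z d c : has_cderiv f z d -> has_cderiv (fun w => c * f w) z (c * d).
Proof.
move=> H; have := has_cderivM (has_cderiv_cst c z) H.
by rewrite mul0r add0r.
Qed.

Lemma has_cderiv_poly (p : {poly R[i]}) z : has_cderiv (fun w => p.[w]) z p^`().[z].
Proof.
elim/poly_ind: p => [|p c ih].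
  rewrite deriv0 horner0; apply: has_cderiv_ext (has_cderiv_cst 0 z).
  by exists 1 => // w _; rewrite horner0.
rewrite derivD derivC addr0 derivM derivX mulr1 hornerD hornerM hornerX addrC.
have := has_cderivD (has_cderivM ih (has_cderiv_id z)) (has_cderiv_cst c z).
rewrite addr0 mulr1 addrC => H.
apply: has_cderiv_ext H.
by exists 1 => // w _; rewrite hornerMXaddC.
Qed.

End CDeriv.

(** * Integrals of complex-valued functions *)

Section ComplexIntegral.
Context d (T : measurableType d) (R : realType) (mu : {measure set T -> \bar R}).
Implicit Types (F G : T -> R[i]) (D : set T).

Definition cint D F : R[i] :=
  Complex (\int[mu]_(x in D) complex.Re (F x)) (\int[mu]_(x in D) complex.Im (F x)).

Definition cintegrable D F :=
  mu.-integrable D (EFin \o (fun x => complex.Re (F x))) /\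
  mu.-integrable D (EFin \o (fun x => complex.Im (F x))).

Lemma eq_cint D F G : {in D, F =1 G} -> cint D F = cint D G.
Proof.
by move=> FG; rewrite /cint; congr Complex; apply: eq_Rintegral => x xD; rewrite FG.
Qed.

Lemma integrableD_EFin D (f g : T -> R) : measurable D ->
  mu.-integrable D (EFin \o f) -> mu.-integrable D (EFin \o g) ->
  mu.-integrable D (EFin \o (fun x => f x + g x)).
Proof.
move=> mD fi gi; rewrite (_ : _ \o _ = (EFin \o f) \+ (EFin \o g))%E.
  exact: integrableD.
by apply/funext => x /=; rewrite EFinD.
Qed.

Lemma integrableZ_EFin D (f : T -> R) (k : R) : measurable D ->
  mu.-integrable D (EFin \o f) -> mu.-integrable D (EFin \o (fun x => k * f x)).
Proof.
move=> mD fi; rewrite (_ : _ \o _ = (fun x => k%:E * (EFin \o f) x))%E.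
  exact: integrableZl.
by apply/funext => x /=; rewrite EFinM.
Qed.

Lemma integrableB_EFin D (f g : T -> R) : measurable D ->
  mu.-integrable D (EFin \o f) -> mu.-integrable D (EFin \o g) ->
  mu.-integrable D (EFin \o (fun x => f x - g x)).
Proof.
move=> mD fi gi; rewrite (_ : _ \o _ = (EFin \o f) \- (EFin \o g))%E.
  exact: integrableB.
by apply/funext => x /=; rewrite EFinB.
Qed.

Lemma integrableS_le D (f g : T -> R) : measurable D ->
  measurable_fun D f -> mu.-integrable D (EFin \o g) ->
  (forall x, D x -> `|f x| <= g x) -> mu.-integrable D (EFin \o f).
Proof.
move=> mD mf gi fg; apply: (le_integrable mD) gi; first exact/measurable_EFinP.
by move=> x Dx /=; rewrite lee_fin (le_trans (fg _ Dx))// ler_norm.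
Qed.

Lemma cintegrableD D F G : measurable D -> cintegrable D F -> cintegrable D G ->
  cintegrable D (fun x => F x + G x).
Proof.
move=> mD [f1 f2] [g1 g2]; split.
- rewrite (_ : (fun x => complex.Re _) = fun x => complex.Re (F x) + complex.Re (G x)).
    exact: integrableD_EFin.
  by apply/funext => x; rewrite cReD.
- rewrite (_ : (fun x => complex.Im _) = fun x => complex.Im (F x) + complex.Im (G x)).
    exact: integrableD_EFin.
  by apply/funext => x; rewrite cImD.
Qed.

Lemma cintegrableZ D F c : measurable D -> cintegrable D F ->
  cintegrable D (fun x => c * F x).
Proof.
move=> mD [f1 f2]; split.
- rewrite (_ : (fun x => complex.Re _) = fun x =>
    complex.Re c * complex.Re (F x) - complex.Im c * complex.Im (F x)).
    by apply: integrableB_EFin => //; exact: integrableZ_EFin.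
  by apply/funext => x; rewrite cReM.
- rewrite (_ : (fun x => complex.Im _) = fun x =>
    complex.Re c * complex.Im (F x) + complex.Im c * complex.Re (F x)).
    by apply: integrableD_EFin => //; exact: integrableZ_EFin.
  by apply/funext => x; rewrite cImM.
Qed.

Lemma cintegrableB D F G : measurable D -> cintegrable D F -> cintegrable D G ->
  cintegrable D (fun x => F x - G x).
Proof.
move=> mD iF iG; rewrite (_ : (fun x => _) = fun x => F x + (-1) * G x).
  by apply: cintegrableD => //; exact: cintegrableZ.
by apply/funext => x; rewrite mulN1r.
Qed.

Lemma cintD D F G : measurable D -> cintegrable D F -> cintegrable D G ->
  cint D (fun x => F x + G x) = cint D F + cint D G.
Proof.
move=> mD [f1 f2] [g1 g2]; apply/eqP; rewrite eq_complex /=; apply/andP; split; apply/eqP.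
- by rewrite -RintegralD//; apply: eq_Rintegral => x _; rewrite cReD.
- by rewrite -RintegralD//; apply: eq_Rintegral => x _; rewrite cImD.
Qed.

Lemma cintZ D F c : measurable D -> cintegrable D F ->
  cint D (fun x => c * F x) = c * cint D F.
Proof.
move=> mD [f1 f2]; apply/eqP; rewrite eq_complex cReM cImM /=; apply/andP; split; apply/eqP.
- rewrite -!RintegralZl// -RintegralB//; try exact: integrableZ_EFin.
  by apply: eq_Rintegral => x _; rewrite cReM.
- rewrite -!RintegralZl// -RintegralD//; try exact: integrableZ_EFin.
  by apply: eq_Rintegral => x _; rewrite cImM.
Qed.

Lemma cintB D F G : measurable D -> cintegrable D F -> cintegrable D G ->
  cint D (fun x => F x - G x) = cint D F - cint D G.
Proof.
move=> mD iF iG; rewrite -mulN1r -cintZ// -cintD//; last exact: cintegrableZ.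
by apply: eq_cint => x _; rewrite mulN1r.
Qed.

Lemma cintegrable_meas D F : measurable D -> cintegrable D F ->
  measurable_fun D (fun x => cnorm (F x)).
Proof.
move=> mD [/measurable_int/measurable_EFinP f1 /measurable_int/measurable_EFinP f2].
apply: (@measurableT_comp _ _ _ _ _ _ (@Num.sqrt R)).
  by apply: continuous_measurable_fun; exact: sqrt_continuous.
by apply: measurable_funD; apply: (@measurableT_comp _ _ _ _ _ _ (fun x : R => x ^+ 2)).
Qed.

Lemma integrable_cnorm D F : measurable D -> cintegrable D F ->
  mu.-integrable D (EFin \o (fun x => cnorm (F x))).
Proof.
move=> mD iF; have mF := cintegrable_meas mD iF.
have [f1 f2] := iF.
apply: (integrableS_le mD mF (g := fun x => `|complex.Re (F x)| + `|complex.Im (F x)|)).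
  by apply: integrableD_EFin => //; apply: integrable_norm.
by move=> x _; rewrite ger0_norm ?cnorm_ge0// cnorm_le_ReIm.
Qed.

Lemma cnorm_cint D F : measurable D -> cintegrable D F ->
  cnorm (cint D F) <= \int[mu]_(x in D) cnorm (F x).
Proof.
move=> mD iF; set I := cint D F.
have [I0|I0] := eqVneq I 0.
  by rewrite I0 cnorm0; apply: Rintegral_ge0 => x _; exact: cnorm_ge0.
have cI : 0 < cnorm I by rewrite cnorm_gt0.
(* The unimodular [c] rotates the integral onto the positive real axis, where its modulus is the
   integral of a real part. *)
pose c := I^* / (cnorm I)%:C.
have c1 : cnorm c = 1 by rewrite cnormf cnormJ cnorm_real ger0_norm ?cnorm_ge0// divff// gt_eqF.
have -> : cnorm I = complex.Re (cint D (fun x => c * F x)).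
  rewrite cintZ// -/I (_ : c * I = (cnorm I)%:C)//.
  rewrite /c mulrAC (mulrC I^*) mulc_conj expr2 rmorphM /= mulfK//.
  by rewrite -cnorm_gt0 cnorm_real ger0_norm ?cnorm_ge0.
apply: le_Rintegral => //.
- by have [] := cintegrableZ c mD iF.
- exact: integrable_cnorm.
- move=> x _; apply: le_trans (ler_norm _) _; apply: le_trans (normRe_le _) _.
  by rewrite cnormM c1 mul1r.
Qed.

Lemma cintegrable_bounded D F M : measurable D -> (mu D < +oo)%E ->
  measurable_fun D (fun x => complex.Re (F x)) ->
  measurable_fun D (fun x => complex.Im (F x)) ->
  (forall x, D x -> cnorm (F x) <= M) -> cintegrable D F.
Proof.
move=> mD muD m1 m2 FM.
by split; apply: measurable_bounded_integrable => //; exists M; split;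
  rewrite ?num_real// => x Mx y Dy; apply: le_trans (ltW Mx);
  apply: le_trans (FM _ Dy); rewrite ?normRe_le ?normIm_le.
Qed.

Lemma cnorm_cint_le D F M : measurable D -> (mu D < +oo)%E -> cintegrable D F ->
  (forall x, D x -> cnorm (F x) <= M) -> cnorm (cint D F) <= M * fine (mu D).
Proof.
move=> mD muD iF FM; apply: le_trans (cnorm_cint mD iF) _.
rewrite -Rintegral_cst//; apply: le_Rintegral => //; first exact: integrable_cnorm.
apply: measurable_bounded_integrable => //; exists `|M|; split; rewrite ?num_real// => x Mx y _.
exact: ltW.
Qed.

Lemma cint_cst D c : measurable D -> cint D (fun=> c) = c * (fine (mu D))%:C.
Proof.
move=> mD; apply/eqP; rewrite eq_complex cReM cImM /= !Rintegral_cst//.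
by apply/andP; split; apply/eqP; ring.
Qed.

End ComplexIntegral.

(** * Continuity and integrals along a real parameter *)

Section ComplexContinuity.
Context {R : realType}.
Implicit Types (F G : R -> R[i]) (t : R).

Definition ccont F t :=
  {for t, continuous (fun x => complex.Re (F x))} /\
  {for t, continuous (fun x => complex.Im (F x))}.

Lemma continuous_ballP (f : R -> R) t : {for t, continuous f} <->
  forall e, 0 < e -> exists2 d, 0 < d & forall s, `|s - t| < d -> `|f s - f t| < e.
Proof.
split=> [ft e e0|H].
- have /cvgrPdist_lt/(_ _ e0)/nbhs_ballP[d d0 H] := ft.
  exists d => // s st; rewrite distrC; apply: H.
  by rewrite /ball /= distrC.
- apply/cvgrPdist_lt => e e0; have [d d0 H'] := H _ e0.
  apply/nbhs_ballP; exists d => // s; rewrite /ball /= => st.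
  by rewrite distrC H'// distrC.
Qed.

(** The componentwise form feeds the real integration lemmas; the form with [cnorm] is the one that
    composes with complex functions. *)
Lemma ccontP F t : ccont F t <->
  forall e, 0 < e -> exists2 d, 0 < d & forall s, `|s - t| < d -> cnorm (F s - F t) < e.
Proof.
split=> [[/continuous_ballP f1 /continuous_ballP f2] e e0|H].
- have e2 : 0 < e / 2 by rewrite divr_gt0.
  have [u u0 Hu] := f1 _ e2; have [v v0 Hv] := f2 _ e2.
  exists (Num.min u v); first by rewrite lt_min u0.
  move=> s; rewrite lt_min => /andP[su sv].
  apply: le_lt_trans (cnorm_le_ReIm _) _; rewrite cReD cReN cImD cImN.
  by have := Hu _ su; have := Hv _ sv; lra.
- split; apply/continuous_ballP => e /H[d d0 Hd]; exists d => // s /Hd; apply: le_lt_trans.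
    by apply: le_trans (normRe_le _); rewrite cReD cReN.
  by apply: le_trans (normIm_le _); rewrite cImD cImN.
Qed.

Lemma ccont_cst c t : ccont (fun=> c) t.
Proof. by split; exact: cvg_cst. Qed.

Lemma ccontD F G t : ccont F t -> ccont G t -> ccont (fun x => F x + G x) t.
Proof.
move=> [f1 f2] [g1 g2]; split.
- rewrite (_ : (fun x => _) = fun x => complex.Re (F x) + complex.Re (G x)).
    exact: cvgD.
  by apply/funext => x; rewrite cReD.
- rewrite (_ : (fun x => _) = fun x => complex.Im (F x) + complex.Im (G x)).
    exact: cvgD.
  by apply/funext => x; rewrite cImD.
Qed.

Lemma ccontM F G t : ccont F t -> ccont G t -> ccont (fun x => F x * G x) t.
Proof.
move=> [f1 f2] [g1 g2]; split.
- rewrite (_ : (fun x => _) = fun x => complex.Re (F x) * complex.Re (G x) -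
    complex.Im (F x) * complex.Im (G x)).
    by apply: cvgB; exact: cvgM.
  by apply/funext => x; rewrite cReM.
- rewrite (_ : (fun x => _) = fun x => complex.Re (F x) * complex.Im (G x) +
    complex.Im (F x) * complex.Re (G x)).
    by apply: cvgD; exact: cvgM.
  by apply/funext => x; rewrite cImM.
Qed.

Lemma ccontB F G t : ccont F t -> ccont G t -> ccont (fun x => F x - G x) t.
Proof.
move=> cF cG; rewrite (_ : (fun x => _) = fun x => F x + (-1) * G x).
  by apply: ccontD cF _; apply: ccontM cG; exact: ccont_cst.
by apply/funext => x; rewrite mulN1r.
Qed.

Lemma ccontJ F t : ccont F t -> ccont (fun x => (F x)^*) t.
Proof.
move=> [f1 f2]; split.
- by rewrite (_ : (fun x => _) = fun x => complex.Re (F x))//; apply/funext => x; rewrite cReJ.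
- rewrite (_ : (fun x => _) = fun x => - complex.Im (F x)).
    exact: cvgN.
  by apply/funext => x; rewrite cImJ.
Qed.

Lemma ccont_real (f : R -> R) t : {for t, continuous f} -> ccont (fun x => (f x)%:C) t.
Proof. by move=> cf; split => //=; exact: cvg_cst. Qed.

Lemma ccont_ucirc t : ccont (@ucirc R) t.
Proof.
have c2 : {for t, continuous (fun x : R => 2 * pi * x)}.
  by apply: cvgM; [exact: cvg_cst|exact: cvg_id].
split=> /=.
- by apply: (@continuous_comp _ _ _ (fun x : R => 2 * pi * x) cos) => //; exact: continuous_cos.
- by apply: (@continuous_comp _ _ _ (fun x : R => 2 * pi * x) sin) => //; exact: continuous_sin.
Qed.

Lemma ccont_comp (f : R[i] -> R[i]) F t :
  (forall e, 0 < e -> exists2 d, 0 < d &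
    forall h, cnorm h < d -> cnorm (f (F t + h) - f (F t)) < e) ->
  ccont F t -> ccont (fun x => f (F x)) t.
Proof.
move=> cf /ccontP cF; apply/ccontP => e /cf[d d0 Hd].
have [u u0 Hu] := cF _ d0; exists u => // s /Hu /Hd.
by rewrite (addrC (F t)) subrK.
Qed.

Lemma ccont_comp_cderiv (f : R[i] -> R[i]) F t d : has_cderiv f (F t) d ->
  ccont F t -> ccont (fun x => f (F x)) t.
Proof. by move=> /has_cderiv_cont; exact: ccont_comp. Qed.

Lemma ccontV F t : F t != 0 -> ccont F t -> ccont (fun x => (F x)^-1) t.
Proof.
move=> Ft; apply: (ccont_comp_cderiv (f := fun z => z^-1)).
exact: has_cderivV (has_cderiv_id _).
Qed.

Lemma ccontX F n t : ccont F t -> ccont (fun x => F x ^+ n) t.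
Proof.
move=> cF; elim: n => [|n ih]; first exact: ccont_cst.
rewrite (_ : (fun x => _) = fun x => F x * F x ^+ n); first exact: ccontM.
by apply/funext => x; rewrite exprS.
Qed.

Lemma ccont_sum (F_ : nat -> R -> R[i]) n t : (forall k : nat, ccont (F_ k) t) ->
  ccont (fun x => \sum_(k < n) F_ k x) t.
Proof.
move=> cF; elim: n => [|n ih].
  by under eq_fun do rewrite big_ord0; exact: ccont_cst.
under eq_fun do rewrite big_ord_recr /=.
exact: ccontD.
Qed.

Lemma continuous_cnorm F t : ccont F t -> {for t, continuous (fun x => cnorm (F x))}.
Proof.
move=> /ccontP cF; apply/continuous_ballP => e /cF[d d0 H]; exists d => // s /H.
apply: le_lt_trans; rewrite ler_norml; apply/andP; split.
  by rewrite lerNl opprB lerBlDl cdistC cnorm_le_sub.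
by rewrite lerBlDl cnorm_le_sub.
Qed.

Lemma lebesgue_itv_cc (a b : R) : a <= b -> fine (lebesgue_measure `[a, b]) = b - a.
Proof.
by rewrite lebesgue_measure_itv /= lte_fin le_eqVlt => /predU1P[->|->//]; rewrite ltxx subrr.
Qed.

Lemma lebesgue_itv_cc_fin (a b : R) : (lebesgue_measure `[a, b] < +oo)%E.
Proof. by rewrite lebesgue_measure_itv /=; case: ifP => //; rewrite -EFinB ltry. Qed.

Definition cintab a b F := cint lebesgue_measure `[a, b]%classic F.

Definition contab a b F := forall t, a <= t -> t <= b -> ccont F t.

Lemma integrable_itv_cont (a b : R) (f : R -> R) :
  (forall t, a <= t -> t <= b -> {for t, continuous f}) ->
  lebesgue_measure.-integrable `[a, b]%classic (EFin \o f).
Proof.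
move=> cf; apply: continuous_compact_integrable; first exact: segment_compact.
apply: continuous_in_subspaceT => x /set_mem /=; rewrite in_itv /= => /andP[ax xb].
exact: cf.
Qed.

Lemma cintegrable_contab a b F : contab a b F ->
  cintegrable lebesgue_measure `[a, b]%classic F.
Proof.
by move=> cF; split; apply: integrable_itv_cont => t at_ tb; have [] := cF _ at_ tb.
Qed.

Lemma cnorm_cintab a b F M : a <= b -> contab a b F ->
  (forall t, a <= t -> t <= b -> cnorm (F t) <= M) -> cnorm (cintab a b F) <= M * (b - a).
Proof.
move=> ab cF FM; rewrite -lebesgue_itv_cc//; apply: cnorm_cint_le => //.
- exact: lebesgue_itv_cc_fin.
- exact: cintegrable_contab.
- by move=> x; rewrite /= in_itv /= => /andP[]; exact: FM.
Qed.

Lemma eq_cintab a b F G : (forall t, a <= t -> t <= b -> F t = G t) ->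
  cintab a b F = cintab a b G.
Proof.
move=> FG; apply: eq_cint => x /set_mem /=; rewrite in_itv /= => /andP[].
exact: FG.
Qed.

Lemma cintabD a b F G : contab a b F -> contab a b G ->
  cintab a b (fun t => F t + G t) = cintab a b F + cintab a b G.
Proof. by move=> cF cG; apply: cintD => //; exact: cintegrable_contab. Qed.

Lemma cintabB a b F G : contab a b F -> contab a b G ->
  cintab a b (fun t => F t - G t) = cintab a b F - cintab a b G.
Proof. by move=> cF cG; apply: cintB => //; exact: cintegrable_contab. Qed.

Lemma cintabZ a b F c : contab a b F ->
  cintab a b (fun t => c * F t) = c * cintab a b F.
Proof. by move=> cF; apply: cintZ => //; exact: cintegrable_contab. Qed.

Lemma cintab_cst a b c : a <= b -> cintab a b (fun=> c) = c * (b - a)%:C.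
Proof. by move=> ab; rewrite /cintab cint_cst// lebesgue_itv_cc. Qed.

Lemma Rintegral_itv_cat (a b c : R) (f : R -> R) : a <= b -> b <= c ->
  lebesgue_measure.-integrable `[a, c]%classic (EFin \o f) ->
  \int[lebesgue_measure]_(x in `[a, c]) f x =
  \int[lebesgue_measure]_(x in `[a, b]) f x + \int[lebesgue_measure]_(x in `[b, c]) f x.
Proof.
move=> ab bc fi.
have := @Rintegral_itvB _ f (BLeft a) (BRight c) b fi.
rewrite !bnd_simp => /(_ ab bc).
rewrite Rintegral_itv_obnd_cbnd => [<-|]; first by rewrite addrC subrK.
by apply: integrableS fi => // x /=; rewrite !in_itv /= => /andP[bx ->]; rewrite (ltW (le_lt_trans ab bx)).
Qed.

Lemma cintab_cat a b c F : a <= b -> b <= c -> contab a c F ->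
  cintab a c F = cintab a b F + cintab b c F.
Proof.
move=> ab bc /cintegrable_contab[f1 f2]; apply/eqP; rewrite eq_complex /=.
by rewrite !(Rintegral_itv_cat ab bc)// !eqxx.
Qed.

Lemma cintab_sum (a b : R) n (F : nat -> R -> R[i]) : a <= b ->
  (forall k, contab a b (F k)) ->
  cintab a b (fun x => \sum_(k < n) F k x) = \sum_(k < n) cintab a b (F k).
Proof.
move=> ab cF; elim: n => [|n ih].
  rewrite big_ord0 (eq_cintab (G := fun=> 0)); first by rewrite cintab_cst// mul0r.
  by move=> x _ _; rewrite big_ord0.
rewrite big_ord_recr /= -ih -cintabD//.
  by apply: eq_cintab => x _ _; rewrite big_ord_recr.
by move=> x ax xb; apply: ccont_sum => k; exact: cF.
Qed.

End ComplexContinuity.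

(** * Goursat's bisection argument *)

Section Bisection.
Context {R : realType}.

Lemma exp2_small (x d : R) : 0 < d -> exists n, x / 2 ^+ n < d.
Proof.
move=> d0; pose n := Num.truncn (`|x| / d); exists n.+1.
have xn : `|x| / d < n.+1%:R by rewrite truncnS_gt.
have n2 : (n.+1%:R : R) <= 2 ^+ n.+1 by rewrite -natrX ler_nat ltnW// ltn_expl.
rewrite ltr_pdivrMr ?exprn_gt0// mulrC -ltr_pdivrMr//.
apply: le_lt_trans (lt_le_trans xn n2).
by rewrite ler_pM2r ?invr_gt0// ler_norm.
Qed.

(** Goursat's argument for an abstract additive function of rectangles. One of the four quarters
    carries at least a quarter of |E|; the nested quarters shrink to a point, where |E| is at most
    [e] times the square of the side sum. That square loses a factor 4 per step, exactly what |E|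
    may lose, so |E| is below any multiple of [e]. *)
Lemma bisection_additive_eq0 (E : R -> R -> R -> R -> R[i]) (a b c d : R) :
  a <= b -> c <= d ->
  (forall a' m b' c' d', a <= a' -> a' <= m -> m <= b' -> b' <= b ->
     c <= c' -> c' <= d' -> d' <= d -> E a' b' c' d' = E a' m c' d' + E m b' c' d') ->
  (forall a' b' c' m d', a <= a' -> a' <= b' -> b' <= b ->
     c <= c' -> c' <= m -> m <= d' -> d' <= d -> E a' b' c' d' = E a' b' c' m + E a' b' m d') ->
  (forall s t, a <= s -> s <= b -> c <= t -> t <= d -> forall e, 0 < e ->
     exists2 del, 0 < del & forall a' b' c' d', a <= a' -> a' <= s -> s <= b' -> b' <= b ->
       c <= c' -> c' <= t -> t <= d' -> d' <= d -> b' - a' < del -> d' - c' < del ->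
       cnorm (E a' b' c' d') <= e * (b' - a' + (d' - c')) ^+ 2) ->
  E a b c d = 0.
Proof.
move=> ab cd addl addr loc; apply/eqP; rewrite -cnorm_eq0; apply/negPn/negP => En0.
have e0 : 0 < cnorm (E a b c d) by rewrite lt_def En0 cnorm_ge0.
pose EQ (Q : (R * R) * (R * R)) := cnorm (E Q.1.1 Q.1.2 Q.2.1 Q.2.2).
pose ok (Q : (R * R) * (R * R)) := [/\ a <= Q.1.1, Q.1.1 <= Q.1.2 & Q.1.2 <= b] /\
  [/\ c <= Q.2.1, Q.2.1 <= Q.2.2 & Q.2.2 <= d].
pose rel (Q Q' : (R * R) * (R * R)) := [/\ ok Q',
  [/\ Q.1.1 <= Q'.1.1, Q'.1.2 <= Q.1.2 & Q'.1.2 - Q'.1.1 = (Q.1.2 - Q.1.1) / 2],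
  [/\ Q.2.1 <= Q'.2.1, Q'.2.2 <= Q.2.2 & Q'.2.2 - Q'.2.1 = (Q.2.2 - Q.2.1) / 2] &
  EQ Q <= 4 * EQ Q'].
have step Q : exists Q', ok Q -> rel Q Q'.
  case: (pselect (ok Q)) => [|nok]; last by exists Q => /nok.
  move: Q => [[a1 b1] [c1 d1]] /= [[/= h1 h2 h3] [h4 h5 h6]].
  pose m := (a1 + b1) / 2; pose n := (c1 + d1) / 2.
  have am : a1 <= m by rewrite /m; lra.
  have mb : m <= b1 by rewrite /m; lra.
  have cn : c1 <= n by rewrite /n; lra.
  have nd : n <= d1 by rewrite /n; lra.
  have mE1 : m - a1 = (b1 - a1) / 2 by rewrite /m; lra.
  have mE2 : b1 - m = (b1 - a1) / 2 by rewrite /m; lra.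
  have nE1 : n - c1 = (d1 - c1) / 2 by rewrite /n; lra.
  have nE2 : d1 - n = (d1 - c1) / 2 by rewrite /n; lra.
  have mlb : m <= b by exact: le_trans mb h3.
  have aml : a <= m by exact: le_trans am.
  have nld : n <= d by exact: le_trans nd h6.
  have cnl : c <= n by exact: le_trans cn.
  have EE : E a1 b1 c1 d1 = (E a1 m c1 n + E a1 m n d1) + (E m b1 c1 n + E m b1 n d1).
    rewrite (addl a1 m b1)//; congr (_ + _); exact: addr.
  have : cnorm (E a1 b1 c1 d1) <= (cnorm (E a1 m c1 n) + cnorm (E a1 m n d1)) +
      (cnorm (E m b1 c1 n) + cnorm (E m b1 n d1)).
    by rewrite EE; apply: le_trans (cnormD _ _) _; rewrite lerD ?cnormD.
  move=> Ele.
  have [k1|k1] := leP (cnorm (E a1 b1 c1 d1)) (4 * cnorm (E a1 m c1 n)).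
    by exists ((a1, m), (c1, n)) => _; split.
  have [k2|k2] := leP (cnorm (E a1 b1 c1 d1)) (4 * cnorm (E a1 m n d1)).
    by exists ((a1, m), (n, d1)) => _; split.
  have [k3|k3] := leP (cnorm (E a1 b1 c1 d1)) (4 * cnorm (E m b1 c1 n)).
    by exists ((m, b1), (c1, n)) => _; split.
  exists ((m, b1), (n, d1)) => _; split => //.
  rewrite /EQ /=; lra.
(* The successor is defined on all quadruples, with the bisection property guarded by [ok], so that
   it can be iterated. *)
have [nx Hnx] := choice step.
pose Q n := iter n nx ((a, b), (c, d)).
have Q0 : Q 0%N = ((a, b), (c, d)) by [].
have QS n : Q n.+1 = nx (Q n) by [].
have okQ n : ok (Q n).
  by elim: n => [|n ih]; [rewrite Q0|rewrite QS; have [] := Hnx _ ih].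
have relQ n : rel (Q n) (Q n.+1) by rewrite QS; exact: Hnx.
have w1 n : (Q n).1.2 - (Q n).1.1 = (b - a) / 2 ^+ n.
  elim: n => [|n ih]; first by rewrite Q0 expr0 divr1.
  by have [_ [_ _ ->] _ _] := relQ n; rewrite ih exprSr invfM mulrA.
have w2 n : (Q n).2.2 - (Q n).2.1 = (d - c) / 2 ^+ n.
  elim: n => [|n ih]; first by rewrite Q0 expr0 divr1.
  by have [_ _ [_ _ ->] _] := relQ n; rewrite ih exprSr invfM mulrA.
have EQn n : cnorm (E a b c d) <= 4 ^+ n * EQ (Q n).
  elim: n => [|n ih]; first by rewrite expr0 mul1r.
  have [_ _ _ h] := relQ n; apply: le_trans ih _.
  by rewrite exprSr -mulrA ler_pM2l// exprn_gt0.
have mon1 m n : (m <= n)%N -> (Q m).1.1 <= (Q n).1.1 /\ (Q n).1.2 <= (Q m).1.2.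
  move=> /subnK <-; elim: (n - m)%N => [|k [ih1 ih2]]; first by rewrite add0n.
  by rewrite addSn; have [_ [h1 h2 _] _ _] := relQ (k + m)%N; split; apply: le_trans; eassumption.
have mon2 m n : (m <= n)%N -> (Q m).2.1 <= (Q n).2.1 /\ (Q n).2.2 <= (Q m).2.2.
  move=> /subnK <-; elim: (n - m)%N => [|k [ih1 ih2]]; first by rewrite add0n.
  by rewrite addSn; have [_ _ [h1 h2 _] _] := relQ (k + m)%N; split; apply: le_trans; eassumption.
have cross1 m n : (Q m).1.1 <= (Q n).1.2.
  have [h1 _] := mon1 m (maxn m n) (leq_maxl _ _).
  have [_ h2] := mon1 n (maxn m n) (leq_maxr _ _).
  by have [[_ h _] _] := okQ (maxn m n); apply: le_trans h1 (le_trans h h2).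
have cross2 m n : (Q m).2.1 <= (Q n).2.2.
  have [h1 _] := mon2 m (maxn m n) (leq_maxl _ _).
  have [_ h2] := mon2 n (maxn m n) (leq_maxr _ _).
  by have [_ [_ h _]] := okQ (maxn m n); apply: le_trans h1 (le_trans h h2).
have limit (l u : nat -> R) : (forall m n, l m <= u n) -> exists s, forall n, l n <= s /\ s <= u n.
  move=> lu; exists (sup (range l)) => n; split.
    by apply: sup_upper_bound; [split; [exists (l n), n|exists (u n) => _ [k _ <-]]|exists n].
  by apply: ge_sup; [exists (l n), n|move=> _ [k _ <-]].
have [s Hs] := limit _ _ cross1; have [t Ht] := limit _ _ cross2.
pose W := (b - a) + (d - c).
have W2 : 0 < W ^+ 2 + 1 by rewrite ltr_wpDl ?sqr_ge0.
(* With this [e] the final bound e W^2 is smaller than |E|; the summand 1 covers a degenerate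
   rectangle. *)
pose e := cnorm (E a b c d) / (W ^+ 2 + 1) / 2.
have ep : 0 < e by rewrite !divr_gt0.
have [as_ sb] := Hs 0%N; have [ct td] := Ht 0%N.
have [del del0 Hd] := loc s t as_ sb ct td e ep.
have [n Hn] := exp2_small W del0.
have [[i1 i2 i3] [i4 i5 i6]] := okQ n.
have [s1 s2] := Hs n; have [t1 t2] := Ht n.
have p2 : 0 < (2 ^+ n)^-1 :> R by rewrite invr_gt0 exprn_gt0.
have := Hd _ _ _ _ i1 s1 s2 i3 i4 t1 t2 i6.
have lt1 : (Q n).1.2 - (Q n).1.1 < del.
  by rewrite w1; apply: le_lt_trans Hn; rewrite ler_pM2r// /W; lra.
have lt2 : (Q n).2.2 - (Q n).2.1 < del.
  by rewrite w2; apply: le_lt_trans Hn; rewrite ler_pM2r// /W; lra.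
move=> /(_ lt1 lt2); rewrite w1 w2 -mulrDl -/W exprMn exprVn -exprM mulnC exprM.
rewrite -[cnorm (E _ _ _ _)]/(EQ (Q n)) (_ : 2 ^+ 2 = 4 :> R); last by rewrite -natrX.
rewrite mulrA ler_pdivlMr ?exprn_gt0// mulrC => h.
have := le_trans (EQn n) h.
rewrite leNgt => /negP; apply.
rewrite /e mulrAC ltr_pdivrMr// mulrAC ltr_pdivrMr//.
have W0 := sqr_ge0 W.
have : 0 <= cnorm (E a b c d) * W ^+ 2 by rewrite mulr_ge0 ?cnorm_ge0.
lra.
Qed.

End Bisection.

(** * Integrals of powers and of the Cauchy kernel over the circle *)

Section CircleIntegrals.
Context {R : realType}.
Implicit Types (a b c t m x : R) (z : R[i]).

Lemma is_derive_continuous (f : R -> R) x d : is_derive x 1 f d -> {for x, continuous f}.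
Proof. by move=> H; apply/differentiable_continuous/derivable1_diffP; case: H. Qed.

Lemma FTC_real (f F : R -> R) a b : a <= b ->
  (forall t, a <= t -> t <= b -> is_derive t 1 F (f t)) ->
  (forall t, a <= t -> t <= b -> {for t, continuous f}) ->
  \int[lebesgue_measure]_(x in `[a, b]) f x = F b - F a.
Proof.
move=> + dF cf; rewrite le_eqVlt => /predU1P[<-|ab].
  by rewrite set_itv1 Rintegral_set1 subrr.
have cF t : a <= t -> t <= b -> {for t, continuous F}.
  by move=> at_ tb; apply: is_derive_continuous (dF _ at_ tb).
rewrite /Rintegral (@continuous_FTC2 _ f F)//.
- apply: continuous_in_subspaceT => x /set_mem /=; rewrite in_itv /= => /andP[ax xb].
  exact: cf.
- split.
  + by move=> x; rewrite in_itv /= => /andP[/ltW ax /ltW xb]; case: (dF _ ax xb).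
  + by apply: cvg_at_right_filter; exact: cF (lexx _) (ltW ab).
  + by apply: cvg_at_left_filter; exact: cF (ltW ab) (lexx _).
- move=> x; rewrite in_itv /= => /andP[/ltW ax /ltW xb].
  by rewrite derive1E; have H := dF _ ax xb; rewrite derive_val.
Qed.

Definition c2pi : R[i] := Complex 0 (2 * pi).

Lemma cnorm_c2pi : cnorm c2pi = 2 * pi.
Proof. by rewrite /cnorm /= expr0n add0r sqrtr_sqr ger0_norm// mulr_ge0// pi_ge0. Qed.

Lemma c2pi_neq0 : c2pi != 0.
Proof. by rewrite -cnorm_gt0 cnorm_c2pi mulr_gt0// pi_gt0. Qed.

Lemma ccont_ucircM m t : ccont (fun t => ucirc (m * t)) t.
Proof.
have c2 : {for t, continuous (fun x : R => m * x)}.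
  by apply: cvgM; [exact: cvg_cst|exact: cvg_id].
have [c3 c4] := ccont_ucirc (m * t).
split.
- by apply: (@continuous_comp _ _ _ (fun x : R => m * x) (fun x => complex.Re (ucirc x))).
- by apply: (@continuous_comp _ _ _ (fun x : R => m * x) (fun x => complex.Im (ucirc x))).
Qed.

Lemma is_derive_scale k x : is_derive x 1 (fun t : R => k * t) k.
Proof.
have := @is_deriveZ _ _ _ id k x 1 1 (is_derive_id _ _).
by rewrite /GRing.scale /= mulr1.
Qed.

Lemma cintab_ucirc m a b : a <= b ->
  c2pi * m%:C * cintab a b (fun t => ucirc (m * t)) = ucirc (m * b) - ucirc (m * a).
Proof.
move=> ab; rewrite -cintabZ; last by move=> t _ _; exact: ccont_ucircM.
have cU t : ccont (fun t => c2pi * m%:C * ucirc (m * t)) t.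
  by apply: ccontM; [exact: ccont_cst|exact: ccont_ucircM].
apply/eqP; rewrite eq_complex cReD cReN cImD cImN; apply/andP; split; apply/eqP => /=.
- apply: (FTC_real (F := fun t => cos (2 * pi * (m * t)))) => //.
  + move=> t _ _; have -> : (fun t => cos (2 * pi * (m * t))) = cos \o (fun t => 2 * pi * m * t).
      by apply/funext => s /=; rewrite !mulrA.
    have H := is_derive_scale (2 * pi * m) t.
    apply: is_derive_eq.
    by rewrite !mulrA; ring.
  + by move=> t _ _; have [] := cU t.
- apply: (FTC_real (F := fun t => sin (2 * pi * (m * t)))) => //.
  + move=> t _ _; have -> : (fun t => sin (2 * pi * (m * t))) = sin \o (fun t => 2 * pi * m * t).
      by apply/funext => s /=; rewrite !mulrA.
    have H := is_derive_scale (2 * pi * m) t.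
    apply: is_derive_eq.
    by rewrite !mulrA; ring.
  + by move=> t _ _; have [] := cU t.
Qed.

Lemma ucirc_lip s t : cnorm (ucirc s - ucirc t) <= 2 * pi * `|s - t|.
Proof.
wlog st : s t / s <= t.
  by move=> H; have [/H//|/ltW/H] := leP s t; rewrite cdistC distrC.
have := cintab_ucirc 1 st; rewrite mulr1 !mul1r => E.
rewrite cdistC -E cnormM cnorm_c2pi; apply: ler_wpM2l; first by rewrite mulr_ge0// pi_ge0.
rewrite distrC ger0_norm ?subr_ge0// -[leRHS]mul1r; apply: cnorm_cintab => //.
- by move=> x _ _; exact: ccont_ucircM.
- by move=> x _ _; rewrite cnorm_ucirc.
Qed.

Lemma ucircMn t (k : nat) : ucirc (k%:R * t) = ucirc t ^+ k.
Proof.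
elim: k => [|k ih]; first by rewrite mul0r ucirc0 expr0.
by rewrite -addn1 natrD mulrDl mul1r ucircD ih exprD expr1.
Qed.

Lemma ucircV t : (ucirc t)^-1 = ucirc (- t).
Proof.
apply: (mulfI (ucirc_neq0 t)); rewrite divff ?ucirc_neq0// -ucircD subrr.
by rewrite ucirc0.
Qed.

Lemma cintab_ucirc_int c (k : int) : k != 0 ->
  cintab c (c + 1) (fun t => ucirc (k%:~R * t)) = 0.
Proof.
move=> k0; have c1 : c <= c + 1 by rewrite lerDl.
have := cintab_ucirc k%:~R c1; rewrite mulrDr mulr1 ucircDint subrr => /eqP.
rewrite !mulf_eq0 (negbTE c2pi_neq0) /= => /orP[|/eqP//].
by rewrite -cnorm_eq0 cnorm_real normr_eq0 intr_eq0 (negbTE k0).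
Qed.

Lemma expr_small (r K e : R) : 0 <= r -> r < 1 -> 0 < e -> exists n, r ^+ n * K < e.
Proof.
move=> r0 r1 e0.
have : GRing.exp r @ \oo --> (0 : R) by apply: cvg_expr; rewrite ger0_norm.
move=> /cvgrPdist_lt/(_ (e / (`|K| + 1))).
have K1 : 0 < `|K| + 1 by rewrite ltr_wpDl.
move=> /(_ (divr_gt0 e0 K1))[n _ /(_ n (leqnn n))].
rewrite /= sub0r normrN ger0_norm ?exprn_ge0// ltr_pdivlMr// => H; exists n.
apply: le_lt_trans H; rewrite ler_wpM2l ?exprn_ge0//.
by apply: le_trans (ler_norm _) _; rewrite lerDl.
Qed.

Lemma ucirc_sub_neq0 z t : cnorm z < 1 -> ucirc t - z != 0.
Proof.
move=> z1; rewrite subr_eq0; apply/eqP => uz.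
by move: z1; rewrite -uz cnorm_ucirc ltxx.
Qed.

Lemma ucirc_sub_ge z t : 1 - cnorm z <= cnorm (ucirc t - z).
Proof. by rewrite lerBlDl -(cnorm_ucirc t) cnorm_le_sub. Qed.

Lemma ccont_ucirc_sub z t : ccont (fun t => ucirc t - z) t.
Proof. by apply: ccontB; [exact: ccont_ucirc|exact: ccont_cst]. Qed.

Lemma cnorm_le_eps0 z : (forall e, 0 < e -> cnorm z <= e) -> z = 0.
Proof.
move=> H; apply/eqP; rewrite -cnorm_eq0; apply/eqP/le_anti; rewrite cnorm_ge0 andbT.
by apply/ler_addgt0Pr => e /H; rewrite add0r.
Qed.

Lemma geom_sumE z n : z != 1 -> (1 - z)^-1 = \sum_(k < n) z ^+ k + z ^+ n / (1 - z).
Proof.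
move=> z1; have z0 : 1 - z != 0 by rewrite subr_eq0 eq_sym.
elim: n => [|n ih]; first by rewrite big_ord0 add0r expr0 div1r.
by rewrite [LHS]ih big_ord_recr /= exprS -addrA; congr (_ + _); field.
Qed.

(** Expand in powers of z / [ucirc t]: over a full turn every nonconstant power integrates to 0, and
    the remainder is a geometric tail. *)
Lemma cint_cauchy_kernel c z : cnorm z < 1 ->
  cintab c (c + 1) (fun t => ucirc t / (ucirc t - z)) = 1.
Proof.
move=> z1; apply/eqP; rewrite -subr_eq0; apply/eqP; apply: cnorm_le_eps0 => e e0.
have c1 : c <= c + 1 by rewrite lerDl.
have z1' : 0 < 1 - cnorm z by rewrite subr_gt0.
have [n0 Hn0] := expr_small (1 - cnorm z)^-1 (cnorm_ge0 z) z1 e0.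
(* A positive [n] makes the partial sum contain the constant term, the only one with nonzero
   integral. *)
pose n := n0.+1.
have Hn : cnorm z ^+ n * (1 - cnorm z)^-1 < e.
  apply: le_lt_trans Hn0; rewrite ler_pM2r ?invr_gt0// exprS -[leRHS]mul1r.
  by rewrite ler_wpM2r ?exprn_ge0 ?cnorm_ge0// ltW.
pose w t := z * ucirc (- t).
have w1 t : w t != 1.
  rewrite /w -ucircV; apply/eqP => E; have := ucirc_sub_neq0 t z1.
  by rewrite subr_eq0 => /eqP; apply; rewrite -[RHS](divfK (ucirc_neq0 t)) E mul1r.
have kE t : ucirc t / (ucirc t - z) = (1 - w t)^-1.
  have -> : ucirc t - z = ucirc t * (1 - w t).
    by rewrite /w -ucircV mulrBr mulr1 mulrCA divff ?ucirc_neq0// mulr1.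
  by rewrite invfM mulrA divff ?ucirc_neq0// mul1r.
have cw t : ccont w t.
  rewrite /w; under eq_fun do rewrite -mulN1r.
  by apply: ccontM; [exact: ccont_cst|exact: ccont_ucircM].
have cs (m : nat) : contab c (c + 1) (fun t => \sum_(k < m) w t ^+ k).
  by move=> t _ _; apply: (ccont_sum (F_ := fun k t => w t ^+ k)) => k; exact: ccontX.
have c1w t : ccont (fun t => (1 - w t)^-1) t.
  apply: ccontV; first by rewrite subr_eq0 eq_sym.
  by apply: ccontB => //; exact: ccont_cst.
have cr : contab c (c + 1) (fun t => w t ^+ n / (1 - w t)).
  by move=> t _ _; apply: ccontM => //; exact: ccontX.
have is1 (m : nat) : (0 < m)%N -> cintab c (c + 1) (fun t => \sum_(k < m) w t ^+ k) = 1.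
  case: m => // m _; elim: m => [|m ih].
    under eq_cintab do rewrite big_ord_recr big_ord0 /= add0r expr0.
    by rewrite cintab_cst// addrAC subrr add0r mulr1.
  under eq_cintab do rewrite big_ord_recr /=.
  rewrite (cintabD (cs m.+1)); last by move=> t _ _; exact: ccontX.
  rewrite ih (_ : cintab _ _ _ = 0) ?addr0//.
  rewrite (eq_cintab (G := fun t => z ^+ m.+1 * ucirc ((- m.+1%:Z)%:~R * t))).
    rewrite cintabZ; last by move=> t _ _; exact: ccont_ucircM.
    by rewrite cintab_ucirc_int ?mulr0// oppr_eq0.
  move=> t _ _; rewrite /w exprMn; congr (_ * _).
  by rewrite -ucircMn mulrNz mulrN mulNr.
have e1 : cintab c (c + 1) (fun t => ucirc t / (ucirc t - z)) =
    cintab c (c + 1) (fun t => \sum_(k < n) w t ^+ k) + cintab c (c + 1) (fun t => w t ^+ n / (1 - w t)).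
  rewrite -cintabD//; apply: eq_cintab => t _ _; rewrite kE; exact: geom_sumE.
have ww t : cnorm (w t) = cnorm z by rewrite /w cnormM cnorm_ucirc mulr1.
have e2 : cnorm (cintab c (c + 1) (fun t => w t ^+ n / (1 - w t))) <= e.
  apply: le_trans (ltW Hn).
  have cc1 : c + 1 - c = 1 by ring.
  rewrite -[leRHS]mulr1 -[X in _ <= _ * X]cc1; apply: cnorm_cintab => // t _ _.
  rewrite cnormf cnormX ww ler_wpM2l ?exprn_ge0 ?cnorm_ge0// lef_pV2 ?posrE//.
    by rewrite lerBlDl -(ww t) -[1 in leLHS]cnorm1 cnorm_le_sub.
  by rewrite cnorm_gt0 subr_eq0 eq_sym.
by rewrite e1 is1// addrAC subrr add0r.
Qed.

End CircleIntegrals.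

(** * Cauchy's integral formula on a circle *)

Section Cauchy.
Context {R : realType}.
Variables (F F' : R[i] -> R[i]) (r : R) (z : R[i]).
Hypothesis dF : deriv_on_disk F F'.
Hypothesis r1 : r < 1.
Hypothesis zr : cnorm z < r.

(** The map [g] contracts the circle of radius [r] towards [z], and dg / (g - z) equals dl / l +
    [c2pi * w t] dt. *)
Let v t := r%:C * ucirc t - z.
Let w t := r%:C * ucirc t / v t.
Let g l t := z + l%:C * v t.

Let r0 : 0 < r. Proof. exact: le_lt_trans (cnorm_ge0 z) zr. Qed.

Let v_ge t : r - cnorm z <= cnorm (v t).
Proof.
rewrite lerBlDl; apply: le_trans (cnorm_le_sub (r%:C * ucirc t) z).
by rewrite cnormM cnorm_real cnorm_ucirc mulr1 ger0_norm// ltW.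
Qed.

Let v_le t : cnorm (v t) <= 2.
Proof.
apply: le_trans (cnormB _ _) _; rewrite cnormM cnorm_real cnorm_ucirc mulr1 gtr0_norm//.
by have := r1; have := zr; lra.
Qed.

Let v_neq0 t : v t != 0.
Proof. by rewrite -cnorm_gt0 (lt_le_trans _ (v_ge t))// subr_gt0. Qed.

Let W := (r - cnorm z)^-1.

Let W_gt0 : 0 < W. Proof. by rewrite invr_gt0 subr_gt0. Qed.

Let w_le t : cnorm (w t) <= W.
Proof.
rewrite cnormf cnormM cnorm_real cnorm_ucirc mulr1 gtr0_norm// /W -[leRHS]mul1r.
apply: ler_pM; rewrite ?invr_ge0 ?cnorm_ge0 ?(ltW r0) ?(ltW r1)//.
by rewrite lef_pV2 ?v_ge// posrE ?cnorm_gt0 ?v_neq0// subr_gt0.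
Qed.

Let cv t : ccont v t.
Proof.
apply: ccontB; last exact: ccont_cst.
by apply: ccontM; [exact: ccont_cst|exact: ccont_ucirc].
Qed.

Let cw t : ccont w t.
Proof.
apply: ccontM; last by apply: ccontV (cv t); exact: v_neq0.
by apply: ccontM; [exact: ccont_cst|exact: ccont_ucirc].
Qed.

Let g_disk l t : 0 <= l -> l <= 1 -> disk (g l t).
Proof.
move=> l0 l1; rewrite /disk /= /g /v.
rewrite (_ : _ + _ = (1 - l)%:C * z + (l * r)%:C * ucirc t); last first.
  by rewrite rmorphB rmorphM /=; ring.
apply: le_lt_trans (cnormD _ _) _; rewrite !cnormM !cnorm_real cnorm_ucirc mulr1.
rewrite !ger0_norm ?mulr_ge0 ?subr_ge0// ?(ltW r0)//.
have : (1 - l) * cnorm z <= (1 - l) * r by rewrite ler_wpM2l ?subr_ge0// ltW.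
have := r1; lra.
Qed.

Let cont_real_id (l : R) : ccont (fun x : R => x%:C) l.
Proof. by apply: (ccont_real (f := id)); exact: cvg_id. Qed.

Let cg1 l t : ccont (fun x => g x t) l.
Proof. by apply: ccontD; [exact: ccont_cst|apply: ccontM; [exact: cont_real_id|exact: ccont_cst]]. Qed.

Let cg2 l t : ccont (fun x => g l x) t.
Proof. by apply: ccontD; [exact: ccont_cst|apply: ccontM; [exact: ccont_cst|exact: cv]]. Qed.

Let cF1 l t : 0 <= l -> l <= 1 -> ccont (fun x => F (g x t)) l.
Proof. by move=> l0 l1; apply: ccont_comp_cderiv (cg1 l t); exact: dF (g_disk t l0 l1). Qed.

Let cF2 l t : 0 <= l -> l <= 1 -> ccont (fun x => F (g l x)) t.
Proof. by move=> l0 l1; apply: ccont_comp_cderiv (cg2 l t); exact: dF (g_disk t l0 l1). Qed.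

Let cinv (l : R) : 0 < l -> ccont (fun x : R => x^-1%:C) l.
Proof.
move=> l0; rewrite (_ : (fun x => _) = fun x : R => (x%:C)^-1); last first.
  by apply/funext => x; rewrite fmorphV.
by apply: ccontV => //; rewrite -cnorm_gt0 cnorm_real normr_gt0 gt_eqF.
Qed.

(* The 1-form F(g) dg / (g - z) pulled back to the (l, t)-plane by g, integrated
   over the boundary of a rectangle; with the factor 2 pi i removed from its dt part. *)
Let E a b c d :=
  cintab a b (fun l => (F (g l c) - F (g l d)) * l^-1%:C) +
  c2pi * cintab c d (fun t => (F (g b t) - F (g a t)) * w t).

Let cE1 a b c d : 0 < a -> b <= 1 -> contab a b (fun l => (F (g l c) - F (g l d)) * l^-1%:C).
Proof.
move=> a0 b1 l al lb; have l0 := lt_le_trans a0 al; have l1 := le_trans lb b1.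
apply: ccontM; last exact: cinv.
by apply: ccontB; apply: cF1 => //; exact: ltW.
Qed.

Let cE2 a b c d : 0 <= a -> a <= 1 -> 0 <= b -> b <= 1 ->
  contab c d (fun t => (F (g b t) - F (g a t)) * w t).
Proof.
move=> a0 a1 b0 b1 t ct td; apply: ccontM; last exact: cw.
by apply: ccontB; exact: cF2.
Qed.

(** Goursat on the parameter rectangle: [E] vanishes by bisection, and its sides t = 0 and t = 1
    cancel because the circle closes up. The lower end [l0] stays positive since dl / l is singular
    at 0. *)
Lemma cauchy_homotopy l0 : 0 < l0 -> l0 <= 1 ->
  cintab 0 1 (fun t => F (r%:C * ucirc t) * w t) = cintab 0 1 (fun t => F (g l0 t) * w t).
Proof.
move=> l00 l01.
have : E l0 1 0 1 = 0.
  apply: bisection_additive_eq0 => //.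
  - move=> a m b c d la am mb b1 c0 cd d1; rewrite /E.
    have a0 : 0 < a by exact: lt_le_trans la.
    have b0 : 0 < b by exact: lt_le_trans a0 (le_trans am mb).
    have m0 : 0 < m by exact: lt_le_trans am.
    have a1 : a <= 1 by exact: le_trans am (le_trans mb b1).
    have m1 : m <= 1 by exact: le_trans mb b1.
    rewrite (cintab_cat am mb (cE1 c d a0 b1)).
    rewrite (_ : cintab c d (fun t => (F (g b t) - F (g a t)) * w t) =
      cintab c d (fun t => (F (g m t) - F (g a t)) * w t) +
      cintab c d (fun t => (F (g b t) - F (g m t)) * w t)); first by ring.
    rewrite -cintabD; [|by apply: cE2 => //; exact: ltW..].
    by apply: eq_cintab => t _ _; ring.
  - move=> a b c m d la ab b1 c0 cm md d1; rewrite /E.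
    have a0 : 0 < a by exact: lt_le_trans la.
    have b0 : 0 <= b by exact: le_trans (ltW a0) ab.
    have a1 : a <= 1 by exact: le_trans ab b1.
    rewrite (cintab_cat cm md (cE2 (ltW a0) a1 b0 b1)).
    rewrite (_ : cintab a b (fun l => (F (g l c) - F (g l d)) * l^-1%:C) =
      cintab a b (fun l => (F (g l c) - F (g l m)) * l^-1%:C) +
      cintab a b (fun l => (F (g l m) - F (g l d)) * l^-1%:C)); first by ring.
    rewrite -cintabD; [|exact: cE1..].
    by apply: eq_cintab => t _ _; ring.
  - move=> s t ls s1 t0 t1 e e0.
    have s0 : 0 < s by exact: lt_le_trans ls.
    set z0 := g s t.
    have dz0 : disk z0 := g_disk t (ltW s0) s1.
    (* A Lipschitz constant of [g]: |v| is at most 2, and [ucirc] has Lipschitz constant 2 pi. *)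
    pose L : R := 2 + 2 * pi.
    have pi0 : 0 <= pi :> R := pi_ge0 R.
    have L0 : 0 < L by rewrite /L; lra.
    (* Chosen so that e1 K ell^2 is the sum of the bounds [B1] and 2 pi times [B2] below. *)
    pose K := 2 * L * (l0^-1 + 2 * pi * W).
    have K0 : 0 < K.
      rewrite !mulr_gt0// addr_gt0 ?invr_gt0 ?mulr_gt0//; exact: pi_gt0.
    have gL l u : 0 <= l -> cnorm (g l u - z0) <= L * (`|l - s| + `|u - t|).
      move=> ll0; rewrite /z0 /g (_ : _ - _ = (l - s)%:C * v u + s%:C * (r%:C * (ucirc u - ucirc t))).
        apply: le_trans (cnormD _ _) _; rewrite !cnormM !cnorm_real (ger0_norm (ltW s0)) (gtr0_norm r0).
        have p1 : `|l - s| * cnorm (v u) <= `|l - s| * 2 by rewrite ler_wpM2l.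
        have p2 : s * (r * cnorm (ucirc u - ucirc t)) <= 1 * (1 * (2 * pi * `|u - t|)).
          apply: ler_pM; rewrite ?mulr_ge0 ?cnorm_ge0 ?(ltW s0) ?(ltW r0)//.
          by apply: ler_pM; rewrite ?cnorm_ge0 ?(ltW r0) ?(ltW r1) ?ucirc_lip.
        have : 0 <= pi * `|l - s| by rewrite mulr_ge0.
        have : 0 <= `|u - t| by [].
        rewrite /L; lra.
      by rewrite /v rmorphB /=; ring.
    pose e1 := e / K.
    have e10 : 0 < e1 by rewrite divr_gt0.
    have [u u0 Hu] := (has_cderivP _ _ _).1 (dF dz0) _ e10.
    exists (u / (2 * L)); first by rewrite divr_gt0// mulr_gt0.
    move=> a b c d la as_ sb b1 c0 ct td d1 abd cdd.
    have a0 : 0 < a by exact: lt_le_trans la.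
    have ab : a <= b by exact: le_trans as_ sb.
    have cd : c <= d by exact: le_trans ct td.
    have a1 : a <= 1 by exact: le_trans ab b1.
    have b0 : 0 <= b by exact: le_trans (ltW a0) ab.
    pose ell := (b - a) + (d - c).
    have ell0 : 0 <= ell by rewrite /ell; lra.
    pose rem y := F y - F z0 - F' z0 * (y - z0).
    have remle l x : a <= l -> l <= b -> c <= x -> x <= d -> cnorm (rem (g l x)) <= e1 * (L * ell).
      move=> al lb cx xd.
      have gle : cnorm (g l x - z0) <= L * ell.
        apply: le_trans (gL l x _) _; first by apply: le_trans al; exact: ltW.
        rewrite ler_pM2l// /ell lerD// ler_norml; apply/andP; split; lra.
      have := Hu (g l x - z0); rewrite (addrC z0) subrK => H.
      apply: le_trans (H _) _; last by rewrite ler_pM2l.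
      apply: le_lt_trans gle _; rewrite mulrC -ltr_pdivlMr// /ell.
      move: abd cdd; rewrite invfM mulrA mulrAC; lra.
    have crem1 x l : 0 <= l -> l <= 1 -> ccont (fun l => rem (g l x)) l.
      move=> l0' l1'; apply: ccontB; first by apply: ccontB; [exact: cF1|exact: ccont_cst].
      apply: ccontM; first exact: ccont_cst.
      by apply: ccontB; [exact: cg1|exact: ccont_cst].
    have crem2 l x : 0 <= l -> l <= 1 -> ccont (fun x => rem (g l x)) x.
      move=> l0' l1'; apply: ccontB; first by apply: ccontB; [exact: cF2|exact: ccont_cst].
      apply: ccontM; first exact: ccont_cst.
      by apply: ccontB; [exact: cg2|exact: ccont_cst].
    have cR1 : contab a b (fun l => (rem (g l c) - rem (g l d)) * l^-1%:C).
      move=> l al lb; have ll0 := lt_le_trans a0 al; have ll1 := le_trans lb b1.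
      apply: ccontM; last exact: cinv.
      by apply: ccontB; apply: crem1 => //; exact: ltW.
    have cR2 : contab c d (fun t => (rem (g b t) - rem (g a t)) * w t).
      move=> x cx xd; apply: ccontM; last exact: cw.
      by apply: ccontB; apply: crem2 => //; exact: ltW.
    have cru : contab c d (fun t => r%:C * ucirc t).
      by move=> x _ _; apply: ccontM; [exact: ccont_cst|exact: ccont_ucirc].
    have E1 : cintab a b (fun l => (F (g l c) - F (g l d)) * l^-1%:C) =
        F' z0 * (v c - v d) * (b - a)%:C + cintab a b (fun l => (rem (g l c) - rem (g l d)) * l^-1%:C).
      rewrite -cintab_cst// -cintabD//; last by move=> x _ _; exact: ccont_cst.
      apply: eq_cintab => l al lb; have ll0 := lt_le_trans a0 al.
      rewrite /rem /g fmorphV /=; field.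
      by rewrite -cnorm_gt0 cnorm_real normr_gt0 gt_eqF.
    have E2 : cintab c d (fun t => (F (g b t) - F (g a t)) * w t) =
        F' z0 * (b - a)%:C * cintab c d (fun t => r%:C * ucirc t) +
        cintab c d (fun t => (rem (g b t) - rem (g a t)) * w t).
      rewrite -cintabZ// -cintabD//; last first.
        by move=> x cx xd; apply: ccontM; [exact: ccont_cst|exact: cru].
      apply: eq_cintab => x cx xd.
      by rewrite /rem /g /w rmorphB /=; field; exact: v_neq0.
    have E3 : c2pi * cintab c d (fun t => r%:C * ucirc t) = v d - v c.
      rewrite cintabZ; last by move=> x _ _; exact: ccont_ucirc.
      have := cintab_ucirc 1 cd; rewrite mulr1 !mul1r => h.
      rewrite (_ : cintab c d (@ucirc R) = cintab c d (fun t => ucirc (1 * t))); last first.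
        by apply: eq_cintab => x _ _; rewrite mul1r.
      by rewrite mulrCA h /v; ring.
    (* The affine part of [F] at [z0] contributes a multiple of [v c - v d + c2pi * I], which is 0
       by [E3]; only the remainder [rem] is left. *)
    have -> : E a b c d = cintab a b (fun l => (rem (g l c) - rem (g l d)) * l^-1%:C) +
       c2pi * cintab c d (fun t => (rem (g b t) - rem (g a t)) * w t).
      rewrite /E E1 E2; set R1 := cintab a b _; set R2 := cintab c d (fun t => (_ - _) * _).
      set I := cintab c d _ in E3 *.
      transitivity (R1 + c2pi * R2 + F' z0 * (b - a)%:C * (v c - v d + c2pi * I)); first by ring.
      by rewrite E3; ring.
    have B1 : cnorm (cintab a b (fun l => (rem (g l c) - rem (g l d)) * l^-1%:C)) <=
        2 * (e1 * (L * ell)) * l0^-1 * (b - a).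
      apply: cnorm_cintab => // l al lb; have ll0 := lt_le_trans a0 al.
      rewrite cnormM cnorm_real ger0_norm ?invr_ge0 ?(ltW ll0)//.
      rewrite ler_pM ?cnorm_ge0 ?invr_ge0 ?(ltW ll0)//.
        apply: le_trans (cnormB _ _) _.
        have := remle l c al lb (lexx _) cd; have := remle l d al lb cd (lexx _); lra.
      by rewrite lef_pV2 ?posrE// (le_trans la).
    have B2 : cnorm (cintab c d (fun t => (rem (g b t) - rem (g a t)) * w t)) <=
        2 * (e1 * (L * ell)) * W * (d - c).
      apply: cnorm_cintab => // x cx xd.
      rewrite cnormM ler_pM ?cnorm_ge0//.
      apply: le_trans (cnormB _ _) _.
      have := remle a x (lexx _) ab cx xd; have := remle b x ab (lexx _) cx xd; lra.
    apply: le_trans (cnormD _ _) _; rewrite cnormM cnorm_c2pi.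
    have B2' : 2 * pi * cnorm (cintab c d (fun t => (rem (g b t) - rem (g a t)) * w t)) <=
        2 * pi * (2 * (e1 * (L * ell)) * W * (d - c)).
      by rewrite ler_wpM2l// mulr_ge0.
    have q0 : 0 <= 2 * (e1 * (L * ell)) by rewrite mulr_ge0// mulr_ge0 ?(ltW e10)// mulr_ge0 ?(ltW L0).
    have B1' : 2 * (e1 * (L * ell)) * l0^-1 * (b - a) <= 2 * (e1 * (L * ell)) * l0^-1 * ell.
      apply: ler_wpM2l; last by rewrite lerDl subr_ge0.
      by apply: mulr_ge0 q0 _; rewrite invr_ge0 ltW.
    have B2'' : 2 * pi * (2 * (e1 * (L * ell)) * W * (d - c)) <= 2 * pi * (2 * (e1 * (L * ell)) * W * ell).
      apply: ler_wpM2l; first by rewrite mulr_ge0.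
      by apply: ler_wpM2l; [rewrite mulr_ge0 ?(ltW W_gt0)|rewrite /ell; lra].
    have -> : e * (b - a + (d - c)) ^+ 2 = e1 * K * ell ^+ 2 by rewrite /e1 divfK// gt_eqF.
    have -> : e1 * K * ell ^+ 2 = 2 * (e1 * (L * ell)) * l0^-1 * ell +
       2 * pi * (2 * (e1 * (L * ell)) * W * ell) by rewrite /K; ring.
    apply: lerD; [apply: le_trans B1 B1'|apply: le_trans B2' B2''].
rewrite /E (_ : cintab l0 1 _ = 0) ?add0r; last first.
  rewrite (eq_cintab (G := fun=> 0)); first by rewrite cintab_cst// mul0r.
  by move=> l _ _; rewrite /g /v ucirc0 ucirc1 subrr mul0r.
move=> /eqP; rewrite mulf_eq0 (negbTE c2pi_neq0) /= => /eqP H.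
apply/eqP; rewrite -subr_eq0 -H; apply/eqP; rewrite -cintabB.
- apply: eq_cintab => t _ _; rewrite -mulrBl; congr ((F _ - _) * _).
  by rewrite /g mul1r /v addrC subrK.
- move=> t _ _; apply: ccontM => //.
  apply: (ccont_comp_cderiv (d := F' (r%:C * ucirc t))).
    by apply: dF; apply: disk_real_ucirc => //; exact: ltW.
  by apply: ccontM; [exact: ccont_cst|exact: ccont_ucirc].
- by move=> t _ _; apply: ccontM => //; apply: cF2 => //; exact: ltW.
Qed.

(** By the homotopy the curve may be contracted until [F] is nearly constant on it, and the weight
    [w] has integral 1. *)
Lemma cauchy_formula : cintab 0 1 (fun t => F (r%:C * ucirc t) * w t) = F z.
Proof.
have w1 : cintab 0 1 w = 1.
  have zr1 : cnorm (z / r%:C) < 1.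
    by rewrite cnormf cnorm_real gtr0_norm// ltr_pdivrMr// mul1r.
  rewrite -(cint_cauchy_kernel 0 zr1) add0r; apply: eq_cintab => t _ _.
  have rn0 : r%:C != 0 by rewrite -cnorm_gt0 cnorm_real normr_gt0 gt_eqF.
  by rewrite /w /v; field; rewrite rn0 /= mulrC; exact: v_neq0.
apply/eqP; rewrite -subr_eq0; apply/eqP; apply: cnorm_le_eps0 => e e0.
have dz : disk z by rewrite /disk /= (lt_trans zr).
have eW : 0 < e / W by rewrite divr_gt0.
have [d d0 Hd] := has_cderiv_cont (dF dz) eW.
(* As |v| is at most 2, the contracted curve stays within d / 2 of [z]. *)
pose l := Num.min 1 (d / 4).
have l0 : 0 < l by rewrite lt_min ltr01 divr_gt0.
have l1 : l <= 1 by rewrite ge_min lexx.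
have ld : l <= d / 4 by rewrite ge_min lexx orbT.
rewrite (cauchy_homotopy l0 l1) -[F z]mulr1 -w1 -cintabZ; last by move=> t _ _.
rewrite -cintabB; last 2 first.
  by move=> t _ _; apply: ccontM => //; apply: cF2 => //; exact: ltW.
  by move=> t _ _; apply: ccontM => //; exact: ccont_cst.
have -> : e = e / W * W * (1 - 0) by rewrite subr0 mulr1 divfK// gt_eqF.
apply: cnorm_cintab => //.
  move=> t _ _; apply: ccontB; first by apply: ccontM => //; apply: cF2 => //; exact: ltW.
  by apply: ccontM => //; exact: ccont_cst.
move=> t _ _; rewrite -mulrBl cnormM; apply: ler_pM; rewrite ?cnorm_ge0//; apply/ltW/Hd.
rewrite cnormM cnorm_real gtr0_norm//.
apply: le_lt_trans (_ : d / 4 * 2 < d); last by lra.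
by rewrite ler_pM ?cnorm_ge0 ?(ltW l0).
Qed.

End Cauchy.

(** * Approximation of analytic functions by polynomials *)

Section PolynomialApproximation.
Context {R : realType}.
Implicit Types (F G : R[i] -> R[i]) (z h : R[i]) (r s e M : R) (p : {poly R[i]}).

Lemma disk_le r z : r < 1 -> cnorm z <= r -> disk z.
Proof. by move=> r1 zr; rewrite /disk /= (le_lt_trans zr). Qed.

Lemma poly_bounded p : exists2 M, 0 <= M & forall z, cnorm z <= 1 -> cnorm p.[z] <= M.
Proof.
elim/poly_ind: p => [|p c [M M0 HM]].
  by exists 0 => // z _; rewrite horner0 cnorm0.
exists (M + cnorm c); first by rewrite addr_ge0 ?cnorm_ge0.
move=> z z1; rewrite hornerMXaddC; apply: le_trans (cnormD _ _) _.
rewrite lerD2r cnormM -[leRHS]mulr1.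
by apply: ler_pM; rewrite ?cnorm_ge0 ?HM.
Qed.

Lemma continuous_bounded (f : R -> R) a b : a <= b ->
  (forall t, a <= t -> t <= b -> {for t, continuous f}) ->
  exists2 M, 0 <= M & forall t, a <= t -> t <= b -> f t <= M.
Proof.
move=> ab cf.
have [|c _ Hc] := @EVT_max R f a b ab.
  apply: continuous_in_subspaceT => x /set_mem /=; rewrite in_itv /= => /andP[].
  exact: cf.
exists (Num.max 0 (f c)); first by rewrite le_max lexx.
by move=> t at_ tb; rewrite le_max Hc ?orbT// in_itv /= at_ tb.
Qed.

Lemma ccont_circle F F' r t : deriv_on_disk F F' -> 0 <= r -> r < 1 ->
  ccont (fun t => F (r%:C * ucirc t)) t.
Proof.
move=> dF r0 r1; apply: (ccont_comp_cderiv (d := F' (r%:C * ucirc t))).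
  by apply: dF; exact: disk_real_ucirc.
by apply: ccontM; [exact: ccont_cst|exact: ccont_ucirc].
Qed.

Lemma cnorm_circle r t : 0 <= r -> cnorm (r%:C * ucirc t) = r.
Proof. by move=> r0; rewrite cnormM cnorm_real cnorm_ucirc mulr1 ger0_norm. Qed.

Lemma circle_sub_ge r t z : 0 <= r -> r - cnorm z <= cnorm (r%:C * ucirc t - z).
Proof. by move=> r0; rewrite lerBlDl -{1}(cnorm_circle t r0) cnorm_le_sub. Qed.

(** Subtracting Cauchy's formula at [z] and at [z + x] bounds the increment of [G] by a multiple of
    [x]; differentiability then transfers the bound to [G' z] without differentiating under the
    integral. *)
Lemma cauchy_estimate G G' r s M z : deriv_on_disk G G' -> r < s -> s < 1 ->
  (forall t, cnorm (G (s%:C * ucirc t)) <= M) -> cnorm z <= r ->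
  cnorm (G' z) <= 2 / (s - r) ^+ 2 * M.
Proof.
move=> dG rs s1 GM zr.
have r0 : 0 <= r by exact: le_trans (cnorm_ge0 z) zr.
have s0 : 0 < s by exact: le_lt_trans rs.
have M0 : 0 <= M by exact: le_trans (cnorm_ge0 _) (GM 0).
have sr : 0 < s - r by rewrite subr_gt0.
have dz : disk z by apply: disk_le zr; exact: lt_trans s1.
have cu t : ccont (fun t => s%:C * ucirc t) t.
  by apply: ccontM; [exact: ccont_cst|exact: ccont_ucirc].
have cG t : ccont (fun t => G (s%:C * ucirc t)) t by apply: ccont_circle dG (ltW s0) s1.
have cu0 y t : cnorm y < s -> s%:C * ucirc t - y != 0.
  by move=> ys; rewrite -cnorm_gt0 (lt_le_trans _ (circle_sub_ge t y (ltW s0)))// subr_gt0.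
have cuy y t : ccont (fun t => s%:C * ucirc t - y) t by apply: ccontB => //; exact: ccont_cst.
apply/ler_addgt0Pr => e e0.
have [d d0 Hd] := (has_cderivP _ _ _).1 (dG _ dz) _ e0.
(* Small enough for the expansion of [G] at [z], and for [z + x] to keep distance (s - r) / 2 from
   the circle of radius [s]. *)
pose x := Num.min d (s - r) / 2.
have m0 : 0 < Num.min d (s - r) by rewrite lt_min d0.
have x0 : 0 < x by rewrite divr_gt0.
have xm : x < Num.min d (s - r) by rewrite /x; lra.
have xsr : x <= (s - r) / 2 by rewrite /x ler_pM2r// ge_min lexx orbT.
clearbody x; move: (xm); rewrite lt_min => /andP[xd xr].
have cx : cnorm x%:C = x by rewrite cnorm_real gtr0_norm.
have zx : cnorm (z + x%:C) <= r + (s - r) / 2 by apply: le_trans (cnormD _ _) _; rewrite cx lerD.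
have zs : cnorm z < s by exact: le_lt_trans zr rs.
have zxs : cnorm (z + x%:C) < s by lra.
have inc : cnorm (G (z + x%:C) - G z) <= 2 / (s - r) ^+ 2 * M * x.
  rewrite -(cauchy_formula dG s1 zs) -(cauchy_formula dG s1 zxs) -cintabB; last 2 first.
  - move=> t _ _; apply: ccontM (cG t) _; apply: ccontM (cu t) _.
    by apply: ccontV (cuy _ t); exact: cu0.
  - move=> t _ _; apply: ccontM (cG t) _; apply: ccontM (cu t) _.
    by apply: ccontV (cuy _ t); exact: cu0.
  rewrite (eq_cintab (G := fun t => G (s%:C * ucirc t) * (s%:C * ucirc t) * x%:C *
      ((s%:C * ucirc t - (z + x%:C))^-1 * (s%:C * ucirc t - z)^-1))); last first.
    by move=> t _ _; field; rewrite !cu0.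
  rewrite -[leRHS]mulr1 -[X in _ * X](subr0 1); apply: (cnorm_cintab ler01).
    move=> t _ _; apply: ccontM; first by apply: ccontM; [exact: ccontM|exact: ccont_cst].
    by apply: ccontM; apply: ccontV => //; exact: cu0.
  move=> t _ _; rewrite !cnormM cx !cnormV cnorm_real cnorm_ucirc mulr1 gtr0_norm//.
  have i1 : (cnorm (s%:C * ucirc t - (z + x%:C)))^-1 <= 2 / (s - r).
    rewrite -[leRHS]invrK lef_pV2 ?posrE ?invr_gt0 ?divr_gt0// ?cnorm_gt0 ?cu0//.
    rewrite invf_div; apply: le_trans (circle_sub_ge _ _ (ltW s0)); lra.
  have i2 : (cnorm (s%:C * ucirc t - z))^-1 <= (s - r)^-1.
    rewrite lef_pV2 ?posrE// ?cnorm_gt0 ?cu0//.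
    apply: le_trans (circle_sub_ge _ _ (ltW s0)); lra.
  have -> : 2 / (s - r) ^+ 2 * M * x = M * 1 * x * (2 / (s - r) * (s - r)^-1).
    by field; rewrite subr_eq0 gt_eqF.
  apply: ler_pM; rewrite 2?mulr_ge0 ?invr_ge0 ?cnorm_ge0 ?(ltW s0) ?(ltW x0)//.
    by rewrite ler_pM2r//; apply: ler_pM; rewrite ?cnorm_ge0 ?(ltW s0) ?(ltW s1).
  by apply: ler_pM; rewrite ?invr_ge0 ?cnorm_ge0.
rewrite -(ler_pM2r x0) -{1}cx -cnormM.
have := cnorm_le_sub (G' z * x%:C) (G (z + x%:C) - G z).
rewrite (cdistC (G' z * _)); have := Hd x%:C; rewrite cx => /(_ xd).
rewrite mulrDl; lra.
Qed.

(** Truncate the geometric expansion of the kernel in Cauchy's formula on a circle of intermediate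
    radius [s]; the tail is of order (r / s)^n. *)
Lemma poly_approx0 F F' r e : deriv_on_disk F F' -> 0 <= r -> r < 1 -> 0 < e ->
  exists p, forall z, cnorm z <= r -> cnorm (F z - p.[z]) <= e.
Proof.
move=> dF r0 r1 e0; pose s := (1 + r) / 2.
have rs : r < s by rewrite /s; lra.
have s1 : s < 1 by rewrite /s; lra.
have s0 : 0 < s by exact: le_lt_trans rs.
have sr : 0 < s - r by rewrite subr_gt0.
have sn0 : s%:C != 0 by rewrite -cnorm_gt0 cnorm_real normr_gt0 gt_eqF.
have cu t : ccont (fun t => s%:C * ucirc t) t.
  by apply: ccontM; [exact: ccont_cst|exact: ccont_ucirc].
have un0 t : s%:C * ucirc t != 0 by rewrite mulf_neq0// ucirc_neq0.
have cG t : ccont (fun t => F (s%:C * ucirc t)) t by apply: ccont_circle dF (ltW s0) s1.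
have [M M0 HM] : exists2 M, 0 <= M & forall t, 0 <= t -> t <= 1 -> cnorm (F (s%:C * ucirc t)) <= M.
  by apply: continuous_bounded => // t _ _; exact: continuous_cnorm.
have rs1 : r / s < 1 by rewrite ltr_pdivrMr// mul1r.
have rs0 : 0 <= r / s by rewrite divr_ge0// ltW.
have [n Hn] := expr_small (M * (s - r)^-1) rs0 rs1 e0.
(* These are the Taylor coefficients of [F] at 0, since d zeta / (2 pi i zeta) is dt. *)
pose a k := cintab 0 1 (fun t => F (s%:C * ucirc t) * (s%:C * ucirc t)^-1 ^+ k).
exists (\poly_(k < n) a k) => z zr.
have zs : cnorm z < s by exact: le_lt_trans zr rs.
have cu0 t : s%:C * ucirc t - z != 0.
  by rewrite -cnorm_gt0 (lt_le_trans _ (circle_sub_ge t z (ltW s0)))// subr_gt0.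
pose ze t := z / (s%:C * ucirc t).
have cze t : ccont ze t by apply: ccontM; [exact: ccont_cst|exact: ccontV].
have ze1 t : ze t != 1.
  by apply/eqP => E; have := cu0 t; rewrite subr_eq0 => /eqP; apply; rewrite -[RHS](divfK (un0 t)) -/(ze t) E mul1r.
have kE t : s%:C * ucirc t / (s%:C * ucirc t - z) = (1 - ze t)^-1.
  have -> : s%:C * ucirc t - z = s%:C * ucirc t * (1 - ze t).
    by rewrite mulrBr mulr1 /ze mulrCA divff// mulr1.
  by rewrite invfM mulrA divff// mul1r.
have cs (m : nat) : contab 0 1 (fun t => F (s%:C * ucirc t) * \sum_(k < m) ze t ^+ k).
  move=> t _ _; apply: ccontM => //; apply: (ccont_sum (F_ := fun k t => ze t ^+ k)) => k.
  exact: ccontX.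
have c1ze t : ccont (fun t => (1 - ze t)^-1) t.
  apply: ccontV; first by rewrite subr_eq0 eq_sym.
  by apply: ccontB => //; exact: ccont_cst.
have cr : contab 0 1 (fun t => F (s%:C * ucirc t) * (ze t ^+ n / (1 - ze t))).
  by move=> t _ _; apply: ccontM => //; apply: ccontM => //; exact: ccontX.
have pE : (\poly_(k < n) a k).[z] = cintab 0 1 (fun t => F (s%:C * ucirc t) * \sum_(k < n) ze t ^+ k).
  rewrite horner_poly; elim: n {Hn cr} => [|m ih].
    rewrite big_ord0 (eq_cintab (G := fun=> 0)); first by rewrite cintab_cst// mul0r.
    by move=> t _ _; rewrite big_ord0 mulr0.
  rewrite big_ord_recr /= ih /a mulrC -cintabZ; last first.
    by move=> t _ _; apply: ccontM => //; apply: ccontX; exact: ccontV.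
  rewrite -cintabD; [|exact: cs|].
    by apply: eq_cintab => t _ _; rewrite big_ord_recr /= /ze exprMn; ring.
  move=> t _ _; apply: ccontM; first exact: ccont_cst.
  by apply: ccontM => //; apply: ccontX; exact: ccontV.
rewrite pE -(cauchy_formula dF s1 zs).
rewrite (eq_cintab (G := fun t => F (s%:C * ucirc t) * \sum_(k < n) ze t ^+ k +
  F (s%:C * ucirc t) * (ze t ^+ n / (1 - ze t)))); last first.
  by move=> t _ _; rewrite kE [in LHS](geom_sumE n (ze1 t)) mulrDr.
rewrite (cintabD (cs n) cr) addrAC subrr add0r.
apply: le_trans (ltW Hn).
rewrite -[leRHS]mulr1 -[X in _ * X](subr0 1); apply: (cnorm_cintab ler01 cr).
move=> t t0 t1; rewrite [leRHS]mulrCA cnormM; apply: ler_pM; rewrite ?cnorm_ge0 ?HM//.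
rewrite cnormM; apply: ler_pM; rewrite ?cnorm_ge0//.
  rewrite cnormX lerXn2r ?nnegrE ?cnorm_ge0// /ze cnormf cnorm_circle ?(ltW s0)//.
  by rewrite ler_pM2r ?invr_gt0.
rewrite -kE cnormf cnorm_circle ?(ltW s0)// -[leRHS]mul1r.
apply: ler_pM; rewrite ?invr_ge0 ?cnorm_ge0 ?(ltW s0) ?(ltW s1)//.
rewrite lef_pV2 ?posrE ?cnorm_gt0//; apply: le_trans (circle_sub_ge _ _ (ltW s0)); lra.
Qed.

Lemma deriv_on_disk_poly p : deriv_on_disk (fun z => p.[z]) (fun z => p^`().[z]).
Proof. by move=> z _; exact: has_cderiv_poly. Qed.

Lemma deriv_on_diskB F F' G G' : deriv_on_disk F F' -> deriv_on_disk G G' ->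
  deriv_on_disk (fun z => F z - G z) (fun z => F' z - G' z).
Proof.
move=> dF dG z dz; have := has_cderivD (dF _ dz) (has_cderivZ (-1) (dG _ dz)).
by rewrite mulN1r; under eq_fun do rewrite mulN1r.
Qed.

(** Approximate on a larger radius [s] and apply [cauchy_estimate] to the difference. Regularity of
    [F'], about which differentiability says nothing directly, is read off from the polynomials. *)
Lemma poly_approx F F' r e : deriv_on_disk F F' -> 0 <= r -> r < 1 -> 0 < e ->
  exists p, forall z, cnorm z <= r ->
    cnorm (F z - p.[z]) <= e /\ cnorm (F' z - p^`().[z]) <= e.
Proof.
move=> dF r0 r1 e0; pose s := (1 + r) / 2.
have rs : r < s by rewrite /s; lra.
have s1 : s < 1 by rewrite /s; lra.
have s0 : 0 < s by exact: le_lt_trans rs.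
have sr : 0 < s - r by rewrite subr_gt0.
pose e1 := Num.min e (e * (s - r) ^+ 2 / 2).
have e10 : 0 < e1 by rewrite lt_min e0 divr_gt0// mulr_gt0// exprn_gt0.
have [p Hp] := poly_approx0 dF (ltW s0) s1 e10.
exists p => z zr; split.
  by apply: le_trans (Hp _ (le_trans zr (ltW rs))) _; rewrite ge_min lexx.
apply: (@le_trans _ _ (2 / (s - r) ^+ 2 * e1)).
  apply: (cauchy_estimate (deriv_on_diskB dF (deriv_on_disk_poly p)) rs s1 _ zr).
  by move=> t; apply: Hp; rewrite cnorm_circle ?(ltW s0).
apply: (@le_trans _ _ (2 / (s - r) ^+ 2 * (e * (s - r) ^+ 2 / 2))).
  rewrite ler_pM2l ?divr_gt0 ?exprn_gt0//; by rewrite ge_min lexx orbT.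
rewrite le_eqVlt; apply/orP; left; apply/eqP; field; by rewrite gt_eqF.
Qed.

Lemma deriv_bounded F F' r : deriv_on_disk F F' -> r < 1 ->
  exists2 M, 0 <= M & forall z, cnorm z <= r -> cnorm (F z) <= M /\ cnorm (F' z) <= M.
Proof.
move=> dF r1.
have [r0|r0] := leP 0 r; last first.
  by exists 0 => // z zr; have := le_lt_trans zr r0; rewrite ltNge cnorm_ge0.
have [p Hp] := poly_approx dF r0 r1 ltr01.
have [M M0 HM] := poly_bounded p; have [N N0 HN] := poly_bounded p^`().
exists (M + N + 1); first by rewrite !addr_ge0.
move=> z zr; have [h1 h2] := Hp _ zr; have z1 := le_trans zr (ltW r1).
have := cnorm_le_sub (F z) p.[z]; have := cnorm_le_sub (F' z) p^`().[z].
have := HM _ z1; have := HN _ z1; lra.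
Qed.

(** On smaller disks [F'] is a uniform limit of polynomials. *)
Lemma deriv_continuous F F' z : deriv_on_disk F F' -> disk z -> forall e, 0 < e ->
  exists2 d, 0 < d & forall h, cnorm h < d -> cnorm (F' (z + h) - F' z) < e.
Proof.
move=> dF dz e e0; pose r := (1 + cnorm z) / 2.
have zr : cnorm z < r by rewrite /r; move: dz; rewrite /disk /=; lra.
have r1 : r < 1 by rewrite /r; move: dz; rewrite /disk /=; lra.
have r0 : 0 <= r by exact: le_trans (cnorm_ge0 _) (ltW zr).
have e4 : 0 < e / 4 by rewrite divr_gt0.
have [p Hp] := poly_approx dF r0 r1 e4.
have [d d0 Hd] := has_cderiv_cont (has_cderiv_poly p^`() z) e4.
exists (Num.min d (r - cnorm z)); first by rewrite lt_min d0 subr_gt0.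
move=> h; rewrite lt_min => /andP[hd hr].
have zh : cnorm (z + h) <= r by apply: le_trans (cnormD _ _) _; lra.
have [_ h1] := Hp _ zh; have [_ h2] := Hp _ (ltW zr); have h3 := Hd _ hd.
rewrite (_ : _ - _ = (F' (z + h) - p^`().[z + h]) + (p^`().[z + h] - p^`().[z])
   - (F' z - p^`().[z])); last by ring.
apply: le_lt_trans (cnormB _ _) _; apply: le_lt_trans (lerD (cnormD _ _) (lexx _)) _; lra.
Qed.

Lemma is_derive_quotient (f : R -> R) x d :
  (forall e, 0 < e -> exists2 del, 0 < del & forall t, `|t| < del ->
     `|f (x + t) - f x - d * t| <= e * `|t|) -> is_derive x 1 f d.
Proof.
move=> H.
have lim : (fun t => t^-1 *: ((f \o shift x) (t *: 1) - f x)) @ 0^' --> d.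
  apply/cvgrPdist_le => e /H[del del0 Hd].
  apply/nbhs_ballP; exists del => // t; rewrite /ball /= sub0r normrN => td tn0.
  rewrite distrC /GRing.scale /= mulr1 (addrC t).
  rewrite (_ : _ - d = (f (x + t) - f x - d * t) / t); last by field.
  by rewrite normf_div ler_pdivrMr ?normr_gt0// Hd.
apply: DeriveDef; first by apply/cvg_ex; exists d.
exact: cvg_lim lim.
Qed.

Lemma is_derive_segment F z h d (t : R) : has_cderiv F (z + t%:C * h) d ->
  is_derive t 1 (fun t => complex.Re (F (z + t%:C * h))) (complex.Re (d * h)) /\
  is_derive t 1 (fun t => complex.Im (F (z + t%:C * h))) (complex.Im (d * h)).
Proof.
move=> /has_cderivP H.
have K e : 0 < e -> exists2 del, 0 < del & forall x, `|x| < del ->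
    cnorm (F (z + (t + x)%:C * h) - F (z + t%:C * h) - d * h * x%:C) <= e * `|x|.
  move=> e0; have h1 : 0 < cnorm h + 1 by rewrite ltr_wpDl ?cnorm_ge0.
  have [u u0 Hu] := H (e / (cnorm h + 1)) (divr_gt0 e0 h1).
  exists (u / (cnorm h + 1)); first by rewrite divr_gt0.
  move=> x xu.
  rewrite (_ : z + (t + x)%:C * h = z + t%:C * h + x%:C * h); last by rewrite rmorphD /=; ring.
  rewrite (_ : d * h * x%:C = d * (x%:C * h)); last by ring.
  have hx : cnorm (x%:C * h) <= `|x| * (cnorm h + 1).
    by rewrite cnormM cnorm_real ler_wpM2l// lerDl.
  apply: le_trans (Hu _ _) _; first by apply: le_lt_trans hx _; rewrite -ltr_pdivlMr.
  rewrite -mulrA ler_pM2l// mulrC ler_pdivrMr//.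
split; apply: is_derive_quotient => e /K[del del0 Hd]; exists del => // x /Hd; apply: le_trans.
- by apply: le_trans (normRe_le _); rewrite !(cReD, cReN, cReM) /= mulr0 subr0.
- by apply: le_trans (normIm_le _); rewrite !(cImD, cImN, cImM) /= !mulr0 add0r.
Qed.

(** Integrate [F'] along the segment, which stays in the disk of radius [r] by convexity. *)
Lemma deriv_increment F F' r M z w : deriv_on_disk F F' -> r < 1 ->
  (forall y, cnorm y <= r -> cnorm (F' y) <= M) -> cnorm z <= r -> cnorm w <= r ->
  cnorm (F z - F w) <= M * cnorm (z - w).
Proof.
move=> dF r1 FM zr wr; pose g (t : R) := w + t%:C * (z - w).
have gr t : 0 <= t -> t <= 1 -> cnorm (g t) <= r.
  move=> t0 t1; rewrite /g (_ : _ + _ = (1 - t)%:C * w + t%:C * z); last by rewrite rmorphB /=; ring.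
  apply: le_trans (cnormD _ _) _; rewrite !cnormM !cnorm_real !ger0_norm ?subr_ge0//.
  have : (1 - t) * cnorm w <= (1 - t) * r by rewrite ler_wpM2l ?subr_ge0.
  have : t * cnorm z <= t * r by rewrite ler_wpM2l.
  lra.
have gd t : 0 <= t -> t <= 1 -> disk (g t) by move=> t0 t1; apply: disk_le r1 (gr _ t0 t1).
have cg t : ccont g t.
  apply: ccontD; first exact: ccont_cst.
  by apply: ccontM; [apply: (ccont_real (f := id)); exact: cvg_id|exact: ccont_cst].
have cF' : contab 0 1 (fun t => F' (g t) * (z - w)).
  move=> t t0 t1; apply: ccontM; last exact: ccont_cst.
  by apply: ccont_comp => //; apply: deriv_continuous dF _; exact: gd.
have -> : F z - F w = cintab 0 1 (fun t => F' (g t) * (z - w)).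
  have g0 : g 0 = w by rewrite /g mul0r addr0.
  have g1 : g 1 = z by rewrite /g mul1r addrC subrK.
  have E1 : complex.Re (cintab 0 1 (fun t => F' (g t) * (z - w))) =
      complex.Re (F (g 1)) - complex.Re (F (g 0)).
    apply: (FTC_real (F := fun t => complex.Re (F (g t)))) => // t t0 t1.
      by have [] := is_derive_segment (dF (g t) (gd t t0 t1)).
    by have [] := cF' _ t0 t1.
  have E2 : complex.Im (cintab 0 1 (fun t => F' (g t) * (z - w))) =
      complex.Im (F (g 1)) - complex.Im (F (g 0)).
    apply: (FTC_real (F := fun t => complex.Im (F (g t)))) => // t t0 t1.
      by have [] := is_derive_segment (dF (g t) (gd t t0 t1)).
    by have [] := cF' _ t0 t1.
  by apply/eqP; rewrite eq_complex cReD cReN cImD cImN E1 E2 g0 g1 !eqxx.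
rewrite -[leRHS]mulr1 -[X in _ * X](subr0 1); apply: cnorm_cintab => // t t0 t1.
by rewrite cnormM ler_wpM2r ?cnorm_ge0 ?FM ?gr.
Qed.

End PolynomialApproximation.

(** * Tonelli's theorem and substitution for Lebesgue integrals *)

Section IntegralTools.
Context {R : realType}.
Local Notation mu := (@lebesgue_measure R).
Implicit Types (a b c : R).

Lemma measurable_tonelli (f : R * R -> R) (B : set R) : measurable B ->
  measurable_fun setT f -> (forall p, 0 <= f p) ->
  measurable_fun setT (fun x => \int[mu]_(y in B) (f (x, y))%:E)%E.
Proof.
move=> mB mf f0.
rewrite (_ : (fun x => _) = fun x => (\int[mu]_y (f (x, y) * \1_B y)%:E)%E); last first.
  apply/funext => x; rewrite integral_mkcond; apply: eq_integral => y _.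
  by rewrite patchE indicE; case: (y \in B); rewrite ?mulr1 ?mulr0.
apply: (@measurable_fun_fubini_tonelli_F _ _ _ _ _ mu (fun p => (f p * \1_B p.2)%:E)).
- apply/measurable_EFinP; apply: measurable_funM => //.
  exact: measurableT_comp.
- by move=> p; rewrite lee_fin mulr_ge0.
Qed.

Lemma tonelli_rect (f : R * R -> R) (A B : set R) : measurable A -> measurable B ->
  measurable_fun setT f -> (forall p, 0 <= f p) ->
  (\int[mu]_(x in A) \int[mu]_(y in B) (f (x, y))%:E =
   \int[mu]_(y in B) \int[mu]_(x in A) (f (x, y))%:E)%E.
Proof.
move=> mA mB mf f0.
pose g (p : R * R) := (f p * (\1_A p.1 * \1_B p.2))%:E.
have mg : measurable_fun setT g.
  apply/measurable_EFinP; apply: measurable_funM => //; apply: measurable_funM; exact: measurableT_comp.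
have g0 p : (0 <= g p)%E by rewrite lee_fin !mulr_ge0.
transitivity (\int[mu]_x \int[mu]_y g (x, y))%E.
  rewrite integral_mkcond; apply: eq_integral => x _; rewrite patchE.
  case: ifPn => xA; last first.
    rewrite (_ : (fun y => g (x, y)) = cst 0%E) ?integral0//.
    by apply/funext => y; rewrite /g /= indicE (negbTE xA) mul0r mulr0.
  rewrite integral_mkcond; apply: eq_integral => y _; rewrite patchE /g /= !indicE xA mul1r.
  by case: (y \in B); rewrite ?mulr1 ?mulr0.
rewrite (@fubini_tonelli _ _ _ _ _ mu mu g mg g0) [RHS]integral_mkcond; apply: eq_integral => y _; rewrite patchE.
case: ifPn => yB; last first.
  rewrite (_ : (fun x => g (x, y)) = cst 0%E) ?integral0//.
  by apply/funext => x; rewrite /g /= !indicE (negbTE yB) !mulr0.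
rewrite [RHS]integral_mkcond; apply: eq_integral => x _; rewrite patchE /g /= !indicE yB mulr1.
by case: (x \in A); rewrite ?mulr1 ?mulr0.
Qed.

(** The margin [e] makes the derivative of [F] coincide with [f] around both endpoints, so that it
    is two-sidedly continuous there too. *)
Lemma integral_subst (F f G : R -> R) a b e : a <= b -> 0 < e ->
  (forall x, a - e < x -> x < b + e -> is_derive x 1 F (f x)) ->
  (forall x, a <= x -> x <= b -> {for x, continuous f}) ->
  (forall x, a <= x -> x <= b -> 0 < f x) ->
  (forall y, F a <= y -> y <= F b -> {for y, continuous G}) ->
  (\int[mu]_(y in `[F a, F b]) (G y)%:E = \int[mu]_(x in `[a, b]) (G (F x) * f x)%:E)%E.
Proof.
move=> ab e0 dF' cf f0 cG.
have dF x : a <= x -> x <= b -> is_derive x 1 F (f x).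
  by move=> ax xb; apply: dF'; lra.
have fE x : a - e < x -> x < b + e -> (derive1 F) x = f x.
  by move=> ax xb; rewrite derive1E; have H := dF' _ ax xb; rewrite derive_val.
have fE' x : a <= x -> x <= b -> (derive1 F) x = f x.
  by move=> ax xb; apply: fE; lra.
have cF x : a <= x -> x <= b -> {for x, continuous F}.
  by move=> ax xb; apply: is_derive_continuous (dF _ ax xb).
have cF' x : a <= x -> x <= b -> {for x, continuous (derive1 F)}.
  move=> ax xb; apply/continuous_ballP => d d0.
  have [u u0 Hu] := (continuous_ballP _ _).1 (cf _ ax xb) _ d0.
  exists (Num.min u e); first by rewrite lt_min u0.
  move=> s; rewrite lt_min => /andP[su]; rewrite ltr_norml => /andP[s1 s2].
  by rewrite !fE ?Hu//; lra.
rewrite (@integration_by_substitution_increasing R F G a b)//.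
- apply: eq_integral => x /set_mem /=; rewrite in_itv /= => /andP[ax xb].
  by rewrite fctE /= fE'.
- move=> x y; rewrite !in_itv /= => /andP[ax xb] /andP[ay yb] xy.
  apply: (@gtr0_derive1_incr R F a b) => //.
  + by move=> z; rewrite in_itv /= => /andP[/ltW az /ltW zb]; case: (dF _ az zb).
  + by move=> z; rewrite in_itv /= => /andP[/ltW az /ltW zb]; rewrite fE'// f0.
  + apply: continuous_in_subspaceT => z /set_mem /=; rewrite in_itv /= => /andP[].
    exact: cF.
- by move=> z; rewrite in_itv /= => /andP[/ltW az /ltW zb]; exact: cF'.
- apply/cvg_ex; exists ((derive1 F) a); apply: cvg_at_right_filter; exact: cF'.
- apply/cvg_ex; exists ((derive1 F) b); apply: cvg_at_left_filter; exact: cF'.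
- split.
  + by move=> z; rewrite in_itv /= => /andP[/ltW az /ltW zb]; case: (dF _ az zb).
  + by apply: cvg_at_right_filter; exact: cF.
  + by apply: cvg_at_left_filter; exact: cF.
- apply: continuous_in_subspaceT => z /set_mem /=; rewrite in_itv /= => /andP[].
  exact: cG.
Qed.

Lemma ge0_integral_itv_cat (f : R -> \bar R) a b c : a <= b -> b <= c ->
  measurable_fun setT f -> (forall x, 0 <= f x)%E ->
  (\int[mu]_(x in `[a, c]) f x <= \int[mu]_(x in `[a, b]) f x + \int[mu]_(x in `[b, c]) f x)%E.
Proof.
move=> ab bc mf f0.
have -> : `[a, c]%classic = `[a, b]%classic `|` `]b, c]%classic.
  by rewrite -itv_bndbnd_setU// bnd_simp.
rewrite ge0_integral_setU//=.
- apply: leeD => //; apply: ge0_subset_integral => //.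
    exact: measurable_funTS.
  by apply: subset_itvr; rewrite bnd_simp.
- exact: measurable_funTS.
- apply/disj_setPS => y [/=]; rewrite !in_itv /= => /andP[_ yb] /andP[].
  by rewrite ltNge yb.
Qed.

End IntegralTools.

(** * Polar coordinates as an inequality between iterated integrals *)

Section Polar.
Context {R : realType}.
Local Notation mu := (@lebesgue_measure R).
Variable K : R[i] -> R.
Hypothesis K_ge0 : forall z, 0 <= K z.
Hypothesis mK : measurable_fun [set: R * R] (fun p => K (Complex p.1 p.2)).
Hypothesis cK : forall F t, ccont F t -> {for t, continuous (fun t => K (F t))}.

Let mK_comp (f g : R * R -> R) : measurable_fun setT f -> measurable_fun setT g ->
  measurable_fun setT (fun p => K (Complex (f p) (g p))).
Proof.
move=> mf mg.
apply: (measurableT_comp (f := fun p : R * R => K (Complex p.1 p.2)) (g := fun p => (f p, g p)) mK).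
exact: measurable_fun_pair.
Qed.

Let measurable_section (f : R * R -> R) (x : R) : measurable_fun setT f ->
  measurable_fun setT (fun y => f (x, y)).
Proof.
move=> mf; apply: (measurableT_comp (g := fun y => (x, y)) mf).
exact: measurable_fun_pair.
Qed.

Let measurable_section2 (f : R * R -> R) (y : R) : measurable_fun setT f ->
  measurable_fun setT (fun x => f (x, y)).
Proof.
move=> mf; apply: (measurableT_comp (g := fun x => (x, y)) mf).
exact: measurable_fun_pair.
Qed.

Let measurable_swap (f : R * R -> R) : measurable_fun setT f ->
  measurable_fun setT (fun p : R * R => f (p.2, p.1)).
Proof.
move=> mf; apply: (measurableT_comp (g := fun p : R * R => (p.2, p.1)) mf).
exact: measurable_fun_pair.
Qed.

Let mK_rot (w : R[i]) (f g : R * R -> R) : measurable_fun setT f -> measurable_fun setT g ->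
  measurable_fun setT (fun p => K (w * Complex (f p) (g p))).
Proof.
case: w => c s mf mg.
rewrite (_ : (fun p => _) = fun p => K (Complex (c * f p - s * g p) (c * g p + s * f p)))//.
by apply: mK_comp; [apply: measurable_funB|apply: measurable_funD]; exact: measurable_funM.
Qed.

Let ccont_Complex (f g : R -> R) t : {for t, continuous f} -> {for t, continuous g} ->
  ccont (fun t => Complex (f t) (g t)) t.
Proof. by move=> cf cg; split. Qed.

Let cK_rot (w : R[i]) (f g : R -> R) t : {for t, continuous f} -> {for t, continuous g} ->
  {for t, continuous (fun t => K (w * Complex (f t) (g t)))}.
Proof.
by move=> cf cg; apply: cK; apply: ccontM; [exact: ccont_cst|exact: ccont_Complex].
Qed.

Lemma measurable_polar : measurable_fun [set: R * R] (fun p => K (p.2%:C * ucirc p.1) * `|p.2|).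
Proof.
apply: measurable_funM; last by apply: measurableT_comp => //; exact: measurableT_comp.
rewrite (_ : (fun p => _) = fun p : R * R => K (Complex (p.2 * cos (2 * pi * p.1)) (p.2 * sin (2 * pi * p.1)))).
  apply: mK_comp; apply: measurable_funM => //; apply: (measurableT_comp (f := _)).
  - by apply: continuous_measurable_fun; exact: continuous_cos.
  - exact: measurable_funM.
  - by apply: continuous_measurable_fun; exact: continuous_sin.
  - exact: measurable_funM.
apply/funext => p; congr K; apply/eqP; rewrite eq_complex cReM cImM /= !mul0r subr0 addr0.
by rewrite !eqxx.
Qed.

Let cos_gt0_quarter (d : R) : - (1 / 4) < d -> d < 1 / 4 -> 0 < cos (2 * pi * d).
Proof.
move=> d1 d2; apply: cos_gt0_pihalf; have p0 := pi_gt0 R; apply/andP; split.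
  by rewrite -subr_gt0 (_ : _ - _ = 2 * pi * (d + 1 / 4)) ?mulr_gt0//; [lra|field].
by rewrite -subr_gt0 (_ : _ - _ = 2 * pi * (1 / 4 - d)) ?mulr_gt0//; [lra|field].
Qed.

(* In the frame rotated by [a], the sector is mapped into the square by
   x = t cos, y = x tan, one variable at a time. *)
Lemma polar_sector (a : R) :
  (\int[mu]_(x in `[(a - 1 / 8)%R, (a + 1 / 8)%R]) \int[mu]_(t in `[0%R, 1%R])
     (K (t%:C * ucirc x) * `|t|)%:E <=
   \int[mu]_(x in `[(-1)%R, 1%R]) \int[mu]_(y in `[(-1)%R, 1%R]) (K (ucirc a * Complex x y))%:E)%E.
Proof.
(* Clamping the angle keeps the tangent away from its poles, so [T] is continuous, hence measurable,
   on the whole line. *)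
pose psi th := Num.max (- (1 / 8)) (Num.min (th - a) (1 / 8)).
have psi_ge th : - (1 / 8) <= psi th by rewrite le_max lexx.
have psi_le th : psi th <= 1 / 8 by rewrite ge_max ge_min lexx orbT andbT; lra.
have psiE th : a - 1 / 8 <= th -> th <= a + 1 / 8 -> psi th = th - a.
  move=> h1 h2; rewrite /psi (_ : Num.min _ _ = th - a); first by apply/max_idPr; lra.
  by apply/min_idPl; lra.
pose T th := tan (2 * pi * psi th).
have cpsi th : {for th, continuous psi}.
  apply: continuous_max; first exact: cst_continuous.
  apply: continuous_min; last exact: cst_continuous.
  by apply: continuousB; [exact: cvg_id|exact: cst_continuous].
have cT : continuous T.
  move=> th; apply: (@continuous_comp _ _ _ (fun th => 2 * pi * psi th) tan).
    by apply: continuousM; [exact: cst_continuous|exact: cpsi].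
  apply: continuous_tan; rewrite gt_eqF// cos_gt0_quarter//.
    by apply: lt_le_trans (psi_ge th); lra.
  by apply: le_lt_trans (psi_le th) _; lra.
have mT : measurable_fun setT T := continuous_measurable_fun cT.
pose H (p : R * R) := K (ucirc a * Complex p.2 (p.2 * T p.1)) * (`|p.2| * (1 + T p.1 ^+ 2)).
have H0 p : 0 <= H p by rewrite mulr_ge0// mulr_ge0// addr_ge0// sqr_ge0.
have mT1 : measurable_fun [set: R * R] (fun p => T p.1) by exact: measurableT_comp.
have mH : measurable_fun setT H.
  apply: measurable_funM; first by apply: mK_rot => //; exact: measurable_funM.
  apply: measurable_funM; first by apply: measurableT_comp => //; exact: measurableT_comp.
  by apply: measurable_funD => //; exact: measurable_funX.
have mpol := measurable_polar.
have pol0 (p : R * R) : 0 <= K (p.2%:C * ucirc p.1) * `|p.2| by rewrite mulr_ge0.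
have mrot : measurable_fun [set: R * R] (fun p => K (ucirc a * Complex p.1 p.2)) by exact: mK_rot.
have pi2 : 1 <= 2 * pi :> R by have := pi_ge2 R; lra.
apply: (@le_trans _ _ (\int[mu]_(x in `[(a - 1 / 8)%R, (a + 1 / 8)%R]) \int[mu]_(t in `[0%R, 1%R]) (H (x, t))%:E)%E).
  apply: ge0_le_integral => //.
  - by move=> x _; apply: integral_ge0 => t _; rewrite lee_fin (pol0 (x, t)).
  - by apply: measurable_funTS; apply: (measurable_tonelli _ mpol).
  - by apply: measurable_funTS; apply: (measurable_tonelli _ mH).
  - move=> th; rewrite /= in_itv /= => /andP[th1 th2].
    have thE := psiE _ th1 th2.
    pose d := th - a; pose c := cos (2 * pi * d); pose s := sin (2 * pi * d).
    have c0 : 0 < c by apply: cos_gt0_quarter; rewrite /d; lra.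
    have cTs : c * T th = s by rewrite /T thE -/d /tan mulrC divfK// gt_eqF.
    have cT1 : c ^+ 2 * (1 + T th ^+ 2) = 1.
      by rewrite mulrDr mulr1 -exprMn cTs /c /s cos2Dsin2.
    pose G x := K (ucirc a * Complex x (x * T th)) * (x * (1 + T th ^+ 2)).
    (* At a fixed angle substitute x = c t: then t dt is x dx / c^2, which is x (1 + tan^2) dx by
       [cT1]. *)
    rewrite (_ : (\int[mu]_(t in _) (K (t%:C * ucirc th) * `|t|)%:E)%E =
        (\int[mu]_(x in `[(c * 0)%R, (c * 1)%R]) (G x)%:E)%E); last first.
      have HD (t : R) : 0 - 1 < t -> t < 1 + 1 -> is_derive t 1 (fun t => c * t) c.
        by move=> _ _; exact: is_derive_scale.
      rewrite (@integral_subst _ (fun t => c * t) (fun=> c) G 0 1 1 ler01 ltr01 HD)//.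
      - apply: eq_integral => t /set_mem /=; rewrite in_itv /= => /andP[t0 t1].
        rewrite ger0_norm//; congr (_%:E).
        rewrite /G (_ : K (ucirc a * _) = K (t%:C * ucirc th)).
          rewrite -mulrA; congr (_ * _).
          have -> : c * t * (1 + T th ^+ 2) * c = t * (c ^+ 2 * (1 + T th ^+ 2)) by ring.
          by rewrite cT1 mulr1.
        congr K; rewrite (_ : Complex _ _ = t%:C * ucirc d).
          by rewrite mulrCA -ucircD /d (addrC th) addrA subrr add0r.
        rewrite (mulrC c) -mulrA cTs; apply/eqP; rewrite eq_complex cReM cImM /= !mul0r subr0 addr0.
        by rewrite !eqxx.
      - by move=> t _ _; exact: cst_continuous.
      - move=> y _ _; apply: continuousM; last first.
          by apply: continuousM; [exact: cvg_id|exact: cst_continuous].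
        apply: cK_rot; first exact: cvg_id.
        by apply: continuousM; [exact: cvg_id|exact: cst_continuous].
    rewrite mulr0 mulr1.
    apply: (@le_trans _ _ (\int[mu]_(x in `[0%R, c]) (H (th, x))%:E)%E).
      rewrite le_eqVlt; apply/orP; left; apply/eqP; apply: eq_integral => x /set_mem /=.
      by rewrite in_itv /= => /andP[x0 _]; rewrite /G /H /= ger0_norm.
    apply: ge0_subset_integral => //.
    + apply/measurable_EFinP; apply: measurable_funTS.
      exact: measurable_section mH.
    + by move=> x _; rewrite lee_fin H0.
    + by apply: subset_itvl; rewrite bnd_simp; exact: cos_le1.
rewrite (tonelli_rect _ _ mH H0)//.
apply: (@le_trans _ _ (\int[mu]_(x in `[0%R, 1%R]) \int[mu]_(y in `[(-1)%R, 1%R]) (K (ucirc a * Complex x y))%:E)%E); last first.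
  apply: ge0_subset_integral => //.
  - by apply: measurable_funTS; apply: (measurable_tonelli (f := fun p => K (ucirc a * Complex p.1 p.2))).
  - by move=> x _; apply: integral_ge0 => y _; rewrite lee_fin.
  - by apply: subset_itvr; rewrite bnd_simp; lra.
apply: ge0_le_integral => //.
- by move=> x _; apply: integral_ge0 => t _; rewrite lee_fin H0.
- apply: measurable_funTS; apply: (measurable_tonelli (f := fun p => H (p.2, p.1))) => //.
  exact: measurable_swap.
- by apply: measurable_funTS; apply: (measurable_tonelli (f := fun p => K (ucirc a * Complex p.1 p.2))).
move=> x; rewrite /= in_itv /= => /andP[+ x1].
rewrite le_eqVlt => /predU1P[<-|x0].
  rewrite (_ : (\int[mu]_(th in _) _)%E = 0%E); first by apply: integral_ge0 => t _; rewrite lee_fin.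
  by apply: integral0_eq => th _; rewrite /H /= normr0 !mul0r mulr0.
pose F th := x * tan (2 * pi * (th - a)).
pose f th := x * ((cos (2 * pi * (th - a))) ^- 2 * (2 * pi)).
pose G y := K (ucirc a * Complex x y).
have cG y : {for y, continuous G} by apply: cK_rot; [exact: cst_continuous|exact: cvg_id].
have Fa1 : F (a - 1 / 8) = - x.
  rewrite /F (_ : 2 * pi * _ = - (pi / 4)); last by field.
  by rewrite tanN tan_piquarter mulrN1.
have Fa2 : F (a + 1 / 8) = x.
  rewrite /F (_ : 2 * pi * _ = pi / 4); last by field.
  by rewrite tan_piquarter mulr1.
apply: (@le_trans _ _ (\int[mu]_(y in `[F (a - 1 / 8)%R, F (a + 1 / 8)%R]) (G y)%:E)%E); last first.
  rewrite Fa1 Fa2; apply: ge0_subset_integral => //.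
  - apply/measurable_EFinP; apply: measurable_funTS; apply: continuous_measurable_fun => y; exact: cG.
  - by move=> y _; rewrite lee_fin /G.
  - move=> y /=; rewrite !in_itv /= => /andP[y1 y2]; apply/andP; split; lra.
(* The margin 1 / 8 demanded by [integral_subst] still leaves the angle below a quarter turn. *)
have cs th : a - 1 / 8 - 1 / 8 < th -> th < a + 1 / 8 + 1 / 8 -> 0 < cos (2 * pi * (th - a)).
  by move=> *; apply: cos_gt0_quarter; lra.
have c_aff th : {for th, continuous (fun th => 2 * pi * (th - a))}.
  apply: continuousM; first exact: cst_continuous.
  by apply: continuousB; [exact: cvg_id|exact: cst_continuous].
have cf th : a - 1 / 8 <= th -> th <= a + 1 / 8 -> {for th, continuous f}.
  move=> h1 h2; apply: continuousM; first exact: cst_continuous.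
  apply: continuousM; last exact: cst_continuous.
  apply: continuousV; first by rewrite expf_neq0// gt_eqF// cs; lra.
  apply: (@continuous_comp _ _ _ (fun th => cos (2 * pi * (th - a))) (fun y : R => y ^+ 2)).
    by apply: (@continuous_comp _ _ _ (fun th => 2 * pi * (th - a)) cos) => //; exact: continuous_cos.
  exact: exprn_continuous.
have cF th : a - 1 / 8 <= th -> th <= a + 1 / 8 -> {for th, continuous F}.
  move=> h1 h2; apply: continuousM; first exact: cst_continuous.
  apply: (@continuous_comp _ _ _ (fun th => 2 * pi * (th - a)) tan) => //.
  by apply: continuous_tan; rewrite gt_eqF// cs; lra.
have HD th : a - 1 / 8 - 1 / 8 < th -> th < a + 1 / 8 + 1 / 8 -> is_derive th 1 F (f th).
  move=> h1 h2; have H1 := is_derive_tan (lt0r_neq0 (cs _ h1 h2)).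
  have H2 : is_derive th 1 (fun th => 2 * pi * (th - a)) (2 * pi).
    rewrite (_ : (fun th => _) = fun th => 2 * pi * th - 2 * pi * a); last first.
      by apply/funext => y; rewrite mulrBr.
    have H3 := is_derive_scale (2 * pi) th.
    have := is_deriveB H3 (is_derive_cst (2 * pi * a) th 1).
    by rewrite subr0.
  exact: (is_deriveZ x (@is_derive1_comp R tan (fun th => 2 * pi * (th - a)) th _ _ H1 H2)).
have ale : a - 1 / 8 <= a + 1 / 8 by lra.
have e8 : 0 < 1 / 8 :> R by lra.
rewrite (@integral_subst _ F f G _ _ (1 / 8) ale e8 HD)//.
- apply: ge0_le_integral => //.
  + by move=> th _; rewrite lee_fin H0.
  + apply/measurable_EFinP; apply: measurable_funTS.
    exact: measurable_section2 mH.
  + apply/measurable_EFinP; apply: subspace_continuous_measurable_fun => //.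
    apply: continuous_in_subspaceT => th /set_mem /=; rewrite in_itv /= => /andP[h1 h2].
    apply: (@continuousM _ _ (fun th => G (F th)) f); last exact: cf.
    by apply: (@continuous_comp _ _ _ F G); [exact: cF|exact: cG].
  + move=> th; rewrite /= in_itv /= => /andP[h1 h2]; rewrite lee_fin /H /G /f /F /= /T psiE//.
    rewrite (gtr0_norm x0) ler_wpM2l// ler_pM2l// -cos2_tan2; last by rewrite gt_eqF// cs; lra.
    by rewrite -[leLHS]mulr1 ler_wpM2l// invr_ge0 sqr_ge0.
- move=> th h1 h2; rewrite /f mulr_gt0// mulr_gt0 ?invr_gt0 ?exprn_gt0 ?cs//; lra.
Qed.

Let swap_square (f : R * R -> R) : measurable_fun setT f -> (forall p, 0 <= f p) ->
  (\int[mu]_(x in `[(-1)%R, 1%R]) \int[mu]_(y in `[(-1)%R, 1%R]) (f (x, y))%:E =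
   \int[mu]_(x in `[(-1)%R, 1%R]) \int[mu]_(y in `[(-1)%R, 1%R]) (f (y, x))%:E)%E.
Proof. by move=> mf f0; rewrite tonelli_rect. Qed.

Let reflect_int (h : R -> R) : (forall y, {for y, continuous h}) ->
  (\int[mu]_(y in `[(-1)%R, 1%R]) (h (- y))%:E = \int[mu]_(y in `[(-1)%R, 1%R]) (h y)%:E)%E.
Proof.
move=> ch; have := @integration_by_substitution_oppr R h (-1) 1.
have le11 : -1 <= 1 :> R by lra.
move=> /(_ le11); rewrite opprK => -> //.
by apply: continuous_in_subspaceT => y _; exact: ch.
Qed.

Let K_square := (\int[mu]_(x in `[(-1)%R, 1%R]) \int[mu]_(y in `[(-1)%R, 1%R]) (K (Complex x y))%:E)%E.

Let cK1 (x : R) t : {for t, continuous (fun t => K (Complex x t))}.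
Proof. by apply: cK; apply: ccont_Complex; [exact: cst_continuous|exact: cvg_id]. Qed.

Let cK2 (x : R) t : {for t, continuous (fun t => K (Complex t x))}.
Proof. by apply: cK; apply: ccont_Complex; [exact: cvg_id|exact: cst_continuous]. Qed.

(** Quarter turns map the square to itself, so the sectors in all directions compare with the same
    integral [K_square]. *)
Let square_i : (\int[mu]_(x in `[(-1)%R, 1%R]) \int[mu]_(y in `[(-1)%R, 1%R])
  (K (Complex (- y) x))%:E)%E = K_square.
Proof.
transitivity (\int[mu]_(x in `[(-1)%R, 1%R]) \int[mu]_(y in `[(-1)%R, 1%R]) (K (Complex y x))%:E)%E.
  by apply: eq_integral => x _; rewrite (@reflect_int (fun y => K (Complex y x)))// => y; exact: cK2.
by rewrite (swap_square (f := fun p => K (Complex p.2 p.1)))//; exact: mK_comp.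
Qed.

Let square_Ni : (\int[mu]_(x in `[(-1)%R, 1%R]) \int[mu]_(y in `[(-1)%R, 1%R])
  (K (Complex y (- x)))%:E)%E = K_square.
Proof.
rewrite (swap_square (f := fun p => K (Complex p.2 (- p.1)))).
- by apply: eq_integral => x _; apply: (reflect_int (h := fun y => K (Complex x y))); exact: cK1.
- by apply: mK_comp; [exact: measurable_snd|apply: measurableT_comp (measurable_fst)].
- by move=> p; exact: K_ge0.
Qed.

Let square_N1 : (\int[mu]_(x in `[(-1)%R, 1%R]) \int[mu]_(y in `[(-1)%R, 1%R])
  (K (Complex (- x) (- y)))%:E)%E = K_square.
Proof.
transitivity (\int[mu]_(x in `[(-1)%R, 1%R]) \int[mu]_(y in `[(-1)%R, 1%R]) (K (Complex (- x) y))%:E)%E.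
  by apply: eq_integral => x _; rewrite (@reflect_int (fun y => K (Complex (- x) y)))// => y; exact: cK1.
rewrite (swap_square (f := fun p => K (Complex (- p.1) p.2)))//=. 
by apply: mK_comp => //; exact: measurableT_comp.
Qed.

Let ucirc_quarters : [/\ ucirc (1 / 4 : R) = Complex 0 1, ucirc (1 / 2 : R) = - 1 & ucirc (3 / 4 : R) = Complex 0 (- 1)].
Proof.
have h1 : ucirc (1 / 4 : R) = Complex 0 1.
  by rewrite /ucirc (_ : 2 * pi * _ = pi / 2) ?cos_pihalf ?sin_pihalf//; field.
have h2 : ucirc (1 / 2 : R) = -1.
  rewrite (_ : 1 / 2 = 1 / 4 + 1 / 4); last by field.
  by rewrite ucircD h1; apply/eqP; rewrite eq_complex /=; apply/andP; split; apply/eqP; ring.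
split => //; rewrite (_ : 3 / 4 = 1 / 2 + 1 / 4); last by field.
by rewrite ucircD h1 h2; apply/eqP; rewrite eq_complex /=; apply/andP; split; apply/eqP; ring.
Qed.

Let sector_le (k : R) : k \in [:: 0; 1 / 4; 1 / 2; 3 / 4; 1] ->
  (\int[mu]_(x in `[(k - 1 / 8)%R, (k + 1 / 8)%R]) \int[mu]_(t in `[0%R, 1%R])
     (K (t%:C * ucirc x) * `|t|)%:E <= K_square)%E.
Proof.
have [h1 h2 h3] := ucirc_quarters.
have E1 : (\int[mu]_(x in `[(-1)%R, 1%R]) \int[mu]_(y in `[(-1)%R, 1%R]) (K (1 * Complex x y))%:E = K_square)%E.
  by apply: eq_integral => x _; apply: eq_integral => y _; rewrite mul1r.
rewrite !inE => /or4P[/eqP->|/eqP->|/eqP->|/orP[/eqP->|/eqP->]]; apply: le_trans (polar_sector _) _.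
- by rewrite ucirc0 E1.
- rewrite h1 -square_i le_eqVlt; apply/orP; left; apply/eqP.
  apply: eq_integral => x _; apply: eq_integral => y _; congr (K _)%:E.
  by apply/eqP; rewrite eq_complex /=; apply/andP; split; apply/eqP; ring.
- rewrite h2 -square_N1 le_eqVlt; apply/orP; left; apply/eqP.
  apply: eq_integral => x _; apply: eq_integral => y _; congr (K _)%:E.
  by rewrite mulN1r.
- rewrite h3 -square_Ni le_eqVlt; apply/orP; left; apply/eqP.
  apply: eq_integral => x _; apply: eq_integral => y _; congr (K _)%:E.
  by apply/eqP; rewrite eq_complex /=; apply/andP; split; apply/eqP; ring.
- by rewrite ucirc1 E1.
Qed.

(* The factor 5 counts the sectors of angle 1/4 centred at 0, 1/4, 1/2, 3/4 and 1. *)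
Lemma polar_integral :
  (\int[mu]_(t in `[0%R, 1%R]) \int[mu]_(x in `[0%R, 1%R]) (K (t%:C * ucirc x) * `|t|)%:E <=
   5%:E * \int[mu]_x \int[mu]_y (K (Complex x y))%:E)%E.
Proof.
have mpol := measurable_polar.
have pol0 (p : R * R) : 0 <= K (p.2%:C * ucirc p.1) * `|p.2| by rewrite mulr_ge0.
rewrite -(tonelli_rect (f := fun p => K (p.2%:C * ucirc p.1) * `|p.2|))//.
pose J (x : R) := (\int[mu]_(t in `[0%R, 1%R]) (K (t%:C * ucirc x) * `|t|)%:E)%E.
have mJ : measurable_fun setT J by apply: (measurable_tonelli _ mpol).
have J0 x : (0 <= J x)%E by apply: integral_ge0 => t _; rewrite lee_fin (pol0 (x, t)).
have cat5 : (\int[mu]_(x in `[(- (1 / 8))%R, (9 / 8)%R]) J x <= 5%:E * K_square)%E.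
  have s1 := sector_le (k := 0); have s2 := sector_le (k := 1 / 4).
  have s3 := sector_le (k := 1 / 2); have s4 := sector_le (k := 3 / 4).
  have s5 := sector_le (k := 1).
  rewrite (_ : - (1 / 8) = 0 - 1 / 8 :> R); last by field.
  have cat (x y z : R) (a b : \bar R) : x <= y -> y <= z -> (\int[mu]_(x in `[x, y]) J x <= a)%E ->
      (\int[mu]_(x in `[y, z]) J x <= b)%E -> (\int[mu]_(x in `[x, z]) J x <= a + b)%E.
    move=> xy yz ha hb; apply: le_trans (ge0_integral_itv_cat xy yz mJ J0) _.
    exact: leeD.
  have -> : (5%:E * K_square = K_square + (K_square + (K_square + (K_square + K_square))))%E.
    exact: mule_natl K_square 5.
  apply: (cat _ (0 + 1 / 8)); [lra|lra|by apply: s1; rewrite !inE eqxx|].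
  rewrite (_ : 0 + 1 / 8 = 1 / 4 - 1 / 8 :> R); last by field.
  apply: (cat _ (1 / 4 + 1 / 8)); [lra|lra|by apply: s2; rewrite !inE eqxx orbT|].
  rewrite (_ : 1 / 4 + 1 / 8 = 1 / 2 - 1 / 8 :> R); last by field.
  apply: (cat _ (1 / 2 + 1 / 8)); [lra|lra|by apply: s3; rewrite !inE eqxx !orbT|].
  rewrite (_ : 1 / 2 + 1 / 8 = 3 / 4 - 1 / 8 :> R); last by field.
  apply: (cat _ (3 / 4 + 1 / 8)); [lra|lra|by apply: s4; rewrite !inE eqxx !orbT|].
  rewrite (_ : 3 / 4 + 1 / 8 = 1 - 1 / 8 :> R); last by field.
  rewrite (_ : 9 / 8 = 1 + 1 / 8 :> R); last by field.
  by apply: s5; rewrite !inE eqxx !orbT.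
apply: (@le_trans _ _ (\int[mu]_(x in `[(- (1 / 8))%R, (9 / 8)%R]) J x)%E).
  apply: ge0_subset_integral; [exact: measurable_itv|exact: measurable_itv|exact: measurable_funTS|..].
  - by move=> x _; exact: J0.
  - by move=> x /=; rewrite !in_itv /= => /andP[x0 x1]; apply/andP; split; lra.
apply: le_trans cat5 _; apply: lee_wpmul2l; first by rewrite lee_fin.
have mK' : measurable_fun setT (fun x => \int[mu]_y (K (Complex x y))%:E)%E.
  by apply: (measurable_tonelli (f := fun p => K (Complex p.1 p.2))).
apply: (@le_trans _ _ (\int[mu]_(x in `[(-1)%R, 1%R]) \int[mu]_y (K (Complex x y))%:E)%E).
  apply: ge0_le_integral; first exact: measurable_itv.
  - by move=> x _; apply: integral_ge0 => y _; rewrite lee_fin.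
  - apply: measurable_funTS.
    by apply: (measurable_tonelli (f := fun p => K (Complex p.1 p.2))).
  - exact: measurable_funTS.
  - move=> x _; apply: ge0_subset_integral; [exact: measurable_itv|exact: measurableT|..].
    + apply/measurable_EFinP; exact: (measurable_section x mK).
    + by move=> y _; rewrite lee_fin.
    + exact: subsetT.
apply: ge0_subset_integral; [exact: measurable_itv|exact: measurableT|exact: mK'|..].
  by move=> x _; apply: integral_ge0 => y _; rewrite lee_fin.
exact: subsetT.
Qed.

End Polar.

(** * Monotonicity of nonnegative integrals *)

Section IntegralMonotone.
Local Open Scope ereal_scope.

(** The integral of a nonnegative function is a supremum over the simple functions below it, which
    is monotone for arbitrary functions. This lets the cutoff of |g'| be compared with the integral
    in [W1] directly. *)
Lemma ge0_le_integral_nomeas d (T : measurableType d) (R : realType)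
    (mu : {measure set T -> \bar R}) (D : set T) (f1 f2 : T -> \bar R) :
  (forall x, D x -> 0 <= f1 x) -> (forall x, D x -> f1 x <= f2 x) ->
  \int[mu]_(x in D) f1 x <= \int[mu]_(x in D) f2 x.
Proof.
move=> f10 f12; rewrite 2!(integral_mkcond D).
have h x : f1 \_ D x <= f2 \_ D x.
  by rewrite !patchE; case: ifPn => // /set_mem; exact: f12.
have h0 x : 0 <= f1 \_ D x.
  by rewrite patchE; case: ifPn => // /set_mem; exact: f10.
rewrite !ge0_integralTE//; last by move=> x; exact: le_trans (h0 x) (h x).
apply: le_ereal_sup => _ [k kf <-]; exists k => // x.
exact: le_trans (kf x) (h x).
Qed.

End IntegralMonotone.

(** * Circular means of |g'| for g in W^1 *)

Section CircleMeans.
Context {R : realType}.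
Local Notation mu := (@lebesgue_measure R).

Lemma measurable_poly_plane (p : {poly R[i]}) :
  measurable_fun [set: R * R] (fun q : R * R => complex.Re p.[Complex q.1 q.2]) /\
  measurable_fun [set: R * R] (fun q : R * R => complex.Im p.[Complex q.1 q.2]).
Proof.
elim/poly_ind: p => [|p c [m1 m2]].
  by split; under eq_fun do rewrite horner0; exact: measurable_cst.
split.
- rewrite (_ : (fun q => _) = fun q : R * R => complex.Re p.[Complex q.1 q.2] * q.1 -
    complex.Im p.[Complex q.1 q.2] * q.2 + complex.Re c); last first.
    by apply/funext => q; rewrite hornerMXaddC cReD cReM.
  by apply: measurable_funD => //; apply: measurable_funB; exact: measurable_funM.
- rewrite (_ : (fun q => _) = fun q : R * R => complex.Re p.[Complex q.1 q.2] * q.2 +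
    complex.Im p.[Complex q.1 q.2] * q.1 + complex.Im c); last first.
    by apply/funext => q; rewrite hornerMXaddC cImD cImM.
  by apply: measurable_funD => //; apply: measurable_funD; exact: measurable_funM.
Qed.

Lemma measurable_cnorm_plane (f g : R * R -> R) : measurable_fun setT f -> measurable_fun setT g ->
  measurable_fun setT (fun q => cnorm (Complex (f q) (g q))).
Proof.
move=> mf mg; rewrite /cnorm /=; apply: (measurableT_comp (f := @Num.sqrt R)).
  by apply: continuous_measurable_fun; exact: sqrt_continuous.
by apply: measurable_funD; exact: measurable_funX.
Qed.

Variables (g g' : R[i] -> R[i]).
Hypothesis dg : deriv_on_disk g g'.

(* [polar_integral] needs a function that is continuous on the whole plane. *)
Lemma disk_cutoff (r : R) : 0 <= r -> r < 1 -> exists K : R[i] -> R,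
  [/\ forall z, 0 <= K z, measurable_fun [set: R * R] (fun p => K (Complex p.1 p.2)),
      forall F t, ccont F t -> {for t, continuous (fun t => K (F t))} &
      [/\ forall z, cnorm z <= r -> K z = cnorm (g' z),
      forall z, disk z -> K z <= cnorm (g' z) & forall z, ~ disk z -> K z = 0]].
Proof.
move=> r0 r1; pose s := (1 + r) / 2.
have rs : r < s by rewrite /s; lra.
have s1 : s < 1 by rewrite /s; lra.
have s0 : 0 <= s by exact: le_trans r0 (ltW rs).
have sr : 0 < s - r by rewrite subr_gt0.
(* A piecewise linear cutoff, equal to 1 up to [r] and to 0 from [s] on; as [s] is below 1, the
   product with |g'| extends continuously by 0. *)
pose chi v := Num.max 0 (Num.min 1 ((s - v) / (s - r))).
have chi0 v : 0 <= chi v by rewrite le_max lexx.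
have chi1 v : chi v <= 1 by rewrite ge_max ler01 ge_min lexx.
have chir v : v <= r -> chi v = 1.
  move=> vr; rewrite /chi (_ : Num.min _ _ = 1); first by apply/max_idPr.
  apply/min_idPl; rewrite ler_pdivlMr// mul1r; lra.
have chis v : s <= v -> chi v = 0.
  move=> sv; apply/max_idPl; rewrite ge_min pmulr_lle0 ?invr_gt0// subr_le0 sv.
  by rewrite orbT.
have cchi' v : {for v, continuous chi}.
  apply: continuous_max; first exact: cst_continuous.
  apply: continuous_min; first exact: cst_continuous.
  apply: continuousM; last exact: cst_continuous.
  by apply: continuousB; [exact: cst_continuous|exact: cvg_id].
have cchi : continuous chi by move=> v; exact: cchi'.
pose K z := chi (cnorm z) * cnorm (g' z).
exists K; split.
- by move=> z; rewrite mulr_ge0 ?cnorm_ge0.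
(* Measurability in the plane: [K] is a pointwise limit of cut-off moduli of polynomials. *)
- have H n : exists p : {poly R[i]}, forall z, cnorm z <= s -> cnorm (g' z - p.[z]) <= n.+1%:R^-1.
    have [|p Hp] := poly_approx (e := n.+1%:R^-1) dg s0 s1; first by rewrite invr_gt0.
    by exists p^`() => z /Hp[].
  have [p Hp] := choice H.
  apply: (measurable_fun_cvg (h := fun n q => chi (cnorm (Complex q.1 q.2)) * cnorm (p n).[Complex q.1 q.2])).
    move=> n; apply: measurable_funM.
      apply: (measurableT_comp (f := chi)); first exact: continuous_measurable_fun.
      exact: measurable_cnorm_plane.
    have [m1 m2] := measurable_poly_plane (p n).
    rewrite (_ : (fun q => _) = fun q : R * R => cnorm (Complex (complex.Re (p n).[Complex q.1 q.2]) (complex.Im (p n).[Complex q.1 q.2]))).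
      exact: measurable_cnorm_plane.
    by [].
  move=> q _; apply/cvgrPdist_le => e e0.
  near=> n; rewrite /K -mulrBr normrM ger0_norm//.
  have [zs|zs] := leP s (cnorm (Complex q.1 q.2)).
    by rewrite chis// mul0r ltW.
  apply: le_trans (_ : n.+1%:R^-1 <= _).
    rewrite -[leRHS]mul1r; apply: ler_pM => //.
    apply: le_trans (Hp n _ (ltW zs)); rewrite ler_norml; apply/andP; split.
      by rewrite lerNl opprB lerBlDl cdistC cnorm_le_sub.
    by rewrite lerBlDl cnorm_le_sub.
  apply: ltW; near: n; exact: (near_infty_natSinv_lt (PosNum e0)).
- move=> F t cF; have cnF := continuous_cnorm cF.
  have [F1|F1] := ltP (cnorm (F t)) 1.
    apply: continuousM.
      by apply: (@continuous_comp _ _ _ (fun t => cnorm (F t)) chi); [exact: cnF|exact: cchi].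
    by apply: continuous_cnorm; apply: ccont_comp => //; exact: deriv_continuous dg F1.
  apply/continuous_ballP => e e0.
  have [d d0 Hd] := (continuous_ballP _ _).1 cnF (1 - s) (ltac:(lra)).
  exists d => // x /Hd; rewrite ltr_norml => /andP[h _].
  rewrite /K chis; last by lra.
  by rewrite chis ?mul0r ?subrr ?normr0//; lra.
- split.
  + by move=> z zr; rewrite /K chir// mul1r.
  + by move=> z _; rewrite /K -[leRHS]mul1r ler_wpM2r ?cnorm_ge0.
  + move=> z /negP; rewrite /disk /= -leNgt => z1.
    by rewrite /K chis ?mul0r// (le_trans (ltW s1)).
Unshelve. all: by end_near. Qed.

(** The factor [t] is the polar Jacobian, so that integrating over [t] gives the area integral of
    |g'| up to a constant. *)
Definition circle_mean (t : R) : R := \int[mu]_(x in `[0, 1]) (cnorm (g' (t%:C * ucirc x)) * t).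

Lemma continuous_circle (t x : R) : 0 <= t -> t < 1 ->
  {for x, continuous (fun x => cnorm (g' (t%:C * ucirc x)))}.
Proof.
move=> t0 t1; apply: continuous_cnorm; apply: ccont_comp.
  by apply: deriv_continuous dg _; exact: disk_real_ucirc.
by apply: ccontM; [exact: ccont_cst|exact: ccont_ucirc].
Qed.

Lemma circle_mean_ge0 t : 0 <= t -> 0 <= circle_mean t.
Proof. by move=> t0; apply: Rintegral_ge0 => x _; rewrite mulr_ge0 ?cnorm_ge0. Qed.

Lemma circle_mean_integrable (r : R) : 0 <= r -> r < 1 ->
  mu.-integrable `[0, r]%classic (EFin \o circle_mean).
Proof.
move=> r0 r1; have [K [K0 mK cK [KE _ _]]] := disk_cutoff r0 r1.
have [M M0 HM] := deriv_bounded dg r1.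
have mpol := measurable_polar mK.
apply: measurable_bounded_integrable => //.
- exact: lebesgue_itv_cc_fin.
- have mJ : measurable_fun setT (fun t : R => fine (\int[mu]_(x in `[0%R, 1%R]) (K (t%:C * ucirc x) * `|t|)%:E)%E).
    apply: measurableT_comp => //.
    apply: (measurable_tonelli (f := fun p => K (p.1%:C * ucirc p.2) * `|p.1|)) => //.
      apply: (measurableT_comp (g := fun p : R * R => (p.2, p.1)) mpol).
      exact: measurable_fun_pair.
    by move=> p; rewrite mulr_ge0.
  apply: (eq_measurable_fun _ _ (measurable_funTS mJ)) => t /set_mem /=.
  rewrite in_itv /= => /andP[t0 tr]; rewrite /circle_mean /Rintegral; congr fine.
  apply: eq_integral => x _; rewrite ger0_norm// KE//.
  by rewrite cnorm_circle.
- exists M; split; first exact: num_real.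
  move=> x Mx t /=; rewrite in_itv /= => /andP[t0 tr].
  rewrite ger0_norm ?circle_mean_ge0//; apply: le_trans (ltW Mx).
  rewrite -[leRHS]mulr1 -[X in _ * X](subr0 1) -(lebesgue_itv_cc ler01) -Rintegral_cst//.
  apply: le_Rintegral => //.
  + apply: integrable_itv_cont => y _ _; apply: continuousM; last exact: cst_continuous.
    by apply: continuous_circle => //; exact: le_lt_trans tr r1.
  + by apply: integrable_itv_cont => y _ _; exact: cst_continuous.
  + move=> y _; rewrite -[leRHS]mulr1; apply: ler_pM; rewrite ?cnorm_ge0//.
      by have [] := HM (t%:C * ucirc y); rewrite ?cnorm_circle.
    exact: le_trans tr (ltW r1).
Qed.

Let W := (\int[(mu \x mu)%E]_(p in @diskR2 R) (cnorm (g' (Complex p.1 p.2)))%:E)%E.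
Hypothesis Wfin : (W < +oo)%E.

Lemma circle_mean_bound (r : R) : 0 <= r -> r < 1 ->
  \int[mu]_(t in `[0, r]) circle_mean t <= 5 * fine W.
Proof.
move=> r0 r1; have [K [K0 mK cK [KE Kle K_out]]] := disk_cutoff r0 r1.
have W0 : (0 <= W)%E by apply: integral_ge0 => p _; rewrite lee_fin cnorm_ge0.
have Wf : W \is a fin_num by rewrite ge0_fin_numE.
have bi := circle_mean_integrable r0 r1.
rewrite -lee_fin EFinM (fineK Wf) /Rintegral fineK; last exact: integrable_fin_num.
have mpol := measurable_polar mK.
have mpol' : measurable_fun [set: R * R] (fun p => K (p.1%:C * ucirc p.2) * `|p.1|).
  apply: (measurableT_comp (g := fun p : R * R => (p.2, p.1)) mpol).
  exact: measurable_fun_pair.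
have pol0 (p : R * R) : 0 <= K (p.1%:C * ucirc p.2) * `|p.1| by rewrite mulr_ge0.
apply: (@le_trans _ _ (\int[mu]_(t in `[0%R, 1%R]) \int[mu]_(x in `[0%R, 1%R])
    (K (t%:C * ucirc x) * `|t|)%:E)%E).
  apply: (@le_trans _ _ (\int[mu]_(t in `[0%R, r]) \int[mu]_(x in `[0%R, 1%R])
    (K (t%:C * ucirc x) * `|t|)%:E)%E).
    rewrite le_eqVlt; apply/orP; left; apply/eqP; apply: eq_integral => t /set_mem /=.
    rewrite in_itv /= => /andP[t0 tr]; rewrite /circle_mean /Rintegral fineK.
      by apply: eq_integral => x _; rewrite ger0_norm// KE// cnorm_circle.
    apply: integrable_fin_num => //.
    apply: (integrable_itv_cont (f := fun x => cnorm (g' (t%:C * ucirc x)) * t)) => y _ _.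
    apply: continuousM; last exact: cst_continuous.
    by apply: continuous_circle => //; exact: le_lt_trans tr r1.
  apply: ge0_subset_integral => //.
  - by apply: measurable_funTS; apply: (measurable_tonelli _ mpol').
  - by move=> t _; apply: integral_ge0 => x _; rewrite lee_fin (pol0 (t, x)).
  - by apply: subset_itvl; rewrite bnd_simp ltW.
apply: le_trans (polar_integral K0 mK cK) _.
apply: lee_wpmul2l; first by rewrite lee_fin.
rewrite -(@fubini_tonelli1 _ _ _ _ _ mu mu (fun p => (K (Complex p.1 p.2))%:E)); last 2 first.
- exact/measurable_EFinP.
- by move=> p; rewrite lee_fin.
(* Since [K] vanishes off the disk, the integral over the plane is one over [diskR2]. *)
rewrite (_ : (fun p => _) = (fun p => (K (Complex p.1 p.2))%:E) \_ (@diskR2 R)).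
  rewrite -integral_mkcond; apply: ge0_le_integral_nomeas.
    by move=> p _; rewrite lee_fin.
  move=> p dp; rewrite lee_fin Kle// /disk /= /cnorm /=.
  by rewrite -(@ltr_pXn2r _ 2)// ?nnegrE ?sqrtr_ge0// sqr_sqrtr ?addr_ge0 ?sqr_ge0// expr1n.
apply/funext => p; rewrite patchE; case: ifPn => // /negP np; congr (_%:E).
apply: K_out; rewrite /disk /= /cnorm /= => dp; apply: np; apply/mem_set; rewrite /diskR2 /=.
rewrite -(sqr_sqrtr (a := p.1 ^+ 2 + p.2 ^+ 2)) ?addr_ge0 ?sqr_ge0//.
by rewrite -(expr1n _ 2) ltr_pXn2r// ?nnegrE ?sqrtr_ge0.
Qed.

(** The integrals over [0, r] increase with [r] and are bounded by [circle_mean_bound], so past a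
    radius where they come within [e] of their supremum only [e] remains. The bound 1 / 2 is for
    [log_kernel_le]. *)
Lemma circle_mean_tail (e : R) : 0 < e -> exists2 s, 1 / 2 <= s < 1 &
  forall r, s <= r -> r < 1 -> \int[mu]_(t in `[s, r]) circle_mean t <= e.
Proof.
move=> e0; pose Th r := \int[mu]_(t in `[0, r]) circle_mean t.
pose S := [set Th r | r in [set r | 0 <= r < 1]].
have S0 : S (Th (1 / 2)) by exists (1 / 2) => //=; apply/andP; split; lra.
have hS : has_sup S.
  split; first by exists (Th (1 / 2)).
  by exists (5 * fine W) => _ [r /andP[r0 r1] <-]; exact: circle_mean_bound.
have [_ [r0 /andP[r00 r01] <-] Hr0] := sup_adherent e0 hS.
have split_int a b : 0 <= a -> a <= b -> b < 1 ->
    Th b = Th a + \int[mu]_(t in `[a, b]) circle_mean t.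
  move=> a0 ab b1; apply: Rintegral_itv_cat => //.
  by apply: circle_mean_integrable => //; exact: le_trans ab.
have int0 a b : 0 <= a -> 0 <= \int[mu]_(t in `[a, b]) circle_mean t.
  move=> a0; apply: Rintegral_ge0 => t /=; rewrite in_itv /= => /andP[at_ _].
  by apply: circle_mean_ge0; exact: le_trans at_.
exists (Num.max (1 / 2) r0).
  by rewrite le_max lexx /= gt_max r01 andbT; lra.
move=> r; rewrite ge_max => /andP[r2 rr] r1.
set s := Num.max _ _.
have s0 : 0 <= s by rewrite /s le_max r00 orbT.
have sr : s <= r by rewrite /s ge_max r2 rr.
have rs : r0 <= s by rewrite /s le_max lexx orbT.
have E1 := split_int _ _ s0 sr r1.
have E2 := split_int _ _ r00 rs (le_lt_trans sr r1).
have I2 := int0 r0 s r00.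
have hsup : Th r <= sup S.
  by apply: sup_upper_bound => //; exists r => //=; rewrite r1 andbT (le_trans s0).
rewrite -(lerD2l (Th s)) -E1; apply: le_trans hsup _.
by rewrite -lerBlDr; apply: le_trans (ltW Hr0) _; rewrite E2 lerDl.
Qed.

End CircleMeans.

(** * Parseval's identity and the logarithmic weight *)

Section Pairing.
Context {R : realType}.
Local Notation mu := (@lebesgue_measure R).

Lemma conjcX (z : R[i]) n : conjc (z ^+ n) = conjc z ^+ n.
Proof. exact: (rmorphXn (@conjc R)). Qed.

Lemma conjcM (z w : R[i]) : conjc (z * w) = conjc z * conjc w.
Proof. exact: (rmorphM (@conjc R)). Qed.

Lemma conjc_sum n (F : 'I_n -> R[i]) : conjc (\sum_(k < n) F k) = \sum_(k < n) conjc (F k).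
Proof. exact: (rmorph_sum (@conjc R)). Qed.

Lemma cintab_monomials (i j : nat) :
  cintab 0 1 (fun x : R => ucirc x ^+ i * conjc (ucirc x ^+ j)) = (i == j)%:R.
Proof.
rewrite (eq_cintab (G := fun x => ucirc ((i%:Z - j%:Z)%:~R * x))); last first.
  move=> x _ _; rewrite conjcX -ucircN -!ucircMn -ucircD; congr ucirc.
  by rewrite intrB mulrBl mulrN.
case: eqVneq => [->|ij].
  rewrite subrr (eq_cintab (G := fun=> 1)).
    by rewrite cintab_cst// subr0 mulr1.
  by move=> x _ _; rewrite mul0r ucirc0.
have := @cintab_ucirc_int R 0 (i%:Z - j%:Z); rewrite add0r => -> //.
by rewrite subr_eq0 eqz_nat.
Qed.

Lemma ccont_poly_circle (p : {poly R[i]}) (t x : R) : ccont (fun x => p.[t%:C * ucirc x]) x.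
Proof.
apply: ccont_comp_cderiv (has_cderiv_poly _ _) _.
by apply: ccontM; [exact: ccont_cst|exact: ccont_ucirc].
Qed.

Lemma parseval_poly (p q : {poly R[i]}) n (t : R) : (size p <= n)%N -> (size q <= n)%N ->
  cintab 0 1 (fun x => p.[t%:C * ucirc x] * conjc q.[t%:C * ucirc x]) =
  \sum_(k < n) p`_k * conjc q`_k * (t ^+ k.*2)%:C.
Proof.
move=> pn qn.
have cU (k : nat) (x : R) : ccont (fun x => ucirc x ^+ k) x by apply: ccontX; exact: ccont_ucirc.
rewrite (eq_cintab (G := fun x => \sum_(k < n) p`_k * (t ^+ k)%:C *
    (ucirc x ^+ k * conjc q.[t%:C * ucirc x]))); last first.
  move=> x _ _; rewrite (horner_coef_wide _ pn) mulr_suml; apply: eq_bigr => k _.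
  by rewrite exprMn rmorphXn /=; ring.
rewrite (@cintab_sum R 0 1 n (fun k x => p`_k * (t ^+ k)%:C * (ucirc x ^+ k * conjc q.[t%:C * ucirc x])) ler01); last first.
  move=> k x _ _; apply: ccontM; first exact: ccont_cst.
  by apply: ccontM; [exact: cU|apply: ccontJ; exact: ccont_poly_circle].
apply: eq_bigr => k _.
rewrite cintabZ; last first.
  move=> x _ _; apply: ccontM; first exact: cU.
  by apply: ccontJ; exact: ccont_poly_circle.
rewrite (eq_cintab (G := fun x => \sum_(l < n) conjc q`_l * (t ^+ l)%:C *
    (ucirc x ^+ k * conjc (ucirc x ^+ l)))); last first.
  move=> x _ _; rewrite (horner_coef_wide _ qn) conjc_sum mulr_sumr; apply: eq_bigr => l _.
  have -> : (t ^+ l)%:C = t%:C ^+ l by rewrite rmorphXn.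
  by rewrite exprMn !conjcM [conjc (t%:C ^+ l)]conjcX conjc_real; ring.
rewrite (@cintab_sum R 0 1 n (fun l x => conjc q`_l * (t ^+ l)%:C * (ucirc x ^+ k * conjc (ucirc x ^+ l))) ler01); last first.
  move=> l x _ _; apply: ccontM; first exact: ccont_cst.
  by apply: ccontM; [exact: cU|apply: ccontJ; exact: cU].
rewrite (bigD1 k)//= big1 ?addr0 => [|l lk]; last first.
  rewrite cintabZ ?cintab_monomials; last first.
    by move=> x _ _; apply: ccontM; [exact: cU|apply: ccontJ; exact: cU].
  by rewrite eq_sym -val_eqE in lk; rewrite (negbTE lk) mulr0.
rewrite cintabZ ?cintab_monomials ?eqxx ?mulr1; last first.
  by move=> x _ _; apply: ccontM; [exact: cU|apply: ccontJ; exact: cU].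
by rewrite -addnn exprD rmorphM /=; ring.
Qed.

(** The Green function with pole 0 of the disk of radius [r], minus that of the disk of radius [s]:
    it yields the difference of the pairings on the two circles, and the singularities at 0
    cancel. *)
Definition log_kernel (s r t : R) := ln r - ln (Num.max s t).

Lemma log_kernel_continuous (s r t : R) : 0 < s -> {for t, continuous (log_kernel s r)}.
Proof.
move=> s0; apply: continuousB; first exact: cst_continuous.
apply: (@continuous_comp _ _ _ (fun t => Num.max s t) (@ln R)).
  by apply: continuous_max; [exact: cst_continuous|exact: cvg_id].
by apply: continuous_ln; rewrite lt_max s0.
Qed.

Lemma continuous_powc (n : nat) (c t : R) : {for t, continuous (fun t : R => c * t ^+ n)}.
Proof. by apply: continuousM; [exact: cst_continuous|exact: exprn_continuous]. Qed.

Lemma is_derive_expr (n : nat) (t : R) : is_derive t 1 (fun t : R => t ^+ n.+1) (n.+1%:R * t ^+ n).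
Proof.
have := is_derive_poly 'X^(n.+1) t.
rewrite derivXn hornerMn hornerXn -mulr_natl (_ : horner 'X^(n.+1) = fun t => t ^+ n.+1)//.
by apply/funext => y; rewrite hornerXn.
Qed.

(* The logarithm arises because (t d/dt)^2 maps t^(2k) to 4 k^2 t^(2k). *)
Lemma log_kernel_monomial (m : nat) (s r : R) : 0 < s -> s <= r ->
  \int[mu]_(t in `[0, r]) (4 * m.+1%:R ^+ 2 * t ^+ m.*2.+1 * log_kernel s r t) =
  r ^+ m.+1.*2 - s ^+ m.+1.*2.
Proof.
move=> s0 sr; have s0' := ltW s0.
have ck (t : R) : {for t, continuous (fun t : R => 4 * m.+1%:R ^+ 2 * t ^+ m.*2.+1 * log_kernel s r t)}.
  by apply: continuousM; [exact: continuous_powc|exact: log_kernel_continuous].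
rewrite (Rintegral_itv_cat s0' sr); last by apply: integrable_itv_cont => t _ _; exact: ck.
have n2 : m.+1.*2%:R = 2 * m.+1%:R :> R by rewrite -mul2n natrM.
have n1 : m.+1.*2 = m.*2.+2 by rewrite doubleS.
have -> : \int[mu]_(t in `[0, s]) (4 * m.+1%:R ^+ 2 * t ^+ m.*2.+1 * log_kernel s r t) =
    2 * m.+1%:R * s ^+ m.+1.*2 * (ln r - ln s).
  transitivity (\int[mu]_(t in `[0, s]) (4 * m.+1%:R ^+ 2 * (ln r - ln s) * t ^+ m.*2.+1)).
    apply: eq_Rintegral => t /set_mem /=; rewrite in_itv /= => /andP[t0 ts].
    by rewrite /log_kernel (max_idPl ts); ring.
  pose F (t : R) := 2 * m.+1%:R * (ln r - ln s) * t ^+ m.+1.*2.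
  transitivity (F s - F 0); last by rewrite /F expr0n /= mulr0 subr0; ring.
  pose f (t : R) := 4 * m.+1%:R ^+ 2 * (ln r - ln s) * t ^+ m.*2.+1.
  apply: (FTC_real (f := f) (F := F) s0') => t _ _; last first.
    exact: (@continuous_powc m.*2.+1 (4 * m.+1%:R ^+ 2 * (ln r - ln s)) t).
  have H1 := is_derive_expr m.*2.+1 t; rewrite -n1 n2 in H1.
  apply: is_derive_eq (is_deriveZ (2 * m.+1%:R * (ln r - ln s)) H1) _.
  by rewrite /GRing.scale /= /f; ring.
have -> : \int[mu]_(t in `[s, r]) (4 * m.+1%:R ^+ 2 * t ^+ m.*2.+1 * log_kernel s r t) =
    r ^+ m.+1.*2 - (2 * m.+1%:R * s ^+ m.+1.*2 * (ln r - ln s) + s ^+ m.+1.*2).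
  transitivity (\int[mu]_(t in `[s, r]) (4 * m.+1%:R ^+ 2 * t ^+ m.*2.+1 * (ln r - ln t))).
    apply: eq_Rintegral => t /set_mem /=; rewrite in_itv /= => /andP[st tr].
    by rewrite /log_kernel (max_idPr st).
  (* This antiderivative comes from one integration by parts against the logarithm. *)
  pose F (t : R) := 2 * m.+1%:R * t ^+ m.+1.*2 * (ln r - ln t) + t ^+ m.+1.*2.
  transitivity (F r - F s); last by rewrite /F subrr mulr0 add0r.
  pose f (t : R) := 4 * m.+1%:R ^+ 2 * t ^+ m.*2.+1 * (ln r - ln t).
  apply: (FTC_real (f := f) (F := F) sr) => t st tr; have t0 : 0 < t by exact: lt_le_trans st.
  - have H1 := is_derive_expr m.*2.+1 t; rewrite -n1 n2 in H1.
    have H2 := is_derive1_ln t0.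
    have H3 := is_deriveB (is_derive_cst (ln r) t 1) H2.
    have H4 := is_deriveM (is_deriveZ (2 * m.+1%:R) H1) H3.
    have H5 := is_deriveD H4 H1.
    apply: is_derive_eq H5 _.
    change (2 * m.+1%:R * t ^+ m.+1.*2 * (0 - t^-1) + (ln r - ln t) * (2 * m.+1%:R * (2 * m.+1%:R * t ^+ m.*2.+1)) +
      2 * m.+1%:R * t ^+ m.*2.+1 = 4 * m.+1%:R ^+ 2 * t ^+ m.*2.+1 * (ln r - ln t)).
    have -> : 2 * m.+1%:R * t ^+ m.+1.*2 * (0 - t^-1) = - (2 * m.+1%:R * t ^+ m.*2.+1).
      rewrite n1 (exprS t m.*2.+1) sub0r mulrN; congr (- _).
      by rewrite -[LHS]mulrA (mulrAC t) divff ?mul1r// gt_eqF.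
    by ring.
  - apply: continuousM; first exact: continuous_powc.
    by apply: continuousB; [exact: cst_continuous|exact: continuous_ln].
ring.
Qed.

End Pairing.

(** * Green's formula and bounds for the pairing *)

Section PairingEstimate.
Context {R : realType}.
Local Notation mu := (@lebesgue_measure R).

Lemma cintab_real (a b : R) (f : R -> R) :
  cintab a b (fun t => (f t)%:C) = (\int[mu]_(t in `[a, b]) f t)%:C.
Proof.
apply/eqP; rewrite eq_complex /= eqxx /=; apply/eqP.
by rewrite Rintegral_cst// mul0r.
Qed.

Lemma conjc_mulrn (z : R[i]) n : conjc (z *+ n) = conjc z *+ n.
Proof. exact: (raddfMn (@conjc R)). Qed.

Definition circle_pairing (p q : {poly R[i]}) (t : R) : R[i] :=
  cintab 0 1 (fun x => p.[t%:C * ucirc x] * conjc q.[t%:C * ucirc x]).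

Lemma ccont_log_weight (s r t : R) : 0 < s ->
  ccont (fun t => (4 * t * log_kernel s r t)%:C) t.
Proof.
move=> s0; apply: (ccont_real (f := fun t => 4 * t * log_kernel s r t)).
apply: continuousM; last exact: log_kernel_continuous.
by apply: continuousM; [exact: cst_continuous|exact: cvg_id].
Qed.

Lemma circle_pairing_sum (p q : {poly R[i]}) n : (size p <= n)%N -> (size q <= n)%N ->
  circle_pairing p q = fun t => \sum_(k < n) p`_k * conjc q`_k * (t ^+ k.*2)%:C.
Proof. by move=> pn qn; apply/funext => t; exact: parseval_poly. Qed.

Lemma ccont_circle_pairing (p q : {poly R[i]}) (t : R) : ccont (circle_pairing p q) t.
Proof.
rewrite (circle_pairing_sum (leq_maxl (size p) (size q)) (leq_maxr _ _)).
apply: (ccont_sum (F_ := fun k t => p`_k * conjc q`_k * (t ^+ k.*2)%:C)) => k.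
apply: ccontM; first exact: ccont_cst.
by apply: (ccont_real (f := fun t => t ^+ k.*2)); exact: exprn_continuous.
Qed.

(* Green's formula on the disk of radius r, with the logarithm frozen inside radius s. *)
Lemma circle_pairing_increment (p q : {poly R[i]}) (s r : R) : 0 < s -> s <= r ->
  circle_pairing p q r - circle_pairing p q s =
  cintab 0 r (fun t => (4 * t * log_kernel s r t)%:C * circle_pairing p^`() q^`() t).
Proof.
move=> s0 sr; have r0 : 0 <= r by exact: le_trans (ltW s0) sr.
pose n := maxn (size p) (size q).
have pn : (size p <= n.+1)%N by rewrite (leq_trans (leq_maxl _ (size q))).
have qn : (size q <= n.+1)%N by rewrite (leq_trans (leq_maxr (size p) _)).
have p'n : (size p^`() <= n)%N.
  exact: leq_trans (size_poly _ _) (leq_trans (leq_pred _) (leq_maxl _ _)).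
have q'n : (size q^`() <= n)%N.
  exact: leq_trans (size_poly _ _) (leq_trans (leq_pred _) (leq_maxr _ _)).
rewrite (circle_pairing_sum pn qn) (circle_pairing_sum p'n q'n).
(* The constant terms cancel in the difference. For k >= 1 the derivatives supply the factor k^2
   that [log_kernel_monomial] expects. *)
rewrite !big_ord_recl /= !expr0 opprD addrACA subrr add0r.
pose c k := p`_k.+1 * conjc q`_k.+1.
rewrite (eq_cintab (G := fun t => \sum_(k < n) c k *
   (4 * k.+1%:R ^+ 2 * t ^+ k.*2.+1 * log_kernel s r t)%:C)); last first.
  move=> t _ _; rewrite mulr_sumr; apply: eq_bigr => k _; rewrite !coef_deriv /c.
  rewrite conjc_mulrn -[p`_k.+1 *+ _]mulr_natr -[conjc _ *+ _]mulr_natr.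
  have -> : 4 * k.+1%:R ^+ 2 * t ^+ k.*2.+1 * log_kernel s r t =
      4 * t * log_kernel s r t * k.+1%:R * k.+1%:R * t ^+ k.*2 by rewrite (exprS t); ring.
  have -> : (k.+1%:R : R[i]) = (k.+1%:R : R)%:C by rewrite rmorph_nat.
  move: (4 * t * log_kernel s r t) (t ^+ k.*2) (k.+1%:R : R) => x y w.
  by rewrite !rmorphM /=; ring.
rewrite (@cintab_sum R 0 r n (fun k t => c k * (4 * k.+1%:R ^+ 2 * t ^+ k.*2.+1 * log_kernel s r t)%:C) r0); last first.
  move=> k t _ _; apply: ccontM; first exact: ccont_cst.
  apply: (ccont_real (f := fun t => 4 * k.+1%:R ^+ 2 * t ^+ k.*2.+1 * log_kernel s r t)).
  apply: continuousM; last exact: log_kernel_continuous.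
  exact: (@continuous_powc _ k.*2.+1 (4 * k.+1%:R ^+ 2)).
rewrite -sumrB; apply: eq_bigr => k _.
rewrite cintabZ; last first.
  move=> t _ _; apply: (ccont_real (f := fun t => 4 * k.+1%:R ^+ 2 * t ^+ k.*2.+1 * log_kernel s r t)).
  apply: continuousM; last exact: log_kernel_continuous.
  exact: (@continuous_powc _ k.*2.+1 (4 * k.+1%:R ^+ 2)).
by rewrite cintab_real log_kernel_monomial// rmorphB /= mulrBr.
Qed.

Lemma ln_sub_le (r v : R) : 0 < v -> 0 < r -> ln r - ln v <= (r - v) / v.
Proof.
move=> v0 r0; rewrite -ln_div ?posrE//.
rewrite (_ : r / v = 1 + (r - v) / v); last by field; rewrite gt_eqF.
apply: le_ln1Dx; rewrite ltr_pdivlMr//; lra.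
Qed.

Lemma log_kernel_ge0 (s r t : R) : 0 < s -> s <= r -> t <= r -> 0 <= log_kernel s r t.
Proof.
move=> s0 sr tr; rewrite subr_ge0 ler_ln ?posrE ?ge_max ?sr// ?lt_max ?s0//.
exact: lt_le_trans sr.
Qed.

(** The first bound serves on the inner disk, where it is small when [s] is near 1; the second
    serves near the circle, where it cancels the growth 1 / (1 - t) of a Bloch derivative. The
    factor 2 is the price of dividing by a number that is at least 1 / 2. *)
Lemma log_kernel_le (s r t : R) : 1 / 2 <= s -> s <= r -> r < 1 -> t <= r ->
  log_kernel s r t <= 2 * (1 - s) /\ log_kernel s r t <= 2 * (1 - t).
Proof.
move=> s2 sr r1 tr; rewrite /log_kernel.
have : Num.max s t <= r by rewrite ge_max sr.
have : t <= Num.max s t by rewrite le_max lexx orbT.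
have : s <= Num.max s t by rewrite le_max lexx.
move: (Num.max s t) => v sv tv vr.
have H : ln r - ln v <= 2 * (1 - v).
  apply: le_trans (ln_sub_le _ _) _; [lra|lra|].
  rewrite ler_pdivrMr; last by lra.
  have : (1 - v) * (1 / 2) <= (1 - v) * v by apply: ler_wpM2l; lra.
  lra.
by split; lra.
Qed.

Variables (g g' : R[i] -> R[i]).
Hypothesis dg : deriv_on_disk g g'.

(** Here [p] and [q] stand for derivatives: [p] has Bloch growth, and [tau] is the error made in
    replacing [g'] by [q]. The factor [t] on the left is the Jacobian in [circle_mean]. *)
Lemma circle_pairing_deriv_bound (p q : {poly R[i]}) (r t N tau : R) :
  0 <= tau -> r < 1 -> 0 <= t -> t <= r ->
  (forall z, cnorm z <= r -> (1 - cnorm z) * cnorm p.[z] <= N) ->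
  (forall z, cnorm z <= r -> cnorm q.[z] <= cnorm (g' z) + tau) ->
  t * cnorm (circle_pairing p q t) <= N / (1 - t) * (circle_mean g' t + tau).
Proof.
move=> tau0 r1 t0 tr HN Hq; have t1 : t < 1 by exact: le_lt_trans r1.
have t1' : 0 < 1 - t by rewrite subr_gt0.
have cp x : ccont (fun x => p.[t%:C * ucirc x]) x by exact: ccont_poly_circle.
have cq x : ccont (fun x => conjc q.[t%:C * ucirc x]) x by apply: ccontJ; exact: ccont_poly_circle.
have zt x : cnorm (t%:C * ucirc x) = t by rewrite cnorm_circle.
have N0 : 0 <= N.
  apply: le_trans (HN (t%:C * ucirc 0) _); rewrite zt//.
  by rewrite mulr_ge0 ?cnorm_ge0// ltW.
have ig : mu.-integrable `[0, 1]%classic (EFin \o (fun x => cnorm (g' (t%:C * ucirc x)) * t)).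
  apply: integrable_itv_cont => x _ _; apply: continuousM; last exact: cst_continuous.
  exact: (continuous_circle dg).
have ipq : mu.-integrable `[0, 1]%classic (EFin \o (fun x => cnorm (p.[t%:C * ucirc x] * conjc q.[t%:C * ucirc x]))).
  by apply: integrable_itv_cont => x _ _; apply: continuous_cnorm; exact: ccontM.
apply: (@le_trans _ _ (t * \int[mu]_(x in `[0, 1]) cnorm (p.[t%:C * ucirc x] * conjc q.[t%:C * ucirc x]))).
  apply: ler_wpM2l => //; apply: cnorm_cint => //; apply: cintegrable_contab => x _ _.
  exact: ccontM.
rewrite -RintegralZl//.
have itau : mu.-integrable `[0, 1]%classic (EFin \o (fun _ : R => tau)).
  by apply: integrable_itv_cont => x _ _; exact: cst_continuous.
have -> : N / (1 - t) * (circle_mean g' t + tau) =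
    \int[mu]_(x in `[0, 1]) (N / (1 - t) * (cnorm (g' (t%:C * ucirc x)) * t + tau)).
  rewrite RintegralZl//; last exact: integrableD_EFin.
  rewrite RintegralD// Rintegral_cst//.
  by rewrite (lebesgue_itv_cc ler01) subr0 mulr1.
apply: le_Rintegral => //.
- exact: integrableZ_EFin.
- by apply: integrableZ_EFin => //; exact: integrableD_EFin.
move=> x _; rewrite cnormM cnormJ.
have h1 : cnorm p.[t%:C * ucirc x] <= N / (1 - t).
  by rewrite ler_pdivlMr// mulrC; have := HN (t%:C * ucirc x); rewrite zt; apply.
have h2 : cnorm q.[t%:C * ucirc x] <= cnorm (g' (t%:C * ucirc x)) + tau.
  by apply: Hq; rewrite zt.
have -> : t * (cnorm p.[t%:C * ucirc x] * cnorm q.[t%:C * ucirc x]) =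
   cnorm p.[t%:C * ucirc x] * (cnorm q.[t%:C * ucirc x] * t) by ring.
apply: ler_pM => //; rewrite ?mulr_ge0 ?cnorm_ge0//.
have : cnorm q.[t%:C * ucirc x] * t <= (cnorm (g' (t%:C * ucirc x)) + tau) * t.
  by rewrite ler_wpM2r.
have : tau * t <= tau * 1 by rewrite ler_wpM2l// ltW.
rewrite mulrDl; lra.
Qed.

(** Split Green's formula at radius [s0]. Inside, the weight over 1 - t is at most a multiple of (1
    - s) / (1 - s0); outside it is bounded, but the mass [e] of |g'| is small. The constant 8 is the
    4 of Green's formula times the 2 of [log_kernel_le]. *)
Lemma circle_pairing_bound (p q : {poly R[i]}) (s0 s r N tau T e : R) :
  0 <= tau -> 1 / 2 <= s0 -> s0 <= s -> s <= r -> r < 1 -> 0 <= N ->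
  (forall z, cnorm z <= r -> (1 - cnorm z) * cnorm p^`().[z] <= N) ->
  (forall z, cnorm z <= r -> cnorm q^`().[z] <= cnorm (g' z) + tau) ->
  \int[mu]_(t in `[0, s0]) circle_mean g' t <= T ->
  \int[mu]_(t in `[s0, r]) circle_mean g' t <= e ->
  cnorm (circle_pairing p q r - circle_pairing p q s) <=
  8 * N * ((1 - s) / (1 - s0) * (T + tau) + (e + tau)).
Proof.
move=> tau0 s02 s0s sr r1 N0 HN Hq HT He.
have s0p : 0 < s0 by lra.
have sp : 0 < s by lra.
have s01 : 0 < 1 - s0 by lra.
have s1 : 0 <= 1 - s by lra.
have s0r : s0 <= r by exact: le_trans sr.
have rp : 0 <= r by lra.
rewrite circle_pairing_increment//.
pose G t := (4 * t * log_kernel s r t)%:C * circle_pairing p^`() q^`() t.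
have cG t : ccont G t by apply: ccontM; [exact: ccont_log_weight|exact: ccont_circle_pairing].
rewrite -/G (cintab_cat (ltW s0p) s0r) => [|t _ _]; last exact: cG.
apply: le_trans (cnormD _ _) _; rewrite mulrDr.
have bi a b : 0 <= a -> a <= b -> b <= r -> mu.-integrable `[a, b]%classic (EFin \o circle_mean g').
  move=> a0 ab br; apply: (integrableS _ _ _ (circle_mean_integrable dg rp r1)) => //.
  by move=> x /=; rewrite !in_itv /= => /andP[ax xb]; rewrite (le_trans a0 ax) (le_trans xb br).
have bnd a b k B : 0 <= a -> a <= b -> b <= r -> b - a <= 1 -> 0 <= k ->
    \int[mu]_(t in `[a, b]) circle_mean g' t <= B ->
    (forall t, a <= t -> t <= b -> 4 * log_kernel s r t / (1 - t) <= k) ->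
    cnorm (cintab a b G) <= k * N * (B + tau).
  move=> a0 ab br ba1 k0 HB Hk.
  have itau : mu.-integrable `[a, b]%classic (EFin \o (fun _ : R => tau)).
    by apply: integrable_itv_cont => x _ _; exact: cst_continuous.
  have cbi : cintegrable mu `[a, b]%classic G by apply: cintegrable_contab => t _ _.
  have bi' := bi _ _ a0 ab br.
  apply: le_trans (cnorm_cint _ cbi) _ => //.
  apply: (@le_trans _ _ (\int[mu]_(t in `[a, b]) (k * N * (circle_mean g' t + tau)))).
    apply: le_Rintegral => //.
    - exact: integrable_cnorm.
    - by apply: integrableZ_EFin => //; exact: integrableD_EFin.
    move=> t /=; rewrite in_itv /= => /andP[at_ tb].
    have t0 : 0 <= t by exact: le_trans at_.
    have tr : t <= r by exact: le_trans br.
    have t1 : 0 < 1 - t by lra.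
    have k1 := log_kernel_ge0 sp sr tr.
    rewrite cnormM cnorm_real ger0_norm; last by rewrite !mulr_ge0.
    have -> : 4 * t * log_kernel s r t * cnorm (circle_pairing p^`() q^`() t) =
        4 * log_kernel s r t * (t * cnorm (circle_pairing p^`() q^`() t)) by ring.
    have H := circle_pairing_deriv_bound tau0 r1 t0 tr HN Hq.
    apply: (@le_trans _ _ (4 * log_kernel s r t * (N / (1 - t) * (circle_mean g' t + tau)))).
      by rewrite ler_wpM2l// mulr_ge0.
    have -> : 4 * log_kernel s r t * (N / (1 - t) * (circle_mean g' t + tau)) =
       4 * log_kernel s r t / (1 - t) * (N * (circle_mean g' t + tau)) by ring.
    rewrite -(mulrA k) ler_wpM2r ?Hk// mulr_ge0// addr_ge0//.
    exact: circle_mean_ge0.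
  rewrite RintegralZl//; last exact: integrableD_EFin.
  rewrite ler_wpM2l ?mulr_ge0// RintegralD// Rintegral_cst// lebesgue_itv_cc//.
  rewrite lerD// -[leRHS]mulr1 ler_wpM2l//.
apply: lerD.
- have -> : 8 * N * ((1 - s) / (1 - s0) * (T + tau)) = 8 * ((1 - s) / (1 - s0)) * N * (T + tau) by ring.
  apply: bnd => //; [lra|lra| |].
    by rewrite mulr_ge0// divr_ge0// ltW.
  move=> t t0 ts; have tr : t <= r by exact: le_trans s0r.
  have [k1 _] := log_kernel_le (le_trans s02 s0s) sr r1 tr.
  rewrite mulrA; apply: ler_pM.
  + by rewrite mulr_ge0// log_kernel_ge0.
  + by rewrite invr_ge0; lra.
  + lra.
  + by rewrite lef_pV2 ?posrE//; lra.
- apply: bnd => //; [lra|lra|].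
  move=> t t0 tr; have [_ k1] := log_kernel_le (le_trans s02 s0s) sr r1 tr.
  by rewrite ler_pdivrMr; lra.
Qed.

End PairingEstimate.

(** * Smallness of the pairing with a fixed element of W^1 *)

Section PairingSmall.
Context {R : realType}.
Local Notation mu := (@lebesgue_measure R).

Lemma pair_integrandE (h g : R[i] -> R[i]) (r t : R) :
  pair_integrand h g r t = h (r%:C * ucirc t) * conjc (g (r%:C * ucirc t)).
Proof. by []. Qed.

Lemma ccont_pair_integrand (h h' g g' : R[i] -> R[i]) (r t : R) :
  deriv_on_disk h h' -> deriv_on_disk g g' -> 0 <= r -> r < 1 ->
  ccont (pair_integrand h g r) t.
Proof.
move=> dh dg r0 r1.
apply: (@ccontM _ (fun t => h (r%:C * ucirc t)) (fun t => conjc (g (r%:C * ucirc t)))).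
  exact: ccont_circle dh r0 r1.
by apply: ccontJ; exact: ccont_circle dg r0 r1.
Qed.

Lemma W1_integral_fin (g g' : R[i] -> R[i]) :
  ((cnorm (g 0))%:E + (pi^-1)%:E *
     \int[(mu \x mu)%E]_(p in @diskR2 R) (cnorm (g' (Complex p.1 p.2)))%:E < +oo)%E ->
  (\int[(mu \x mu)%E]_(p in @diskR2 R) (cnorm (g' (Complex p.1 p.2)))%:E < +oo)%E.
Proof.
set I := (\int[_]_(p in _) _)%E.
have : (0 <= I)%E by apply: integral_ge0 => p _; rewrite lee_fin cnorm_ge0.
case: I => [x _ _| _|//]; first exact: ltry.
by rewrite gt0_muley ?lte_fin ?invr_gt0 ?pi_gt0// addey// ltxx.
Qed.

Lemma pair_sub_poly (h h' g g' : R[i] -> R[i]) (p q : {poly R[i]}) (r t tau B : R) :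
  deriv_on_disk h h' -> deriv_on_disk g g' -> 0 <= t -> t <= r -> r < 1 ->
  0 <= tau -> tau <= 1 ->
  (forall z, cnorm z <= r -> cnorm (h z) <= B /\ cnorm (g z) <= B) ->
  (forall z, cnorm z <= r -> cnorm (h z - p.[z]) <= tau) ->
  (forall z, cnorm z <= r -> cnorm (g z - q.[z]) <= tau) ->
  cnorm (cintab 0 1 (pair_integrand h g t) - circle_pairing p q t) <= tau * (2 * B + 1).
Proof.
move=> dh dg t0 tr r1 tau0 tau1 HB Hp Hq; have t1 : t < 1 by exact: le_lt_trans r1.
have cp x : ccont (fun x => p.[t%:C * ucirc x]) x by exact: ccont_poly_circle.
have cq x : ccont (fun x => conjc q.[t%:C * ucirc x]) x by apply: ccontJ; exact: ccont_poly_circle.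
have ch x := ccont_pair_integrand x dh dg t0 t1.
rewrite -cintabB; last 2 first.
- by move=> x _ _; exact: ch.
- by move=> x _ _; exact: ccontM.
rewrite -[leRHS]mulr1 -[X in _ * X](subr0 1); apply: (cnorm_cintab ler01).
  by move=> x _ _; apply: ccontB; [exact: ch|exact: ccontM].
move=> x _ _; rewrite pair_integrandE; set z := t%:C * ucirc x.
have zr : cnorm z <= r by rewrite /z cnorm_circle.
have [hB gB] := HB _ zr; have h1 := Hp _ zr; have h2 := Hq _ zr.
rewrite (_ : _ - _ = (h z - p.[z]) * conjc (g z) + p.[z] * conjc (g z - q.[z])); last first.
  by rewrite [conjc (g z - q.[z])](raddfB (@conjc R)) /=; ring.
apply: le_trans (cnormD _ _) _; rewrite !cnormM !cnormJ.
have pB : cnorm p.[z] <= B + 1.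
  have := cnorm_le_sub p.[z] (h z); rewrite cdistC; lra.
have e1 : cnorm (h z - p.[z]) * cnorm (g z) <= tau * B by apply: ler_pM; rewrite ?cnorm_ge0.
have e2 : cnorm p.[z] * cnorm (g z - q.[z]) <= (B + 1) * tau by apply: ler_pM; rewrite ?cnorm_ge0.
lra.
Qed.

(** The radius [s] and the tolerance [eta] depend on [g], [M], [eps] only. The pairing on the circle
    of radius [s] is small because [h] is, and its increment up to [r] is small by
    [circle_pairing_bound]. The polynomials replacing [h] and [g] come last, as their accuracy [tau]
    may depend on [h] and [r]. *)
Lemma pairing_small (g : R[i] -> R[i]) (M eps : R) : W1 g -> 0 <= M -> 0 < eps ->
  exists s eta : R, [/\ 0 <= s, s < 1, 0 < eta &
    forall h h', deriv_on_disk h h' ->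
      (forall z, disk z -> (1 - cnorm z) * cnorm (h' z) <= M) ->
      (forall z, cnorm z <= s -> cnorm (h z) <= eta) ->
      forall r, s <= r -> r < 1 -> cnorm (cintab 0 1 (pair_integrand h g r)) <= eps].
Proof.
move=> [g' [dg /W1_integral_fin Wfin]] M0 eps0.
have W0 : 0 <= fine (\int[(mu \x mu)%E]_(p in @diskR2 R) (cnorm (g' (Complex p.1 p.2)))%:E)%E.
  by apply: fine_ge0; apply: integral_ge0 => p _; rewrite lee_fin cnorm_ge0.
have Hbound := circle_mean_bound dg Wfin.
have Htail := circle_mean_tail dg Wfin.
move: W0 Hbound Htail; move: (fine _) => w w0 Hbound Htail.
pose T := 5 * w; have T0 : 0 <= T by rewrite mulr_ge0.
have M1 : 0 < M + 1 by lra.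
(* The tail then costs 8 (M + 1) [e1], an eighth of [eps]; M + 1 instead of M allows for the error
   in replacing [h'] by a polynomial. *)
pose e1 := eps / (64 * (M + 1)).
have e10 : 0 < e1 by rewrite divr_gt0// mulr_gt0.
have [s0 /andP[s02 s01] Hs0] := Htail _ e10.
have s0' : 0 < 1 - s0 by lra.
pose D := 8 * (M + 1) * T / (1 - s0).
have D0 : 0 <= D by rewrite /D !mulr_ge0 ?invr_ge0// ltW.
have D1 : 0 < D + 1 by lra.
(* [D] times 1 - s is the cost of the inner disk; keeping 1 - s below [del] makes it at most eps /
   8. *)
pose del := eps / (8 * (D + 1)).
have del0 : 0 < del by rewrite divr_gt0// mulr_gt0.
pose s := Num.max s0 (1 - del).
have s1 : s < 1 by rewrite /s gt_max s01 /=; lra.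
have s0s : s0 <= s by rewrite /s le_max lexx.
have sdel : 1 - s <= del by rewrite lerBlDr addrC -lerBlDr /s le_max lexx orbT.
clearbody s.
have sp : 0 <= s by lra.
have [G G0 HG] := deriv_bounded dg s1.
pose eta := eps / (2 * (G + 1)).
have G1 : 0 < G + 1 by lra.
have eta0 : 0 < eta by rewrite divr_gt0// mulr_gt0.
exists s, eta; split => // h h' dh hM heta r sr r1.
have r0 : 0 <= r by exact: le_trans sr.
have [Bh Bh0 HBh] := deriv_bounded dh r1.
have [Bg Bg0 HBg] := deriv_bounded dg r1.
pose B := Bh + Bg.
have B0 : 0 <= B by rewrite addr_ge0.
have HB z : cnorm z <= r -> cnorm (h z) <= B /\ cnorm (g z) <= B.
  by move=> zr; have [b1 _] := HBh _ zr; have [b2 _] := HBg _ zr; rewrite /B; split; [apply: le_trans b1 _; rewrite lerDl|apply: le_trans b2 _; rewrite lerDr].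
(* [Z] collects all coefficients of [tau]: 16 (M + 1) from Green's formula, and 2 B + 1 for each of
   the radii [r] and [s]. The budget is eps / 4 for the increment, eps / 4 for [tau], eps / 2 for
   the circle of radius [s]. *)
pose Z := 16 * (M + 1) + 2 * (2 * B + 1).
have Z0 : 0 < Z by rewrite /Z; clear - M1 B0; lra.
pose tau := Num.min 1 (eps / (4 * Z)).
have tau0 : 0 < tau by rewrite lt_min ltr01 divr_gt0// mulr_gt0.
have tau1 : tau <= 1 by rewrite ge_min lexx.
have tauZ : tau * Z <= eps / 4.
  have : tau <= eps / (4 * Z) by rewrite ge_min lexx orbT.
  rewrite -(ler_pM2r Z0) => /le_trans; apply.
  rewrite le_eqVlt; apply/orP; left; apply/eqP; field; exact: lt0r_neq0.
clearbody tau.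
have [p Hp] := poly_approx dh r0 r1 tau0.
have [q Hq] := poly_approx dg r0 r1 tau0.
have Hp1 z : cnorm z <= r -> cnorm (h z - p.[z]) <= tau by case/Hp.
have Hq1 z : cnorm z <= r -> cnorm (g z - q.[z]) <= tau by case/Hq.
have A1 := pair_sub_poly dh dg r0 (lexx r) r1 (ltW tau0) tau1 HB Hp1 Hq1.
have A2 := pair_sub_poly dh dg sp sr r1 (ltW tau0) tau1 HB Hp1 Hq1.
have HN z : cnorm z <= r -> (1 - cnorm z) * cnorm p^`().[z] <= M + 1.
  move=> zr; have [_ h2] := Hp _ zr; have dz : disk z by exact: disk_le r1 zr.
  have z1 : 0 <= 1 - cnorm z by rewrite subr_ge0 ltW.
  have z0 := cnorm_ge0 z.
  have pz : cnorm p^`().[z] <= cnorm (h' z) + tau.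
    by have := cnorm_le_sub p^`().[z] (h' z); rewrite cdistC; clear - h2; lra.
  have : (1 - cnorm z) * cnorm p^`().[z] <= (1 - cnorm z) * (cnorm (h' z) + tau) by rewrite ler_wpM2l.
  have : (1 - cnorm z) * tau <= 1 * 1 by apply: ler_pM z1 (ltW tau0) _ tau1; rewrite gerBl.
  have := hM _ dz; rewrite mulrDr; clear; lra.
have Hq2 z : cnorm z <= r -> cnorm q^`().[z] <= cnorm (g' z) + tau.
  move=> zr; have [_ h2] := Hq _ zr.
  by have := cnorm_le_sub q^`().[z] (g' z); rewrite cdistC; clear - h2; lra.
have s0r : s0 <= r by exact: le_trans sr.
have s00 : 0 <= s0 by clear - s02; lra.
have A3 := circle_pairing_bound dg (ltW tau0) s02 s0s sr r1 (ltW M1) HN Hq2 (Hbound _ s00 s01) (Hs0 _ s0r r1).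
rewrite -/T in A3.
have ratio : (1 - s) / (1 - s0) <= 1 by rewrite (ler_pdivrMr _ _ s0') mul1r lerB.
have ratio0 : 0 <= (1 - s) / (1 - s0) by apply: divr_ge0 (ltW s0'); rewrite subr_ge0 ltW.
have A4 : 8 * (M + 1) * ((1 - s) / (1 - s0) * (T + tau) + (e1 + tau)) <= eps / 4 + 16 * (M + 1) * tau.
  have -> : 8 * (M + 1) * ((1 - s) / (1 - s0) * (T + tau) + (e1 + tau)) =
    D * (1 - s) + (1 - s) / (1 - s0) * (8 * (M + 1) * tau) + 8 * (M + 1) * e1 + 8 * (M + 1) * tau.
    by rewrite /D; ring.
  have b1 : D * (1 - s) <= eps / 8.
    apply: (@le_trans _ _ (D * del)); first by rewrite ler_wpM2l.
    rewrite /del mulrA ler_pdivrMr ?mulr_gt0//.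
    have : 0 <= eps by exact: ltW.
    have := mulr_ge0 (ltW eps0) D0; clear; lra.
  have b2 : (1 - s) / (1 - s0) * (8 * (M + 1) * tau) <= 8 * (M + 1) * tau.
    by rewrite -[leRHS]mul1r ler_wpM2r// !mulr_ge0// ltW.
  have b3 : 8 * (M + 1) * e1 = eps / 8 by rewrite /e1; field; rewrite gt_eqF.
  clear - b1 b2 b3; lra.
have A5 : cnorm (cintab 0 1 (pair_integrand h g s)) <= eps / 2.
  apply: (@le_trans _ _ (eta * G * (1 - 0))).
    apply: cnorm_cintab => //.
      by move=> x _ _; exact: ccont_pair_integrand dh dg sp s1.
    move=> x _ _; rewrite pair_integrandE cnormM cnormJ; apply: ler_pM; rewrite ?cnorm_ge0//.
      by apply: heta; rewrite cnorm_circle.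
    by have [] := HG (s%:C * ucirc x); rewrite ?cnorm_circle.
  rewrite subr0 mulr1 /eta mulrAC ler_pdivrMr ?mulr_gt0//.
  have := mulr_ge0 (ltW eps0) G0; clear - eps0; lra.
set X := cintab 0 1 (pair_integrand h g r) in A1 *.
set Y := cintab 0 1 (pair_integrand h g s) in A2 A5.
rewrite (_ : X = (X - circle_pairing p q r) + (circle_pairing p q r - circle_pairing p q s)
   - (Y - circle_pairing p q s) + Y); last by ring.
apply: le_trans (cnormD _ _) _.
apply: le_trans (lerD (cnormB _ _) (lexx _)) _.
apply: le_trans (lerD (lerD (cnormD _ _) (lexx _)) (lexx _)) _.
move: tauZ; rewrite /Z; clear - A1 A2 A3 A4 A5; lra.
Qed.

End PairingSmall.

(** * Arcs and integrals over them against nu and Lebesgue measure *)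

Section CircleArcs.
Context {R : realType}.
Implicit Types (a l t : R).

Lemma measurable_carc a l : measurable (carc a l).
Proof.
rewrite (_ : carc a l = `[0, 1[%classic `&` \bigcup_(n : nat)
    (`[a - n%:R, a + l - n%:R[%classic `|` `[a + n%:R, a + l + n%:R[%classic)).
  apply: measurableI => //; apply: bigcup_measurable => n _; exact: measurableU.
apply/seteqP; split => t /=; rewrite in_itv /=.
- move=> [t01 [k /andP[k1 k2]]]; split => //.
  case: k k1 k2 => k k1 k2; [exists k => //; left|exists k.+1 => //; right];
    rewrite /= in_itv /=; apply/andP; split.
  + by rewrite lerBlDr.
  + by rewrite ltrBrDr.
  + by move: k1; rewrite NegzE mulrNz lerBrDr.
  + by move: k2; rewrite NegzE mulrNz ltrBlDr.
- move=> [t01 [n _ [|]]]; rewrite /= in_itv /= => /andP[h1 h2]; split => //.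
  + by exists n%:Z; apply/andP; split; [rewrite -lerBlDr|rewrite -ltrBrDr].
  + exists (- n%:Z); rewrite mulrNz; apply/andP; split; [by rewrite lerBrDr|by rewrite ltrBlDr].
Qed.

Lemma carc_sub01 a l : carc a l `<=` `[0, 1[%classic.
Proof. by move=> t [t01 _]; rewrite /= in_itv. Qed.

Lemma carc1 a : carc a 1 = `[0, 1[%classic.
Proof.
apply/seteqP; split; first exact: carc_sub01.
move=> t /=; rewrite in_itv /= => t01; split => //.
have := floor_itv (t - a); rewrite intrD => /andP[h1 h2].
by exists (- Num.floor (t - a)); rewrite mulrNz; apply/andP; split; lra.
Qed.

Lemma carcD a l1 l2 : 0 <= l1 -> 0 <= l2 -> carc a (l1 + l2) = carc a l1 `|` carc (a + l1) l2.
Proof.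
move=> l10 l20; apply/seteqP; split => t /=.
- move=> [t01 [k /andP[k1 k2]]]; have [h|h] := ltP (t + k%:~R) (a + l1).
    by left; split => //; exists k; rewrite k1.
  by right; split => //; exists k; rewrite h /= -addrA.
- move=> [[t01 [k /andP[k1 k2]]]|[t01 [k /andP[k1 k2]]]]; split => //; exists k; apply/andP; split => //; lra.
Qed.

Lemma carc_disjoint a l1 l2 : 0 <= l1 -> 0 <= l2 -> l1 + l2 <= 1 ->
  [disjoint carc a l1 & carc (a + l1) l2].
Proof.
move=> l10 l20 l12; apply/disj_setPS => t [[_ [k /andP[k1 k2]]] [_ [m /andP[m1 m2]]]].
(* A common point would give two integers whose difference lies strictly between 0 and 1. *)
have h1 : 0 < (m - k)%:~R :> R by rewrite intrB; lra.
have h2 : (m - k)%:~R < 1 :> R by rewrite intrB; lra.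
move: h1 h2; rewrite ltr0z (_ : 1 = 1%:~R)// ltr_int => h1 h2.
by move: h1; rewrite gtz0_ge1 leNgt h2.
Qed.

Lemma carc_subset a l c m : c <= a -> a + l <= c + m -> carc a l `<=` carc c m.
Proof.
move=> ca acl t [t01 [k /andP[k1 k2]]]; split => //; exists k.
by rewrite (le_trans ca k1) (lt_le_trans k2 acl).
Qed.

Variable nu : {measure set R -> \bar R}.
Hypothesis nufin : (nu `[0%R, 1%R[%classic < +oo)%E.

Definition arc_mass a l := fine (nu (carc a l)).

Lemma nu_carc_fin a l : (nu (carc a l) < +oo)%E.
Proof.
apply: le_lt_trans nufin; apply: le_measure; rewrite ?inE//; first exact: measurable_carc.
exact: carc_sub01.
Qed.

Lemma arc_mass_ge0 a l : 0 <= arc_mass a l.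
Proof. exact: fine_ge0. Qed.

Lemma arc_massD a l1 l2 : 0 <= l1 -> 0 <= l2 -> l1 + l2 <= 1 ->
  arc_mass a (l1 + l2) = arc_mass a l1 + arc_mass (a + l1) l2.
Proof.
move=> l10 l20 l12; rewrite /arc_mass carcD// measureU//.
- by rewrite fineD// ge0_fin_numE// nu_carc_fin.
- exact: measurable_carc.
- exact: measurable_carc.
- by apply/eqP; rewrite -disj_set2E; exact: carc_disjoint.
Qed.

Variable K : R -> R.
Hypothesis cK : forall t, {for t, continuous K}.
Hypothesis bK : exists B, forall t, `|K t| <= B.
Hypothesis perK : forall t (k : int), K (t + k%:~R) = K t.

Definition arc_int a l := Rintegral nu (carc a l) K.

Lemma arc_integrable (D : set R) : measurable D -> D `<=` `[0, 1[%classic ->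
  nu.-integrable D (EFin \o K).
Proof.
move=> mD D01; apply: measurable_bounded_integrable => //.
- by apply: le_lt_trans nufin; apply: le_measure; rewrite ?inE.
- by apply: measurable_funTS; exact: continuous_measurable_fun.
- have [B HB] := bK; exists B; split; rewrite ?num_real// => x Bx y _.
  exact: le_trans (HB _) (ltW Bx).
Qed.

Lemma arc_intD a l1 l2 : 0 <= l1 -> 0 <= l2 -> l1 + l2 <= 1 ->
  arc_int a (l1 + l2) = arc_int a l1 + arc_int (a + l1) l2.
Proof.
move=> l10 l20 l12; rewrite /arc_int carcD// Rintegral_setU//.
- exact: measurable_carc.
- exact: measurable_carc.
- rewrite -carcD//; apply: arc_integrable; [exact: measurable_carc|exact: carc_sub01].
- exact: carc_disjoint.
Qed.

Lemma arc_int_approx a l L : 0 <= L -> 0 <= l ->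
  (forall x, a <= x -> x <= a + l -> `|K x - K a| <= L * (x - a)) ->
  `|arc_int a l - K a * arc_mass a l| <= L * l * arc_mass a l.
Proof.
move=> L0 l0 HL; have mC := measurable_carc a l.
have iK : nu.-integrable (carc a l) (EFin \o K) by apply: arc_integrable => //; exact: carc_sub01.
have ic c : nu.-integrable (carc a l) (EFin \o (fun _ : R => c)).
  apply: measurable_bounded_integrable => //; first exact: nu_carc_fin.
  by exists `|c|; split; rewrite ?num_real// => x cx y _; exact: ltW.
rewrite /arc_mass -!Rintegral_cst// /arc_int -RintegralB//.
have iB := integrableB_EFin mC iK (ic (K a)).
apply: le_trans (le_normr_Rintegral mC iB) _.
apply: le_Rintegral => //; first exact: integrable_norm.
(* A point of the arc is a parameter in [0, 1); periodicity moves it to the lift in [a, a + l),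
   where the Lipschitz bound applies. *)
move=> t [_ [k /andP[k1 k2]]]; rewrite -(perK t k).
by apply: le_trans (HL _ k1 (ltW k2)) _; rewrite ler_wpM2l//; lra.
Qed.

Definition leb_int a l := \int[lebesgue_measure]_(t in `[a, a + l]) K t.

Lemma leb_intD a l1 l2 : 0 <= l1 -> 0 <= l2 ->
  leb_int a (l1 + l2) = leb_int a l1 + leb_int (a + l1) l2.
Proof.
move=> l10 l20; rewrite /leb_int addrA; apply: Rintegral_itv_cat; [lra|lra|].
by apply: integrable_itv_cont => t _ _; exact: cK.
Qed.

Lemma leb_int_approx a l L : 0 <= L -> 0 <= l ->
  (forall x, a <= x -> x <= a + l -> `|K x - K a| <= L * (x - a)) ->
  `|leb_int a l - K a * l| <= L * l * l.
Proof.
move=> L0 l0 HL; have al : a <= a + l by rewrite lerDl.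
have le : fine (lebesgue_measure `[a, a + l]) = l by rewrite lebesgue_itv_cc// addrC addKr.
have ic (c : R) : lebesgue_measure.-integrable `[a, a + l]%classic (EFin \o (fun _ : R => c)).
  by apply: integrable_itv_cont => t _ _; exact: cst_continuous.
have iK : lebesgue_measure.-integrable `[a, a + l]%classic (EFin \o K).
  by apply: integrable_itv_cont => t _ _; exact: cK.
have -> : `|leb_int a l - K a * l| = `|\int[lebesgue_measure]_(t in `[a, a + l]) (K t - K a)|.
  by rewrite RintegralB// Rintegral_cst// le.
rewrite -[X in _ <= _ * X]le -Rintegral_cst//.
apply: le_trans (le_normr_Rintegral _ _) _ => //; first exact: integrableB_EFin.
apply: le_Rintegral => //; first by apply: integrable_norm => //; exact: integrableB_EFin.
move=> t /=; rewrite in_itv /= => /andP[t1 t2].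
by apply: le_trans (HL _ t1 t2) _; rewrite ler_wpM2l//; lra.
Qed.

End CircleArcs.

(** * Dyadic decompositions for measures of controlled oscillation *)

Section Dyadic.
Context {R : realType}.

Lemma normr_halves (x y c : R) : `|x - y| <= c -> `|x| + `|y| <= `|x + y| + c.
Proof.
case: (ger0P x) => x0; case: (ger0P y) => y0; case: (ger0P (x + y)) => h1;
  case: (ger0P (x - y)) => h2; lra.
Qed.

Lemma dyadic_deviation (n X : R -> R -> R) (K : R -> R) (A L e a0 l0 : R) :
  0 <= A -> 0 <= L -> 0 <= e -> 0 <= l0 -> l0 <= 1 ->
  (forall a l, 0 <= n a l) ->
  (forall a h, 0 <= h -> h + h <= 1 -> n a (h + h) = n a h + n (a + h) h) ->
  (forall a h, 0 <= h -> h + h <= 1 -> X a (h + h) = X a h + X (a + h) h) ->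
  (forall a l, a0 <= a -> 0 <= l -> a + l <= a0 + l0 ->
     `|X a l - K a * (n a l - A * l)| <= L * l * (n a l + A * l)) ->
  (forall x y, a0 <= x -> x <= y -> y <= a0 + l0 -> `|K y - K x| <= L * (y - x)) ->
  (forall a h, a0 <= a -> 0 <= h -> a + (h + h) <= a0 + l0 -> `|n a h - n (a + h) h| <= e * h) ->
  `|X a0 l0 - K a0 * (n a0 l0 - A * l0)| <= L * l0 * ((`|n a0 l0 - A * l0| + e * l0) / 2).
Proof.
move=> A0 L0 e0 l00 l01 n0 nadd Xadd crude lip osc.
pose sg a l := n a l - A * l.
have H k : forall a l, a0 <= a -> 0 <= l -> a + l <= a0 + l0 ->
    `|X a l - K a * sg a l| <= L * l * ((`|sg a l| + e * l) / 2) + L * l * (n a l + A * l) / 2 ^+ k.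
  elim: k => [|k ih] a l aa0 l0' al.
    apply: le_trans (crude _ _ aa0 l0' al) _; rewrite expr0 divr1 lerDr.
    by rewrite !mulr_ge0 ?divr_ge0 ?addr_ge0 ?mulr_ge0.
  pose h := l / 2.
  have h0 : 0 <= h by rewrite divr_ge0.
  have lE : l = h + h by rewrite /h; lra.
  have h1 : h + h <= 1 by rewrite -lE; lra.
  clearbody h; subst l.
  have ih1 := ih a h aa0 h0 ltac:(lra).
  have ih2 := ih (a + h) h ltac:(lra) h0 ltac:(lra).
  have os := osc a h aa0 h0 al.
  have lp := lip a (a + h) aa0 ltac:(lra) ltac:(lra).
  have sgE : sg a (h + h) = sg a h + sg (a + h) h by rewrite /sg nadd//; lra.
  have sgd : `|sg a h - sg (a + h) h| <= e * h.
    by rewrite /sg (_ : _ - _ - _ = n a h - n (a + h) h)//; ring.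
  have hv := normr_halves sgd; rewrite -sgE in hv.
  have nE := nadd a h h0 h1.
  rewrite Xadd// nE.
  rewrite (_ : _ - _ = (X a h - K a * sg a h) + (X (a + h) h - K (a + h) * sg (a + h) h) +
     (K (a + h) - K a) * sg (a + h) h); last by rewrite sgE; ring.
  have s2 : `|sg (a + h) h| <= (`|sg a (h + h)| + e * h) / 2.
    have := sgd; rewrite distrC => sgd'.
    have e1 : 2 * sg (a + h) h = sg a (h + h) + (sg (a + h) h - sg a h) by rewrite sgE; ring.
    have : `|2 * sg (a + h) h| <= `|sg a (h + h)| + e * h.
      by rewrite e1; apply: le_trans (ler_normD _ _) _; rewrite lerD2l.
    by rewrite normrM ger0_norm//; lra.
  apply: le_trans (ler_normD _ _) _; apply: le_trans (lerD (ler_normD _ _) (lexx _)) _.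
  rewrite normrM.
  have t3 : `|K (a + h) - K a| * `|sg (a + h) h| <= L * h * ((`|sg a (h + h)| + e * h) / 2).
    apply: ler_pM => //; apply: le_trans lp _.
    by rewrite ler_wpM2l//; lra.
  apply: le_trans (lerD (lerD ih1 ih2) t3) _.
  have p0 : (2 ^+ k.+1)^-1 = (2 ^+ k)^-1 / 2 :> R by rewrite exprSr invfM.
  rewrite p0.
  move: ((2 ^+ k)^-1) (`|sg a (h + h)|) (`|sg a h|) (`|sg (a + h) h|) hv => P S S1 S2 hv.
  have hv' : L * h * (S1 + S2) <= L * h * (S + e * h) by rewrite ler_wpM2l// mulr_ge0.
  lra.
apply/ler_addgt0Pr => d d0.
have [k Hk] := exp2_small (L * l0 * (n a0 l0 + A * l0)) d0.
apply: le_trans (H k _ _ (lexx _) l00 (lexx _)) _.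
by rewrite lerD2l ltW.
Qed.

(** The bound is the sum 6 + 8 + 8 of the infinite series; the induction carries the exact partial
    sum. *)
Lemma dyadic_weight_sum n : \sum_(k < n) (k%:R + 2) ^+ 2 / 2 ^+ k <= 22 :> R.
Proof.
suff : \sum_(k < n) (k%:R + 2) ^+ 2 / 2 ^+ k <= 22 - (2 * n%:R ^+ 2 + 12 * n%:R + 22) / 2 ^+ n :> R.
  move=> /le_trans; apply; rewrite gerBl; apply: divr_ge0; last exact: exprn_ge0.
  have : 0 <= n%:R :> R by []. have := sqr_ge0 (n%:R : R); lra.
elim: n => [|n ih]; first by rewrite big_ord0 expr0n /= mulr0 mulr0 !add0r divr1 subrr.
rewrite big_ord_recr /=; apply: le_trans (lerD ih (lexx _)) _.
rewrite -[n.+1]addn1 natrD exprD expr1 invfM.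
move: ((2 ^+ n)^-1) (n%:R) => P x; rewrite le_eqVlt; apply/orP; left; apply/eqP.
by field.
Qed.

(* [N], [P] are masses of an arc with endpoint at the base point and of the
   adjacent shell of the same length, [X], [Y] the corresponding integrals. *)
Lemma dyadic_side (n : nat) (l0 kappa E c A : R) (N P X Y eps : nat -> R) :
  0 < l0 -> 0 <= kappa -> 0 <= E -> 0 <= c ->
  (forall k, (k < n)%N -> N k.+1 = N k + P k) ->
  (forall k, (k < n)%N -> X k.+1 = X k + Y k) ->
  (forall k, (k <= n)%N -> 0 <= eps k <= E * (1 + c * k%:R)) ->
  (forall k, (k < n)%N -> `|P k - N k| <= eps k.+1 * (2 ^+ k * l0)) ->
  `|N 0%N - A * l0| <= eps 0%N * l0 ->
  `|X 0%N| <= 2 * kappa / l0 ^+ 2 * (`|N 0%N - A * l0| + eps 0%N * l0) ->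
  (forall k, (k < n)%N -> `|Y k| <= 2 * kappa / (2 ^+ k * l0) ^+ 2 *
     (`|P k - A * (2 ^+ k * l0)| + eps k.+1 * (2 ^+ k * l0))) ->
  `|X n| <= 92 * (1 + c) * kappa * E / l0.
Proof.
move=> l00 k0 E0 c0 NE XE epsE PN N0 X0 Y0.
have p2 k : 0 < 2 ^+ k :> R by rewrite exprn_gt0.
have lk k : 0 < 2 ^+ k * l0 by rewrite mulr_gt0.
have epsc k : (k <= n)%N -> eps k <= E * (1 + c) * (k%:R + 1).
  move=> kn; have /andP[_ h] := epsE _ kn; apply: le_trans h _.
  rewrite -mulrA ler_wpM2l//.
  have : 0 <= k%:R :> R by []. have : 0 <= c * k%:R by rewrite mulr_ge0.
  lra.
have eps0 k : (k <= n)%N -> 0 <= eps k by move=> kn; have /andP[] := epsE _ kn.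
(* At each doubling the average over the arc moves by at most half of [eps k.+1], which is linear in
   k, so its distance from [A] grows quadratically. *)
have D k : (k <= n)%N -> `|N k - A * (2 ^+ k * l0)| <= E * (1 + c) * (k%:R + 1) ^+ 2 * (2 ^+ k * l0).
  elim: k => [|k ih] kn.
    rewrite expr0 mul1r add0r expr1n mulr1; apply: le_trans N0 _.
    by rewrite ler_wpM2r ?(ltW l00)//; have := epsc _ kn; rewrite add0r mulr1.
  have ih' := ih (ltnW kn); have pn := PN _ kn; have ec := epsc _ kn.
  rewrite NE// (_ : _ - _ = 2 * (N k - A * (2 ^+ k * l0)) + (P k - N k)); last by rewrite exprS; ring.
  apply: le_trans (ler_normD _ _) _; rewrite normrM (ger0_norm (x := 2))//.
  apply: le_trans (lerD (ler_wpM2l _ ih') pn) _ => //.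
  have h1 : eps k.+1 * (2 ^+ k * l0) <= E * (1 + c) * (k.+1%:R + 1) * (2 ^+ k * l0).
    by rewrite ler_wpM2r// ltW.
  apply: le_trans (lerD (lexx _) h1) _.
  rewrite (exprS 2) -(natr1 k).
  have w0 : 0 <= E * (1 + c) * (2 ^+ k * l0) by rewrite !mulr_ge0 ?addr_ge0// ltW.
  have kk : 0 <= k%:R :> R by [].
  have : 0 <= E * (1 + c) * (2 ^+ k * l0) * (3 * k%:R + 4) by rewrite mulr_ge0//; lra.
  move: (2 ^+ k) (k%:R : R) => z x; lra.
have Pd k : (k < n)%N -> `|P k - A * (2 ^+ k * l0)| + eps k.+1 * (2 ^+ k * l0) <=
    2 * (E * (1 + c)) * (k%:R + 2) ^+ 2 * (2 ^+ k * l0).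
  move=> kn; have d := D _ (ltnW kn); have pn := PN _ kn; have ec := epsc _ kn.
  have h1 : eps k.+1 * (2 ^+ k * l0) <= E * (1 + c) * (k.+1%:R + 1) * (2 ^+ k * l0).
    by rewrite ler_wpM2r// ltW.
  have : `|P k - A * (2 ^+ k * l0)| <= `|P k - N k| + `|N k - A * (2 ^+ k * l0)|.
    by rewrite (_ : P k - A * _ = (P k - N k) + (N k - A * (2 ^+ k * l0))); [exact: ler_normD|ring].
  move=> tri.
  apply: (@le_trans _ _ (E * (1 + c) * (k%:R + 1) ^+ 2 * (2 ^+ k * l0) + 2 * (E * (1 + c) * (k.+1%:R + 1) * (2 ^+ k * l0)))).
    lra.
  rewrite -(natr1 k).
  have w0 : 0 <= E * (1 + c) * (2 ^+ k * l0) by rewrite !mulr_ge0 ?addr_ge0// ltW.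
  have kk : 0 <= k%:R :> R by [].
  have : 0 <= E * (1 + c) * (2 ^+ k * l0) * (k%:R ^+ 2 + 4 * k%:R + 3) by rewrite mulr_ge0// !addr_ge0// ?sqr_ge0// mulr_ge0.
  move: (2 ^+ k) (k%:R : R) => z x; lra.
(* The unit of the estimate: the base arc costs at most [w] and the shells at most 22 [w], whence 92
   = 4 * 23. *)
pose w := 4 * kappa * (E * (1 + c)) / l0.
have w0 : 0 <= w by rewrite /w divr_ge0 ?(ltW l00)// !mulr_ge0// addr_ge0.
have Yk k : (k < n)%N -> `|Y k| <= w * ((k%:R + 2) ^+ 2 / 2 ^+ k).
  move=> kn; apply: le_trans (Y0 _ kn) _.
  apply: le_trans (ler_wpM2l _ (Pd _ kn)) _.
    by rewrite divr_ge0 ?mulr_ge0 ?exprn_ge0// ltW.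
  rewrite le_eqVlt; apply/orP; left; apply/eqP; rewrite /w; field.
  by rewrite !gt_eqF.
have X0w : `|X 0%N| <= w.
  apply: le_trans X0 _.
  have e0 := epsc _ (leq0n n); rewrite add0r mulr1 in e0.
  have h : `|N 0%N - A * l0| + eps 0%N * l0 <= 2 * (E * (1 + c)) * l0.
    have : eps 0%N * l0 <= E * (1 + c) * l0 by rewrite ler_wpM2r// ltW.
    lra.
  apply: le_trans (ler_wpM2l _ h) _; first by rewrite divr_ge0 ?mulr_ge0 ?exprn_ge0// ltW.
  rewrite le_eqVlt; apply/orP; left; apply/eqP; rewrite /w; field.
  by rewrite !gt_eqF.
have XS k : (k <= n)%N -> `|X k| <= w + w * \sum_(i < k) (i%:R + 2) ^+ 2 / 2 ^+ i.
  elim: k => [|k ih] kn; first by rewrite big_ord0 mulr0 addr0.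
  rewrite XE// big_ord_recr /= mulrDr addrA.
  by apply: le_trans (ler_normD _ _) _; rewrite lerD ?ih ?Yk// ltnW.
apply: le_trans (XS _ (leqnn n)) _.
have := ler_wpM2l w0 (dyadic_weight_sum n).
have -> : 92 * (1 + c) * kappa * E / l0 = 23 * w by rewrite /w; field; rewrite gt_eqF.
lra.
Qed.

End Dyadic.

(** * Comparison of nu with Lebesgue measure against a peaked kernel *)

Section KernelEstimate.
Context {R : realType}.
Variable nu : {measure set R -> \bar R}.
Hypothesis nufin : (nu `[0%R, 1%R[%classic < +oo)%E.
Variable K : R -> R.
Hypothesis cK : forall t, {for t, continuous K}.
Hypothesis bK : exists B, forall t, `|K t| <= B.
Hypothesis perK : forall t (k : int), K (t + k%:~R) = K t.
Variables (th : R) (n : nat) (kappa E c : R) (eps : nat -> R).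
(** With this value 2^n [l0] is 1 / 2, so the dyadic arcs on the two sides of [th] end exactly at
    the opposite point. *)
Let l0 : R := (2 ^+ n.+1)^-1.
Hypothesis kappa0 : 0 <= kappa.
Hypothesis E0 : 0 <= E.
Hypothesis c0 : 0 <= c.
(** The free scale [l] stands for the distance of x from 0, cut off at [l0]; it allows a whole shell
    to be treated with its inner radius. *)
Hypothesis K_le : forall l x, 0 < l -> l <= Num.max l0 `|x| -> `|x| <= 1 / 2 ->
  `|K (th + x)| <= kappa / l ^+ 2.
Hypothesis K_lip : forall l x y, 0 < l -> l <= Num.max l0 `|x| -> l <= Num.max l0 `|y| ->
  `|x| <= 1 / 2 -> `|y| <= 1 / 2 -> x <= y ->
  `|K (th + y) - K (th + x)| <= kappa / l ^+ 3 * (y - x).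
Hypothesis epsE : forall k, (k <= n)%N -> 0 <= eps k <= E * (1 + c * k%:R).
Hypothesis osc : forall k a h, (k <= n)%N -> th - 2 ^+ k * l0 <= a -> 0 <= h ->
  a + (h + h) <= th + 2 ^+ k * l0 ->
  `|arc_mass nu a h - arc_mass nu (a + h) h| <= eps k * h.

Definition central_avg (l : R) := arc_mass nu (th - l) (l + l) / (l + l).

(** The density subtracted from nu. Taking it from the innermost arc makes the deviation on both
    halves of that arc a matter of oscillation only. *)
Let A := central_avg l0.
Let X a l := arc_int nu K a l - A * leb_int K a l.

Let l00 : 0 < l0. Proof. by rewrite invr_gt0 exprn_gt0. Qed.

Let lk k : 0 < 2 ^+ k * l0. Proof. by rewrite mulr_gt0// exprn_gt0. Qed.

Let lk_half k : (k <= n)%N -> 2 ^+ k * l0 <= 1 / 2.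
Proof.
move=> kn; rewrite /l0 ler_pdivrMr ?exprn_gt0// exprS mulrA divfK//.
by rewrite mul1r ler_eXn2l// ltr1n.
Qed.

Let lkS k : 2 ^+ k.+1 * l0 = 2 ^+ k * l0 + 2 ^+ k * l0.
Proof. by rewrite exprS; ring. Qed.

Let A0 : 0 <= A.
Proof. by rewrite divr_ge0 ?arc_mass_ge0// addr_ge0// ltW. Qed.

Let XD a l1 l2 : 0 <= l1 -> 0 <= l2 -> l1 + l2 <= 1 -> X a (l1 + l2) = X a l1 + X (a + l1) l2.
Proof. by move=> *; rewrite /X (arc_intD nufin)// leb_intD//; ring. Qed.

(** At scale [l] the kernel has size kappa / l^2 and Lipschitz constant kappa / l^3. Over length [l]
    it thus varies by no more than its size, and the main term and the error of [dyadic_deviation]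
    are of the same order. *)
Let piece (p l e : R) : 0 < l -> l <= 1 / 2 -> 0 <= e ->
  (forall x, p <= x -> x <= p + l -> l <= Num.max l0 `|x - th| /\ `|x - th| <= 1 / 2) ->
  (forall a h, p <= a -> 0 <= h -> a + (h + h) <= p + l ->
     `|arc_mass nu a h - arc_mass nu (a + h) h| <= e * h) ->
  `|X p l| <= 2 * kappa / l ^+ 2 * (`|arc_mass nu p l - A * l| + e * l).
Proof.
move=> lp lh e0 Hx Ho.
pose L := kappa / l ^+ 3.
have L0 : 0 <= L by rewrite divr_ge0// exprn_ge0// ltW.
have lip x y : p <= x -> x <= y -> y <= p + l -> `|K y - K x| <= L * (y - x).
  move=> px xy yl; have [h1 h2] := Hx _ px (le_trans xy yl).
  have [h3 h4] := Hx _ (le_trans px xy) yl.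
  have := K_lip lp h1 h3 h2 h4; rewrite lerD2r => /(_ xy).
  rewrite (addrC th) subrK (addrC th) subrK.
  by rewrite (_ : y - th - (x - th) = y - x); last by ring.
have Kp : `|K p| <= kappa / l ^+ 2.
  have [h1 h2] := Hx p (lexx _) ltac:(rewrite lerDl; exact: ltW).
  by have := K_le lp h1 h2; rewrite (addrC th) subrK.
have crude a m : p <= a -> 0 <= m -> a + m <= p + l ->
    `|X a m - K a * (arc_mass nu a m - A * m)| <= L * m * (arc_mass nu a m + A * m).
  move=> pa m0 aml.
  have Hl x : a <= x -> x <= a + m -> `|K x - K a| <= L * (x - a).
    by move=> ax xm; apply: lip => //; exact: le_trans aml.
  have h1 := arc_int_approx nufin cK bK perK L0 m0 Hl.
  have h2 := leb_int_approx cK L0 m0 Hl.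
  rewrite /X (_ : _ - _ = (arc_int nu K a m - K a * arc_mass nu a m) - A * (leb_int K a m - K a * m)); last by ring.
  apply: le_trans (ler_normB _ _) _; rewrite normrM (ger0_norm A0).
  have := ler_wpM2l A0 h2; lra.
have D := @dyadic_deviation R (arc_mass nu) X K A L e p l A0 L0 e0 (ltW lp).
have l1 : l <= 1 by lra.
have {D} := D l1 (arc_mass_ge0 nu) (fun a h h0 hh => arc_massD nufin a h0 h0 hh)
  (fun a h h0 hh => XD a h0 h0 hh) crude lip Ho.
move: (X p l) (arc_mass nu p l - A * l) => x s D.
have xs : `|x| <= `|x - K p * s| + `|K p| * `|s|.
  by rewrite -normrM -{1}(subrK (K p * s) x); exact: ler_normD.
have ks : `|K p| * `|s| <= kappa / l ^+ 2 * `|s| by rewrite ler_wpM2r.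
have LE : L * l = kappa / l ^+ 2 by rewrite /L; field; rewrite gt_eqF.
rewrite LE in D.
have q0 : 0 <= kappa / l ^+ 2 by rewrite divr_ge0// exprn_ge0// ltW.
have : 0 <= kappa / l ^+ 2 * `|s| by rewrite mulr_ge0.
have : 0 <= kappa / l ^+ 2 * (e * l) by rewrite mulr_ge0// mulr_ge0// ltW.
rewrite -mulrA; lra.
Qed.

Let eps0 k : (k <= n)%N -> 0 <= eps k. Proof. by move=> /epsE/andP[]. Qed.

Let l0_half : l0 <= 1 / 2.
Proof. by have := lk_half (leq0n n); rewrite expr0 mul1r. Qed.

Let A_eq : A * (l0 + l0) = arc_mass nu (th - l0) l0 + arc_mass nu th l0.
Proof.
rewrite /A /central_avg divfK ?gt_eqF ?addr_gt0// (arc_massD nufin) ?(ltW l00)//.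
  by rewrite subrK.
by have := l0_half; lra.
Qed.

Let osc0 : `|arc_mass nu (th - l0) l0 - arc_mass nu th l0| <= eps 0%N * l0.
Proof.
have := @osc 0%N (th - l0) l0 (leq0n n); rewrite expr0 mul1r subrK.
by apply; rewrite ?(ltW l00)//; lra.
Qed.

Let base_right : `|arc_mass nu th l0 - A * l0| <= eps 0%N * l0.
Proof.
have e0 : 0 <= eps 0%N * l0 by rewrite mulr_ge0 ?eps0// ltW.
have : `|2 * (arc_mass nu th l0 - A * l0)| <= eps 0%N * l0.
  rewrite (_ : 2 * _ = - (arc_mass nu (th - l0) l0 - arc_mass nu th l0)) ?normrN//.
  by have := A_eq; lra.
rewrite normrM (ger0_norm (x := 2))//; have := normr_ge0 (arc_mass nu th l0 - A * l0); lra.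
Qed.

Let base_left : `|arc_mass nu (th - l0) l0 - A * l0| <= eps 0%N * l0.
Proof.
rewrite (_ : _ - _ = - (arc_mass nu th l0 - A * l0)) ?normrN ?base_right//.
by have := A_eq; lra.
Qed.

Let right_side : `|X th (2 ^+ n * l0)| <= 92 * (1 + c) * kappa * E / l0.
Proof.
have sub k : (k < n)%N -> 2 ^+ k * l0 + 2 ^+ k * l0 <= 1 / 2.
  by move=> kn; rewrite -lkS; exact: lk_half.
apply: (@dyadic_side R n l0 kappa E c A (fun k => arc_mass nu th (2 ^+ k * l0))
  (fun k => arc_mass nu (th + 2 ^+ k * l0) (2 ^+ k * l0)) (fun k => X th (2 ^+ k * l0))
  (fun k => X (th + 2 ^+ k * l0) (2 ^+ k * l0)) eps) => //.
- move=> k kn; have s := sub _ kn; rewrite lkS (arc_massD nufin) ?(ltW (lk k))//; lra.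
- move=> k kn; have s := sub _ kn; rewrite lkS XD ?(ltW (lk k))//; lra.
- move=> k kn; rewrite distrC; apply: osc => //; rewrite ?(ltW (lk k))// lkS; have := lk k; lra.
- by rewrite expr0 mul1r.
- rewrite expr0 mul1r; apply: piece => //; first exact: eps0.
  + move=> x x1 x2; split; first by rewrite le_max lexx.
    by rewrite ger0_norm; have := l0_half; lra.
  + by move=> a h a1 h0 a2; apply: osc => //; rewrite expr0 mul1r; have := l00; lra.
- move=> k kn; have s := sub _ kn; have p := lk k; apply: piece => //; [lra|exact: eps0| |].
  + move=> x x1 x2; rewrite ger0_norm; last by lra.
    by split; [rewrite le_max; apply/orP; right; lra|lra].
  + by move=> a h a1 h0 a2; apply: osc => //; rewrite lkS; lra.
Qed.

Let left_side : `|X (th - 2 ^+ n * l0) (2 ^+ n * l0)| <= 92 * (1 + c) * kappa * E / l0.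
Proof.
have sub k : (k < n)%N -> 2 ^+ k * l0 + 2 ^+ k * l0 <= 1 / 2.
  by move=> kn; rewrite -lkS; exact: lk_half.
have start k : th - 2 ^+ k.+1 * l0 + 2 ^+ k * l0 = th - 2 ^+ k * l0.
  by rewrite lkS; ring.
apply: (@dyadic_side R n l0 kappa E c A (fun k => arc_mass nu (th - 2 ^+ k * l0) (2 ^+ k * l0))
  (fun k => arc_mass nu (th - 2 ^+ k.+1 * l0) (2 ^+ k * l0)) (fun k => X (th - 2 ^+ k * l0) (2 ^+ k * l0))
  (fun k => X (th - 2 ^+ k.+1 * l0) (2 ^+ k * l0)) eps) => //.
- move=> k kn; have s := sub _ kn; rewrite {2}lkS (arc_massD nufin) ?(ltW (lk k))//; last by lra.
  by rewrite start addrC.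
- move=> k kn; have s := sub _ kn; rewrite {2}lkS XD ?(ltW (lk k))//; last by lra.
  by rewrite start addrC.
- move=> k kn; rewrite -(start k); apply: osc => //; rewrite ?(ltW (lk k))// lkS; have := lk k; lra.
- by rewrite expr0 mul1r.
- rewrite expr0 mul1r; apply: piece => //; first exact: eps0.
  + move=> x x1 x2; split; first by rewrite le_max lexx.
    by rewrite ler_norml; apply/andP; split; have := l0_half; lra.
  + by move=> a h a1 h0 a2; apply: osc => //; rewrite expr0 mul1r; have := l00; lra.
- move=> k kn; have s := sub _ kn; have p := lk k; apply: piece => //; [lra|exact: eps0| |].
  + rewrite lkS => x x1 x2; rewrite ler0_norm; last by lra.
    by split; [rewrite le_max; apply/orP; right; lra|lra].
  + by rewrite lkS => a h a1 h0 a2; apply: osc => //; rewrite lkS; lra.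
Qed.

(** The two sides of [th] contribute equally, whence 184 = 2 * 92. The Lebesgue integral of [K] will
    be 1 for the Poisson kernel and 0 for the components of [herglotz_deriv]. *)
Lemma kernel_estimate :
  `|arc_int nu K (th - 1 / 2) 1 - A * leb_int K (th - 1 / 2) 1| <=
  184 * (1 + c) * kappa * E / l0.
Proof.
have ln : 2 ^+ n * l0 = 1 / 2.
  by rewrite /l0 exprS; field; rewrite expf_neq0.
have := right_side; have := left_side; rewrite ln => hl hr.
rewrite -/(X _ _) (_ : X (th - 1 / 2) 1 = X (th - 1 / 2) (1 / 2) + X th (1 / 2)); last first.
  have e : 1 = 1 / 2 + 1 / 2 :> R by lra.
  rewrite [X _ 1](_ : _ = X (th - 1 / 2) (1 / 2 + 1 / 2)); last by rewrite -e.
  by rewrite XD ?subrK//; lra.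
by apply: le_trans (ler_normD _ _) _; lra.
Qed.

End KernelEstimate.

(** * Estimates for the Poisson kernel and the differentiated Herglotz kernel *)

Section Kernels.
Context {R : realType}.

Lemma polar_form (z : R[i]) : exists th : R, z = (cnorm z)%:C * ucirc th.
Proof.
have [->|z0] := eqVneq z 0; first by exists 0; rewrite cnorm0 mul0r.
have c0 : 0 < cnorm z by rewrite cnorm_gt0.
pose x := complex.Re z / cnorm z; pose y := complex.Im z / cnorm z.
have xy : x ^+ 2 + y ^+ 2 = 1.
  rewrite /x /y !expr_div_n -mulrDl -cnorm_sqr divff// expf_neq0// gt_eqF//.
have x1 : -1 <= x <= 1.
  by rewrite -ler_norml -(@ler_pXn2r _ 2)// ?nnegrE// expr1n real_normK ?num_real// -xy lerDl sqr_ge0.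
have twopi : 2 * pi != 0 :> R by rewrite mulf_neq0// gt_eqF// pi_gt0.
have co : cos (acos x) = x by rewrite acosK// in_itv.
have si : sin (acos x) = `|y| by rewrite sin_acos// -sqrtr_sqr -xy addrAC subrr add0r.
have zE (s : R) : ucirc s = Complex x y -> z = (cnorm z)%:C * ucirc s.
  move=> ->; apply/eqP; rewrite eq_complex cReM cImM /= !mul0r subr0 addr0.
  have cn0 : cnorm z != 0 by rewrite gt_eqF.
  by rewrite /x /y !(mulrC (cnorm z)) !divfK// !eqxx.
have [y0|y0] := leP 0 y.
- exists (acos x / (2 * pi)); apply: zE.
  by rewrite /ucirc mulrC divfK// co si ger0_norm.
- exists (- (acos x / (2 * pi))); apply: zE.
  by rewrite /ucirc mulrN mulrC divfK// cosN sinN co si ltr0_norm// opprK.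
Qed.

(** The difference of the two sides has the nonnegative derivative t sin t. *)
Lemma sin_ge_mulcos (v : R) : 0 <= v -> v <= pi -> v * cos v <= sin v.
Proof.
move=> v0 vpi.
have cf t : {for t, continuous (fun t : R => t * sin t)}.
  by apply: continuousM; [exact: cvg_id|exact: continuous_sin].
pose F (t : R) := sin t - t * cos t.
have dF (t : R) : 0 <= t -> t <= v -> is_derive t 1 F (t * sin t).
  move=> _ _.
  have H := is_deriveB (is_derive_sin t) (is_deriveM (is_derive_id t 1) (is_derive_cos t)).
  apply: is_derive_eq H _; rewrite /GRing.scale /=; ring.
have := FTC_real (f := fun t => t * sin t) v0 dF (fun t _ _ => cf t).
rewrite /F sin0 mul0r !subr0 => E.
rewrite -subr_ge0 -E; apply: Rintegral_ge0 => t /=; rewrite in_itv /= => /andP[t0 tv].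
by rewrite mulr_ge0// sin_ge0_pi// t0 (le_trans tv).
Qed.

(** By [sin_ge_mulcos] at y / 2, sin y = 2 sin (y / 2) cos (y / 2) is at least (y / 2) (1 + cos y),
    and cos y is nonnegative here. *)
Lemma sin_ge_half (y : R) : 0 <= y -> y <= pi / 2 -> y / 2 <= sin y.
Proof.
move=> y0 yp; have pi0 := pi_gt0 R.
have h := @sin_ge_mulcos (y / 2) ltac:(lra) ltac:(lra).
have cy : 0 <= cos (y / 2) by apply: cos_ge0_pihalf; apply/andP; split; lra.
have cyy : 0 <= cos y by apply: cos_ge0_pihalf; apply/andP; split; lra.
have e : y = y / 2 + y / 2 by lra.
have sE : sin y = 2 * (sin (y / 2) * cos (y / 2)) by rewrite {1}e sinD; ring.
have cE : 2 * cos (y / 2) ^+ 2 = 1 + cos y.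
  rewrite {2}e cosD; have := cos2Dsin2 (y / 2); rewrite !expr2; lra.
have : y / 2 * cos (y / 2) * cos (y / 2) <= sin (y / 2) * cos (y / 2) by rewrite ler_wpM2r.
rewrite -mulrA -expr2 sE => h2.
have : y / 2 * 1 <= y / 2 * (2 * cos (y / 2) ^+ 2).
  by rewrite ler_wpM2l ?cE; lra.
lra.
Qed.

(** The chord has length 2 sin (pi |x|). The factor 2 in the bound is what [ucirc_sub_max]
    consumes. *)
Lemma ucirc_dist_ge (th x : R) : `|x| <= 1 / 2 -> 2 * `|x| <= cnorm (ucirc (th + x) - ucirc th).
Proof.
move=> x2; rewrite ucircD -{2}(mulr1 (ucirc th)) -mulrBr cnormM cnorm_ucirc mul1r.
wlog x0 : x x2 / 0 <= x.
  move=> H; have [x0|x0] := leP 0 x; first exact: H.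
  have := H (- x); rewrite normrN oppr_ge0 => /(_ x2 (ltW x0)).
  have -> : ucirc (- x) - 1 = conjc (ucirc x - 1).
    rewrite ucircN; case: (ucirc x) => a b; apply/eqP.
    by rewrite eq_complex /= !subr0 !eqxx.
  by rewrite cnormJ.
rewrite (ger0_norm x0) in x2 *.
have pi0 := pi_ge2 R.
have px : 0 <= pi * x by rewrite mulr_ge0// pi_ge0.
have sp := @sin_ge_half (pi * x) px ltac:(nra).
have s0 : 0 <= sin (pi * x) by apply: le_trans sp; rewrite divr_ge0.
have -> : cnorm (ucirc x - 1) = 2 * sin (pi * x).
  apply/eqP; rewrite -(eqrXn2 (n := 2))// ?cnorm_ge0 ?mulr_ge0//; apply/eqP.
  rewrite cnorm_sqr cReD cImD cReN cImN /= subr0.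
  have -> : 2 * pi * x = pi * x + pi * x by ring.
  rewrite cosD sinD; have := cos2Dsin2 (pi * x).
  set s := sin _; set c := cos _ => cs.
  have -> : c * c - s * s - 1 = - (2 * s ^+ 2) by have := cs; rewrite !expr2; lra.
  have -> : (- (2 * s ^+ 2)) ^+ 2 + (s * c + c * s) ^+ 2 = (2 * s) ^+ 2 * (c ^+ 2 + s ^+ 2) by ring.
  by rewrite cs mulr1.
nra.
Qed.

(** The distance is at least 1 - r and at least 2 |x| - (1 - r); the mean of the two bounds is
    |x|. *)
Lemma ucirc_sub_max (r th x l0 : R) : 0 <= r -> r < 1 -> l0 <= 1 - r -> `|x| <= 1 / 2 ->
  Num.max l0 `|x| <= cnorm (ucirc (th + x) - r%:C * ucirc th).
Proof.
move=> r0 r1 lr x2; set z := r%:C * ucirc th.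
have zr : cnorm z = r by exact: cnorm_circle.
have h1 := ucirc_sub_ge z (th + x); rewrite zr in h1.
have h2 := ucirc_dist_ge th x2.
have h3 : cnorm (ucirc (th + x) - ucirc th) <= cnorm (ucirc (th + x) - z) + cnorm (z - ucirc th).
  by rewrite (_ : ucirc (th + x) - ucirc th = (ucirc (th + x) - z) + (z - ucirc th)) ?cnormD//; ring.
have h4 : cnorm (z - ucirc th) = 1 - r.
  rewrite (_ : z - ucirc th = - ((1 - r)%:C * ucirc th)); last by rewrite /z rmorphB /=; ring.
  by rewrite cnormN cnorm_circle// subr_ge0 ltW.
by rewrite ge_max; apply/andP; split; lra.
Qed.

(* [d/dz ((u + z) / (u - z))] *)
Definition herglotz_deriv (z : R[i]) (t : R) : R[i] := 2%:R * ucirc t / (ucirc t - z) ^+ 2.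

Lemma herglotz_deriv_le (z : R[i]) (t l : R) : 0 < l -> l <= cnorm (ucirc t - z) ->
  cnorm (herglotz_deriv z t) <= 2 / l ^+ 2.
Proof.
move=> l0 lu; rewrite cnormf cnormM cnorm_ucirc mulr1 cnormX.
rewrite (_ : 2%:R = (2 : R)%:C) ?cnorm_real ?ger0_norm ?rmorph_nat//.
rewrite ler_wpM2l// lef_pV2 ?posrE ?exprn_gt0// ?(lt_le_trans l0)//.
by rewrite lerXn2r// ?nnegrE ?(ltW l0) ?cnorm_ge0.
Qed.

Lemma inv_dist_le (a b l : R) : 0 < l -> l <= a -> l <= b ->
  (a + b) / (a ^+ 2 * b ^+ 2) <= 2 / l ^+ 3.
Proof.
move=> l0 la lb; have a0 := lt_le_trans l0 la; have b0 := lt_le_trans l0 lb.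
have l3 : 0 < l ^+ 3 by rewrite exprn_gt0.
have -> : (a + b) / (a ^+ 2 * b ^+ 2) = (a * b ^+ 2)^-1 + (a ^+ 2 * b)^-1.
  by field; rewrite !gt_eqF.
have h1 : (a * b ^+ 2)^-1 <= (l ^+ 3)^-1.
  rewrite lef_pV2 ?posrE ?mulr_gt0 ?exprn_gt0// exprS; apply: ler_pM; rewrite ?exprn_ge0 ?(ltW l0)//.
  by rewrite lerXn2r// ?nnegrE ltW.
have h2 : (a ^+ 2 * b)^-1 <= (l ^+ 3)^-1.
  rewrite lef_pV2 ?posrE ?mulr_gt0 ?exprn_gt0// exprSr; apply: ler_pM; rewrite ?exprn_ge0 ?(ltW l0)//.
  by rewrite lerXn2r// ?nnegrE ltW.
lra.
Qed.

Lemma herglotz_deriv_lip (z : R[i]) (s t l : R) : cnorm z <= 1 -> 0 < l ->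
  l <= cnorm (ucirc s - z) -> l <= cnorm (ucirc t - z) -> s <= t ->
  cnorm (herglotz_deriv z t - herglotz_deriv z s) <= 8 * pi / l ^+ 3 * (t - s).
Proof.
move=> z1 l0 ls lt st.
have s0 : ucirc s - z != 0 by rewrite -cnorm_gt0 (lt_le_trans l0).
have t0 : ucirc t - z != 0 by rewrite -cnorm_gt0 (lt_le_trans l0).
set u := ucirc s in ls s0 *; set v := ucirc t in lt t0 *.
have -> : herglotz_deriv z t - herglotz_deriv z s =
    2%:R * (v - u) * (- (u - z) * v - z * (v - z)) / ((u - z) ^+ 2 * (v - z) ^+ 2).
  by rewrite /herglotz_deriv -/u -/v; field; rewrite s0 t0.
rewrite cnormf !(cnormX, cnormM) (_ : 2%:R = (2 : R)%:C) ?cnorm_real ?ger0_norm ?rmorph_nat//.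
have vu : cnorm (v - u) <= 2 * pi * (t - s).
  by have := ucirc_lip t s; rewrite ger0_norm// subr_ge0.
have num : cnorm (- (u - z) * v - z * (v - z)) <= cnorm (u - z) + cnorm (v - z).
  apply: le_trans (cnormB _ _) _; rewrite !cnormM cnormN cnorm_ucirc mulr1 lerD2l.
  by rewrite -[leRHS]mul1r ler_wpM2r ?cnorm_ge0.
have d := inv_dist_le l0 ls lt.
have d0 : 0 <= (cnorm (u - z) + cnorm (v - z)) / (cnorm (u - z) ^+ 2 * cnorm (v - z) ^+ 2).
  by rewrite divr_ge0 ?addr_ge0 ?mulr_ge0 ?exprn_ge0 ?cnorm_ge0.
apply: (@le_trans _ _ (2 * (2 * pi * (t - s)) * (2 / l ^+ 3))); last by rewrite le_eqVlt; apply/orP; left; apply/eqP; ring.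
rewrite -mulrA; apply: ler_pM; rewrite ?mulr_ge0 ?cnorm_ge0 ?invr_ge0 ?exprn_ge0 ?cnorm_ge0//.
- by rewrite mulr_ge0 ?exprn_ge0 ?cnorm_ge0.
- by rewrite ler_pM2l.
- apply: le_trans d; rewrite ler_wpM2r// invr_ge0 mulr_ge0// exprn_ge0// cnorm_ge0//.
Qed.

Lemma poisson_kernelE (z : R[i]) (t : R) : cnorm z < 1 ->
  complex.Re (herglotz z t) = (1 - cnorm z ^+ 2) / cnorm (ucirc t - z) ^+ 2.
Proof.
move=> z1; rewrite /herglotz !cnorm_sqr.
have uz := ucirc_sub_neq0 t z1.
have d0 : cnorm (ucirc t - z) ^+ 2 != 0 by rewrite expf_neq0// cnorm_eq0.
rewrite cnorm_sqr in d0.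
have u1 : complex.Re (ucirc t) ^+ 2 + complex.Im (ucirc t) ^+ 2 = 1 by rewrite /= cos2Dsin2.
rewrite -u1; move: (ucirc t) z d0 {u1 uz z1} => [a b] [x y] /= d0.
by rewrite mulrN opprK; field.
Qed.

(** The constant 8 pi, where 2 would do, agrees with [poisson_kernel_lip], so that one [kappa]
    serves for both. *)
Lemma poisson_kernel_le (z : R[i]) (t l : R) : cnorm z < 1 -> 0 < l -> l <= cnorm (ucirc t - z) ->
  `|complex.Re (herglotz z t)| <= 8 * pi * (1 - cnorm z) / l ^+ 2.
Proof.
move=> z1 l0 lu; have z0 := cnorm_ge0 z; have pi2 := pi_ge2 R.
have zz : cnorm z ^+ 2 <= 1 by rewrite expr_le1// ltW.
rewrite poisson_kernelE// ger0_norm; last by rewrite divr_ge0 ?sqr_ge0// subr_ge0.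
apply: ler_pM; rewrite ?invr_ge0 ?sqr_ge0 ?subr_ge0//.
  rewrite (_ : 1 - _ = (1 - cnorm z) * (1 + cnorm z)); last by ring.
  rewrite mulrC ler_wpM2r ?subr_ge0 ?ltW//; lra.
rewrite lef_pV2 ?posrE ?exprn_gt0// ?(lt_le_trans l0)//.
by rewrite lerXn2r// ?nnegrE ?(ltW l0) ?cnorm_ge0.
Qed.

Lemma poisson_kernel_lip (z : R[i]) (s t l : R) : cnorm z < 1 -> 0 < l ->
  l <= cnorm (ucirc s - z) -> l <= cnorm (ucirc t - z) -> s <= t ->
  `|complex.Re (herglotz z t) - complex.Re (herglotz z s)| <= 8 * pi * (1 - cnorm z) / l ^+ 3 * (t - s).
Proof.
move=> z1 l0 ls lt st; have z0 := cnorm_ge0 z; have pi2 := pi_ge2 R.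
have zz : cnorm z ^+ 2 <= 1 by rewrite expr_le1// ltW.
rewrite !poisson_kernelE//.
have vu : cnorm (ucirc t - ucirc s) <= 2 * pi * (t - s).
  by have := ucirc_lip t s; rewrite ger0_norm// subr_ge0.
have tri : `|cnorm (ucirc s - z) - cnorm (ucirc t - z)| <= cnorm (ucirc t - ucirc s).
  have e1 : (ucirc s - z) - (ucirc t - z) = ucirc s - ucirc t by ring.
  have e2 : (ucirc t - z) - (ucirc s - z) = ucirc t - ucirc s by ring.
  have := cnorm_le_sub (ucirc s - z) (ucirc t - z); have := cnorm_le_sub (ucirc t - z) (ucirc s - z).
  rewrite e1 e2 (cdistC (ucirc s) (ucirc t)) ler_norml => h1 h2; apply/andP; split; lra.
move: (cnorm (ucirc s - z)) (cnorm (ucirc t - z)) ls lt tri => a b la lb tri.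
have a0 := lt_le_trans l0 la; have b0 := lt_le_trans l0 lb.
have -> : (1 - cnorm z ^+ 2) / b ^+ 2 - (1 - cnorm z ^+ 2) / a ^+ 2 =
    (1 - cnorm z ^+ 2) * ((a - b) * ((a + b) / (a ^+ 2 * b ^+ 2))).
  by field; rewrite !gt_eqF.
have d := inv_dist_le l0 la lb.
have d0 : 0 <= (a + b) / (a ^+ 2 * b ^+ 2).
  by rewrite divr_ge0 ?addr_ge0 ?mulr_ge0 ?exprn_ge0// ltW.
rewrite normrM (normrM (a - b)) (ger0_norm d0) ger0_norm ?subr_ge0//.
have h1 : 1 - cnorm z ^+ 2 <= 2 * (1 - cnorm z).
  rewrite (_ : 1 - _ = (1 + cnorm z) * (1 - cnorm z)); last by ring.
  by rewrite ler_wpM2r ?subr_ge0 ?ltW//; lra.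
apply: (@le_trans _ _ (2 * (1 - cnorm z) * (2 * pi * (t - s) * (2 / l ^+ 3)))); last first.
  by rewrite le_eqVlt; apply/orP; left; apply/eqP; ring.
apply: ler_pM; [by rewrite subr_ge0|by rewrite mulr_ge0|exact: h1|].
by apply: ler_pM => //; exact: le_trans tri vu.
Qed.

Lemma ccont_herglotz (z : R[i]) (t : R) : cnorm z < 1 -> ccont (herglotz z) t.
Proof.
move=> z1; apply: ccontM; first by apply: ccontD; [exact: ccont_ucirc|exact: ccont_cst].
by apply: ccontV (ccont_ucirc_sub z t); exact: ucirc_sub_neq0.
Qed.

Lemma ccont_herglotz_deriv (z : R[i]) (t : R) : cnorm z < 1 -> ccont (herglotz_deriv z) t.
Proof.
move=> z1; apply: ccontM; first by apply: ccontM; [exact: ccont_cst|exact: ccont_ucirc].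
apply: ccontV; first by rewrite expf_neq0// ucirc_sub_neq0.
by apply: ccontX; exact: ccont_ucirc_sub.
Qed.

Lemma cintab_herglotz (c : R) (z : R[i]) : cnorm z < 1 -> cintab c (c + 1) (herglotz z) = 1.
Proof.
move=> z1; have c1 : c <= c + 1 by rewrite lerDl.
have ck t : ccont (fun t => ucirc t / (ucirc t - z)) t.
  apply: ccontM; first exact: ccont_ucirc.
  by apply: ccontV (ccont_ucirc_sub z t); exact: ucirc_sub_neq0.
rewrite (eq_cintab (G := fun t => 2%:R * (ucirc t / (ucirc t - z)) - 1)); last first.
  by move=> t _ _; rewrite /herglotz; field; exact: ucirc_sub_neq0.
rewrite cintabB; last 2 first.
- by move=> t _ _; apply: ccontM (ck t); exact: ccont_cst.
- by move=> t _ _; exact: ccont_cst.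
have cc1 : c + 1 - c = 1 by ring.
by rewrite cintabZ ?cint_cauchy_kernel// cintab_cst// cc1 rmorph1; ring.
Qed.

(** The integral of the Herglotz kernel is 1 for every [z], so its difference quotients integrate to
    0, and they converge uniformly in t to [herglotz_deriv]. *)
Lemma cintab_herglotz_deriv (c : R) (z : R[i]) : cnorm z < 1 ->
  cintab c (c + 1) (herglotz_deriv z) = 0.
Proof.
move=> z1; have c1 : c <= c + 1 by rewrite lerDl.
apply: cnorm_le_eps0 => e e0.
pose d := 1 - cnorm z; have d0 : 0 < d by rewrite subr_gt0.
(* Per unit of [x], a bound for the error of the difference quotient: the poles are at distance at
   least [d] from [z] and d / 2 from [z + x]. *)
pose B := 4 / d ^+ 3; have B0 : 0 < B by rewrite divr_gt0// exprn_gt0.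
pose x := Num.min (d / 2) (e / B).
have x0 : 0 < x by rewrite lt_min; apply/andP; split; exact: divr_gt0.
have xd : x <= d / 2 by rewrite ge_min lexx.
have xe : x * B <= e by rewrite -ler_pdivlMr// ge_min lexx orbT.
clearbody x.
have cx : cnorm x%:C = x by rewrite cnorm_real gtr0_norm.
have zx1 : cnorm (z + x%:C) < 1.
  by apply: le_lt_trans (cnormD _ _) _; rewrite cx; move: xd; rewrite /d; lra.
have xn0 : x%:C != 0 by rewrite -cnorm_gt0 cx.
have n1 t := ucirc_sub_neq0 t z1; have n2 t := ucirc_sub_neq0 t zx1.
have cz t := ccont_herglotz_deriv t z1.
pose Q t := herglotz (z + x%:C) t - herglotz z t.
have cQ t : ccont Q t by apply: ccontB; exact: ccont_herglotz.
have IQ : cintab c (c + 1) Q = 0.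
  rewrite cintabB; first by rewrite !cintab_herglotz// subrr.
  - by move=> t _ _; exact: ccont_herglotz.
  - by move=> t _ _; exact: ccont_herglotz.
have -> : cintab c (c + 1) (herglotz_deriv z) = - cintab c (c + 1) (fun t => x%:C^-1 * Q t - herglotz_deriv z t).
  rewrite cintabB; last 2 first.
  - by move=> t _ _; apply: ccontM (cQ t); exact: ccont_cst.
  - by move=> t _ _; exact: cz.
  by rewrite cintabZ ?IQ ?mulr0 ?sub0r ?opprK//.
rewrite cnormN; apply: le_trans xe; rewrite -[leRHS]mulr1.
have cc1 : c + 1 - c = 1 by ring.
rewrite -[X in _ <= _ * X]cc1; apply: (cnorm_cintab c1).
  by move=> t _ _; apply: ccontB (cz t); apply: ccontM (cQ t); exact: ccont_cst.
move=> t _ _; rewrite (_ : _ - _ = x%:C * (2%:R * ucirc t) / ((ucirc t - (z + x%:C)) * (ucirc t - z) ^+ 2)); last first.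
  by rewrite /Q /herglotz /herglotz_deriv; field; rewrite n1 n2 xn0.
rewrite cnormf !(cnormX, cnormM) cx cnorm_ucirc mulr1 (_ : 2%:R = (2 : R)%:C) ?cnorm_real ?ger0_norm ?rmorph_nat//.
rewrite -mulrA ler_wpM2l ?(ltW x0)//.
have u1 := ucirc_sub_ge z t.
have u2 : d / 2 <= cnorm (ucirc t - (z + x%:C)).
  apply: le_trans (ucirc_sub_ge _ _).
  by have := cnormD z x%:C; rewrite cx; move: xd; rewrite /d; lra.
have -> : B = 2 / ((d / 2) * d ^+ 2) by rewrite /B; field; rewrite gt_eqF.
rewrite ler_wpM2l// lef_pV2 ?posrE ?mulr_gt0 ?divr_gt0 ?exprn_gt0 ?cnorm_gt0 ?n1 ?n2//.
apply: ler_pM; rewrite ?divr_ge0 ?exprn_ge0 ?(ltW d0)//.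
by rewrite lerXn2r// ?nnegrE ?cnorm_ge0 ?(ltW d0).
Qed.

End Kernels.

(** * Chain rule and complex exponential *)

Section ComplexExp.
Context {R : realType}.

Lemma has_cderiv_comp (F g : R[i] -> R[i]) (z d e : R[i]) : has_cderiv g z d ->
  has_cderiv F (g z) e -> has_cderiv (fun w => F (g w)) z (e * d).
Proof.
move=> Hg HF; apply/has_cderivP => x x0.
have L0 : 0 < cnorm d + 1 by rewrite ltr_wpDl ?cnorm_ge0.
have K0 : 0 < cnorm e + 1 by rewrite ltr_wpDl ?cnorm_ge0.
have x1 : 0 < x / 2 / (cnorm d + 1) by rewrite !divr_gt0.
have x2 : 0 < x / 2 / (cnorm e + 1) by rewrite !divr_gt0.
have [a a0 Ha] := (has_cderivP _ _ _).1 HF _ x1.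
have [b b0 Hb] := (has_cderivP _ _ _).1 Hg _ x2.
have [l l0 Hl] := has_cderiv_lip Hg.
have [m m0 Hm] := has_cderiv_cont Hg a0.
exists (Num.min b (Num.min l m)); first by rewrite !lt_min b0 l0 m0.
move=> h; rewrite !lt_min => /and3P[hb hl hm].
have h1 := Ha _ (Hm _ hm); rewrite (addrC (g z)) subrK in h1.
have h2 := Hb _ hb; have h3 := Hl _ hl.
rewrite (_ : _ - _ = (F (g (z + h)) - F (g z) - e * (g (z + h) - g z)) + e * (g (z + h) - g z - d * h)); last by ring.
apply: le_trans (cnormD _ _) _; rewrite cnormM.
have e1 : x / 2 / (cnorm d + 1) * cnorm (g (z + h) - g z) <= x / 2 * cnorm h.
  apply: le_trans (ler_wpM2l (ltW x1) h3) _.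
  by rewrite mulrA divfK// gt_eqF.
have e2 : cnorm e * cnorm (g (z + h) - g z - d * h) <= x / 2 * cnorm h.
  apply: le_trans (ler_wpM2l (cnorm_ge0 _) h2) _.
  rewrite mulrA; apply: ler_wpM2r; first exact: cnorm_ge0.
  have q : x / 2 / (cnorm e + 1) * (cnorm e + 1) = x / 2 by rewrite divfK ?gt_eqF.
  by rewrite -[leRHS]q mulrDr mulr1 mulrC lerDl ltW.
lra.
Qed.

Lemma is_derive_eps (f : R -> R) (x d : R) : is_derive x 1 f d ->
  forall e, 0 < e -> exists2 del, 0 < del & forall t, `|t| < del ->
     `|f (x + t) - f x - d * t| <= e * `|t|.
Proof.
move=> fd e e0.
have := @ex_derive _ _ _ _ _ _ _ fd => /cvg_ex[l hl].
have ld : l = d by rewrite -(@derive_val _ _ _ _ _ _ _ fd); apply/esym/cvg_lim.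
move: hl; rewrite ld => /cvgrPdist_le/(_ _ e0)/nbhs_ballP[del del0 H].
exists del => // t td; have [->|t0] := eqVneq t 0.
  by rewrite addr0 mulr0 subrr subr0 normr0 mulr0.
have := H t; rewrite /ball /= sub0r normrN => /(_ td t0).
rewrite /GRing.scale /= mulr1 (addrC t) distrC => h.
rewrite (_ : _ - _ = (t^-1 * (f (x + t) - f x) - d) * t); last by field.
by rewrite normrM ler_wpM2r.
Qed.

Lemma cexpD (w v : R[i]) : cexp (w + v) = cexp w * cexp v.
Proof.
rewrite /cexp cReD cImD expRD cosD sinD; apply/eqP; rewrite eq_complex /=.
by apply/andP; split; apply/eqP; ring.
Qed.

Lemma cexp0 : cexp (0 : R[i]) = 1.
Proof. by rewrite /cexp /= expR0 cos0 sin0 mul1r. Qed.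

Lemma cnorm_cexp (w : R[i]) : cnorm (cexp w) = expR (complex.Re w).
Proof.
rewrite /cexp cnormM cnorm_real ger0_norm ?expR_ge0// [X in _ * X]/cnorm /=.
by rewrite cos2Dsin2 sqrtr1 mulr1.
Qed.

Lemma has_cderiv_cexp0 : has_cderiv (@cexp R) 0 1.
Proof.
apply/has_cderivP => e e0.
(* The errors of both components add up to 9/16 of [e]; the cap 1 gives the linear bounds [a2] and
   [s1]. *)
have e4 : 0 < Num.min (e / 16) 1 by rewrite lt_min ltr01 divr_gt0.
have [a a0 Ha] := is_derive_eps (is_derive_expR (0 : R)) e4.
have [b b0 Hb] := is_derive_eps (is_derive_cos (0 : R)) e4.
have [c c0 Hc] := is_derive_eps (is_derive_sin (0 : R)) e4.
have d0 : 0 < Num.min (Num.min a (e / 16)) (Num.min b (Num.min c 1)).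
  by rewrite !lt_min a0 b0 c0 ltr01 divr_gt0.
exists (Num.min (Num.min a (e / 16)) (Num.min b (Num.min c 1))) => // h.
rewrite add0r mul1r cexp0 !lt_min => /andP[/andP[ha h8] /and3P[hb hc h1]].
pose x := complex.Re h; pose y := complex.Im h.
have xh : `|x| <= cnorm h := normRe_le h.
have yh : `|y| <= cnorm h := normIm_le h.
have m4 : Num.min (e / 16) 1 <= e / 16 by rewrite ge_min lexx.
have m1 : Num.min (e / 16) 1 <= 1 by rewrite ge_min lexx orbT.
have := Ha x (le_lt_trans xh ha); have := Hb y (le_lt_trans yh hb); have := Hc y (le_lt_trans yh hc).
rewrite !add0r expR0 sin0 cos0 ?oppr0 mul0r ?subr0 ?addr0 !mul1r => c1 b1 a1.
have x8 : `|x| <= e / 16 by lra.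
have X0 := normr_ge0 x; have Y0 := normr_ge0 y.
have N0 := cnorm_ge0 h.
set m := Num.min (e / 16) 1 in m4 m1 a1 b1 c1 e4 Ha Hb Hc *; clearbody m.
have a2 : `|expR x - 1| <= 2 * `|x|.
  have := ler_normD (expR x - 1 - x) x; rewrite subrK => t.
  have : m * `|x| <= 1 * `|x| by rewrite ler_wpM2r.
  move: a1; clear - t X0; lra.
have E3 : expR x <= 3.
  have t1 := ler_norm (expR x - 1); have t2 : `|x| <= 1 by apply: (le_trans xh); exact: ltW.
  by rewrite -(subrK 1 (expR x)) (_ : 3 = 2 * 1 + 1) ?lerD2r; [apply: le_trans t1 (le_trans a2 _); rewrite ler_wpM2l | ring].
have E0 := expR_ge0 x.
have s1 : `|sin y| <= 2 * `|y|.
  have := ler_normD (sin y - y) y; rewrite subrK => t.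
  have : m * `|y| <= 1 * `|y| by rewrite ler_wpM2r.
  move: c1; clear - t Y0; lra.
have mh z : 0 <= z -> z <= cnorm h -> m * z <= e / 16 * cnorm h.
  by move=> z0 zh; apply: ler_pM => //; exact: ltW.
apply: le_trans (cnorm_le_ReIm _) _.
rewrite !(cReD, cReN, cImD, cImN) /cexp cReM cImM /= -/x -/y !mul0r !subr0 addr0.
have r1 : `|expR x * cos y - 1 - x| <= `|expR x - 1 - x| + expR x * `|cos y - 1|.
  rewrite (_ : _ - _ = (expR x - 1 - x) + expR x * (cos y - 1)); last by ring.
  by apply: le_trans (ler_normD _ _) _; rewrite normrM (ger0_norm E0).
have r2 : `|expR x * sin y - y| <= `|expR x - 1| * `|sin y| + `|sin y - y|.
  rewrite (_ : _ - _ = (expR x - 1) * sin y + (sin y - y)); last by ring.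
  by apply: le_trans (ler_normD _ _) _; rewrite normrM.
have p1 : expR x * `|cos y - 1| <= 3 * (m * `|y|).
  by apply: ler_pM => //.
have p2 : `|expR x - 1| * `|sin y| <= (2 * (e / 16)) * (2 * cnorm h).
  apply: ler_pM => //; last exact: le_trans s1 (ler_wpM2l _ yh).
  by apply: (le_trans a2 _); clear - x8; lra.
have q1 := mh _ X0 xh; have q2 := mh _ Y0 yh.
have EN : 0 <= e * cnorm h by rewrite mulr_ge0// ltW.
move: a1 b1 c1; clear - r1 r2 p1 p2 q1 q2 EN; lra.
Qed.

Lemma has_cderiv_cexp (w : R[i]) : has_cderiv (@cexp R) w (cexp w).
Proof.
apply/has_cderivP => e e0.
have c0 : 0 < cnorm (cexp w) by rewrite cnorm_cexp expR_gt0.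
have e1 : 0 < e / cnorm (cexp w) by rewrite divr_gt0.
have [del del0 H] := (has_cderivP _ _ _).1 has_cderiv_cexp0 _ e1.
exists del => // h /H; rewrite add0r cexp0 => Hh.
rewrite cexpD (_ : _ - _ = cexp w * (cexp h - 1 - 1 * h)); last by ring.
by rewrite cnormM (le_trans (ler_wpM2l (cnorm_ge0 _) Hh))// mulrA (mulrC (cnorm (cexp w))) divfK// gt_eqF.
Qed.

End ComplexExp.

(** * The Herglotz integral and its derivative *)

Section HerglotzTransform.
Context {R : realType}.
Variable nu : {measure set R -> \bar R}.
Hypothesis nufin : (nu `[0%R, 1%R[%classic < +oo)%E.

Let D : set R := `[0, 1[%classic.
Let mD : measurable D. Proof. exact: measurable_itv. Qed.

Lemma cintegrable_circle (F : R -> R[i]) (M : R) : (forall t, ccont F t) ->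
  (forall t, cnorm (F t) <= M) -> cintegrable nu D F.
Proof.
move=> cF FM; apply: (@cintegrable_bounded _ _ _ nu D F M) => //.
- by apply: measurable_funTS; apply: continuous_measurable_fun => t; exact: (cF t).1.
- by apply: measurable_funTS; apply: continuous_measurable_fun => t; exact: (cF t).2.
Qed.

Definition herglotz_int (z : R[i]) : R[i] := cint nu D (herglotz z).
Definition herglotz_int_deriv (z : R[i]) : R[i] := cint nu D (herglotz_deriv z).

Lemma cnorm_herglotz_le (z : R[i]) (t : R) : cnorm z < 1 ->
  cnorm (herglotz z t) <= 2 / (1 - cnorm z).
Proof.
move=> z1; have z0 : 0 < 1 - cnorm z by rewrite subr_gt0.
rewrite /herglotz cnormf; apply: ler_pM; rewrite ?cnorm_ge0 ?invr_ge0 ?cnorm_ge0//.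
  by apply: le_trans (cnormD _ _) _; rewrite cnorm_ucirc; lra.
by rewrite lef_pV2 ?posrE// ?ucirc_sub_ge// (lt_le_trans z0)// ucirc_sub_ge.
Qed.

Lemma cintegrable_herglotz (z : R[i]) : cnorm z < 1 -> cintegrable nu D (herglotz z).
Proof.
move=> z1; apply: (@cintegrable_circle _ (2 / (1 - cnorm z))) => t.
  exact: ccont_herglotz.
exact: cnorm_herglotz_le.
Qed.

Lemma cintegrable_herglotz_deriv (z : R[i]) : cnorm z < 1 ->
  cintegrable nu D (herglotz_deriv z).
Proof.
move=> z1; apply: (@cintegrable_circle _ (2 / (1 - cnorm z) ^+ 2)) => t.
  exact: ccont_herglotz_deriv.
by apply: herglotz_deriv_le; rewrite ?subr_gt0// ucirc_sub_ge.
Qed.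

(** The remainder of the kernel is explicitly 2 u h^2 / ((u - z - h) (u - z)^2), which is quadratic
    in [h] uniformly in u; it integrates against the finite measure. *)
Lemma has_cderiv_herglotz_int (z : R[i]) : disk z ->
  has_cderiv herglotz_int z (herglotz_int_deriv z).
Proof.
rewrite /disk /= => z1; apply/has_cderivP => e e0.
pose d := 1 - cnorm z; have d0 : 0 < d by rewrite subr_gt0.
pose T := fine (nu D); have T0 : 0 <= T by exact: fine_ge0.
have K0 : 0 < e * d ^+ 3 / (4 * (T + 1)).
  by rewrite divr_gt0 ?mulr_gt0 ?exprn_gt0// ltr_wpDl.
(* The first bound keeps [z + h] at distance d / 2 from the circle, the second turns 4 T |h|^2 / d^3
   into e |h|; T + 1 covers a vanishing measure. *)
exists (Num.min (d / 2) (e * d ^+ 3 / (4 * (T + 1)))); first by rewrite lt_min divr_gt0.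
move=> h; rewrite lt_min => /andP[h1 h2].
have zh1 : cnorm (z + h) < 1.
  by apply: le_lt_trans (cnormD _ _) _; move: h1; rewrite /d; lra.
have iz := cintegrable_herglotz z1; have izh := cintegrable_herglotz zh1.
have iB : cintegrable nu D (fun t => herglotz (z + h) t - herglotz z t) by exact: cintegrableB.
have id := cintegrable_herglotz_deriv z1.
have iZ : cintegrable nu D (fun t => h * herglotz_deriv z t) by exact: cintegrableZ.
rewrite (mulrC _ h) /herglotz_int /herglotz_int_deriv -cintB// -cintZ// -cintB//.
have B t : D t -> cnorm (herglotz (z + h) t - herglotz z t - h * herglotz_deriv z t)
    <= 4 / d ^+ 3 * cnorm h ^+ 2.
  move=> _; have u1 := ucirc_sub_neq0 t z1; have u2 := ucirc_sub_neq0 t zh1.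
  have -> : herglotz (z + h) t - herglotz z t - h * herglotz_deriv z t =
      2%:R * ucirc t * h ^+ 2 / ((ucirc t - (z + h)) * (ucirc t - z) ^+ 2).
    by rewrite /herglotz /herglotz_deriv; field; rewrite u1 u2.
  have g1 := ucirc_sub_ge z t; have g2 := ucirc_sub_ge (z + h) t.
  have g2' : d / 2 <= cnorm (ucirc t - (z + h)).
    by apply: le_trans g2; have := cnormD z h; move: h1; rewrite /d; lra.
  rewrite cnormf (cnormM _ (h ^+ 2)) (cnormM 2%:R) (cnormM (ucirc t - (z + h))) cnorm_ucirc !cnormX mulr1.
  rewrite (_ : 2%:R = (2 : R)%:C) ?cnorm_real ?ger0_norm ?rmorph_nat//.
  rewrite mulrAC ler_wpM2r ?exprn_ge0 ?cnorm_ge0//.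
  have -> : 4 / d ^+ 3 = 2 / (d / 2 * d ^+ 2).
    by field; rewrite gt_eqF.
  rewrite ler_wpM2l//.
  rewrite lef_pV2 ?posrE ?mulr_gt0 ?exprn_gt0 ?divr_gt0 ?(lt_le_trans d0 g1)//.
    apply: ler_pM; rewrite ?divr_ge0 ?exprn_ge0 ?(ltW d0)//.
    by rewrite ler_pXn2r ?nnegrE ?(ltW d0) ?cnorm_ge0.
  by apply: lt_le_trans g2'; rewrite divr_gt0.
have iBZ : cintegrable nu D (fun t => herglotz (z + h) t - herglotz z t - h * herglotz_deriv z t).
  exact: cintegrableB.
apply: le_trans (@cnorm_cint_le _ _ _ nu D _ _ _ nufin iBZ B) _ => //.
have T1 : 0 < T + 1 by rewrite ltr_wpDl.
have := ltW h2; rewrite ler_pdivlMr ?mulr_gt0// => h3.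
rewrite -/T (_ : _ * T = cnorm h * (4 * T) / d ^+ 3 * cnorm h); last by ring.
apply: ler_wpM2r; first exact: cnorm_ge0.
rewrite ler_pdivrMr ?exprn_gt0//; apply: le_trans h3.
by rewrite ler_wpM2l ?cnorm_ge0// ler_wpM2l// lerDl.
Qed.

Variable f : R[i] -> R[i].
Variable c : R[i].
Hypothesis c1 : cnorm c = 1.
Hypothesis fE : forall z, disk z -> f z = c * cexp (- herglotz_int z).

Lemma has_cderiv_exp_herglotz (z : R[i]) : disk z -> has_cderiv f z (- herglotz_int_deriv z * f z).
Proof.
move=> z1; have r0 : 0 < 1 - cnorm z by rewrite subr_gt0.
apply: (has_cderiv_ext (f := fun w => c * cexp (- herglotz_int w))).
  exists (1 - cnorm z) => // w wz; rewrite fE// /disk /=.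
  by have := cnorm_le_sub w z; lra.
rewrite fE// mulrCA; apply: has_cderivZ.
rewrite mulrC; apply: (has_cderiv_comp (F := @cexp R) (g := fun w => - herglotz_int w)).
  rewrite -mulN1r; rewrite (_ : (fun w => _) = (fun w => -1 * herglotz_int w)).
    by apply: has_cderivZ; exact: has_cderiv_herglotz_int.
  by apply/funext => w; rewrite mulN1r.
exact: has_cderiv_cexp.
Qed.

Lemma cnorm_exp_herglotz (z : R[i]) : disk z -> cnorm (f z) = expR (- complex.Re (herglotz_int z)).
Proof. by move=> z1; rewrite fE// cnormM c1 mul1r cnorm_cexp cReN. Qed.

End HerglotzTransform.

(** * Consequences of the hypothesis for centred arcs *)

Section Oscillation.
Context {R : realType}.
Variable nu : {measure set R -> \bar R}.
Hypothesis nufin : (nu `[0%R, 1%R[%classic < +oo)%E.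
Variable C : R.
Hypothesis C0 : 0 < C.
Hypothesis avgH : forall a l : R, 0 < l -> 2 * l <= 1 ->
  `| avg nu a l - avg nu (a + l) l | <=
    C * inf [set x : R | exists c L : R,
      [/\ 0 < L <= 1, setU (carc a l) (carc (a + l) l) `<=` carc c L &
          x = expR (- avg nu c L)]].

(** The infimum lies below the member given by any one covering arc. Multiplied out by [l], the
    inequality also covers the empty arcs that the dyadic lemmas allow. *)
Lemma osc_arc (a l c L : R) : 0 <= l -> 0 < L <= 1 -> c <= a -> a + (l + l) <= c + L ->
  `|arc_mass nu a l - arc_mass nu (a + l) l| <= C * expR (- avg nu c L) * l.
Proof.
move=> l0 /andP[L0 L1] ca acl; move: l0; rewrite le_eqVlt => /orP[/eqP<-|l0].
  by rewrite mulr0 addr0 subrr normr0.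
have l1 : 2 * l <= 1 by lra.
have h := avgH a l0 l1.
have {}h : `|avg nu a l - avg nu (a + l) l| <= C * expR (- avg nu c L).
  apply: le_trans h _; rewrite ler_wpM2l ?(ltW C0)//; apply: ge_inf; last first.
    exists c, L; split => //; first by rewrite L0.
    by move=> t [] ; apply: carc_subset; lra.
  by exists 0 => _ [c' [L' [_ _ ->]]]; exact: expR_ge0.
rewrite (_ : _ - _ = (avg nu a l - avg nu (a + l) l) * l); last first.
  by rewrite mulrBl !divfK ?gt_eqF.
by rewrite normrM (gtr0_norm l0) ler_wpM2r// ltW.
Qed.

Lemma osc_central (th lam a l : R) : 0 < lam -> lam + lam <= 1 -> th - lam <= a -> 0 <= l ->
  a + (l + l) <= th + lam ->
  `|arc_mass nu a l - arc_mass nu (a + l) l| <= C * expR (- central_avg nu th lam) * l.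
Proof. by move=> lam0 lam1 tha l0 al; apply: osc_arc => //; lra. Qed.

Lemma central_avg_ge0 (th lam : R) : 0 < lam -> 0 <= central_avg nu th lam.
Proof. by move=> lam0; rewrite divr_ge0 ?arc_mass_ge0// ?addr_ge0 ?(ltW lam0). Qed.

(** Cut the long arc into quarters of masses m1, ..., m4: the averages differ by ((m2 - m1) + (m3 -
    m4)) / (4 lam), and each bracket compares adjacent arcs of equal length. *)
Lemma central_avg_double (th lam : R) : 0 < lam -> 4 * lam <= 1 ->
  `|central_avg nu th lam - central_avg nu th (2 * lam)| <=
  C / 2 * expR (- central_avg nu th (2 * lam)).
Proof.
move=> lam0 lam1; set e := expR _.
have h1 := @osc_central th (2 * lam) (th - 2 * lam) lam ltac:(lra) ltac:(lra) ltac:(lra) (ltW lam0) ltac:(lra).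
have h2 := @osc_central th (2 * lam) th lam ltac:(lra) ltac:(lra) ltac:(lra) (ltW lam0) ltac:(lra).
rewrite -/e in h1 h2.
have E2 : arc_mass nu (th - lam) (lam + lam) = arc_mass nu (th - lam) lam + arc_mass nu th lam.
  rewrite (arc_massD nufin); [|lra..].
  by rewrite subrK.
have E4 : arc_mass nu (th - 2 * lam) (2 * lam + 2 * lam) =
    arc_mass nu (th - 2 * lam) lam + arc_mass nu (th - lam) lam
    + (arc_mass nu th lam + arc_mass nu (th + lam) lam).
  rewrite (arc_massD nufin); [|lra..]; rewrite subrK.
  have D2 t : arc_mass nu t (2 * lam) = arc_mass nu t lam + arc_mass nu (t + lam) lam.
    have -> : 2 * lam = lam + lam by ring.
    by apply: (arc_massD nufin); lra.
  rewrite !D2; congr (_ + arc_mass _ _ _ + _); ring.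
rewrite (_ : th - 2 * lam + lam = th - lam) in h1; last by ring.
rewrite /central_avg E2 E4.
move: h1 h2; set m1 := arc_mass _ _ _; set m2 := arc_mass _ _ _; set m3 := arc_mass _ _ _; set m4 := arc_mass _ _ _.
clearbody m1 m2 m3 m4 => h1 h2.
rewrite (_ : _ - _ = ((m2 - m1) + (m3 - m4)) / (4 * lam)); last by field; lra.
rewrite normrM normfV (gtr0_norm (_ : 0 < 4 * lam)) ?mulr_gt0// ler_pdivrMr ?mulr_gt0//.
apply: le_trans (ler_normD _ _) _; rewrite (distrC m2).
by rewrite (_ : C / 2 * e * (4 * lam) = C * e * lam + C * e * lam) ?lerD//; field.
Qed.

(** A discrete form of the differential inequality b' <= exp (- b): in terms of exp b the increment
    is bounded. The factor exp (C / 2) pays for the finite step, through exp x <= 1 + x exp x. *)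
Lemma expR_central_avg_step (th lam : R) : 0 < lam -> 4 * lam <= 1 ->
  expR (central_avg nu th lam) <=
  expR (central_avg nu th (2 * lam)) + C / 2 * expR (C / 2).
Proof.
move=> lam0 lam1; have h := central_avg_double th lam0 lam1.
have B0 : 0 <= central_avg nu th (2 * lam) by apply: central_avg_ge0; rewrite mulr_gt0.
move: h B0; set b := central_avg _ _ lam; set B := central_avg _ _ _; clearbody b B => h B0.
pose x := C / 2 * expR (- B).
have x0 : 0 <= x by rewrite mulr_ge0 ?expR_ge0// divr_ge0// ltW.
have xC : x <= C / 2.
  by rewrite -[leRHS]mulr1 ler_wpM2l ?divr_ge0 ?(ltW C0)// -expR0 ler_expR oppr_le0.
have ex : expR x <= 1 + x * expR x.
  have := @expR_ge1Dx R (- x); rewrite expRN => e1.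
  have : (1 + - x) * expR x <= (expR x)^-1 * expR x by rewrite ler_wpM2r ?expR_ge0.
  by rewrite mulVf ?gt_eqF ?expR_gt0//; lra.
have bB : b <= B + x by move: h; rewrite -/x; have := ler_norm (b - B); lra.
apply: (@le_trans _ _ (expR B * (1 + x * expR (C / 2)))).
  rewrite (le_trans (_ : _ <= expR (B + x))) ?ler_expR// expRD ler_wpM2l ?expR_ge0//.
  by apply: le_trans ex _; rewrite lerD2l ler_wpM2l// ler_expR.
rewrite mulrDr mulr1 lerD2l mulrA (_ : expR B * x = C / 2)//.
by rewrite /x mulrCA -expRD subrr expR0 mulr1.
Qed.

Let cc := C / 2 * expR (C / 2).

(** A longer arc may have a smaller average, which weakens the oscillation bound. Summing the
    additive steps limits the loss to a factor linear in k, the shape that [dyadic_side]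
    tolerates. *)
Lemma expR_central_avg_chain (th l0 : R) (n j k : nat) : 0 < l0 -> 2 ^+ n * l0 <= 1 / 2 ->
  (j <= k)%N -> (k <= n)%N ->
  expR (- central_avg nu th (2 ^+ k * l0)) <=
  expR (- central_avg nu th (2 ^+ j * l0)) * (1 + cc * k%:R).
Proof.
move=> l00 nl jk kn.
have cc0 : 0 <= cc by rewrite mulr_ge0 ?expR_ge0// divr_ge0// ltW.
have pos i : 0 < 2 ^+ i * l0 by rewrite mulr_gt0// exprn_gt0.
have H i : (i <= n)%N -> 2 ^+ i * l0 <= 1 / 2.
  by move=> i_n; apply: le_trans nl; rewrite ler_wpM2r ?(ltW l00)// ler_weXn2l// ler1n.
have {kn} chain : expR (central_avg nu th (2 ^+ j * l0)) <=
    expR (central_avg nu th (2 ^+ k * l0)) + cc * (k - j)%:R.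
  move: kn; rewrite -(subnKC jk); move: (k - j)%N => d; elim: d => [|d ih] dn.
    by rewrite addn0 subnn mulr0 addr0.
  have dn' : (j + d <= n)%N by rewrite (leq_trans _ dn)// leq_add2l.
  apply: le_trans (ih dn') _.
  have := @expR_central_avg_step th (2 ^+ (j + d) * l0) (pos _).
  have e : 2 * (2 ^+ (j + d) * l0) = 2 ^+ (j + d.+1) * l0 by rewrite addnS exprS mulrA.
  have := H _ dn; rewrite -e => h1 /(_ ltac:(lra)) h2.
  rewrite -/cc in h2; rewrite !addKn (_ : d.+1%:R = d%:R + 1 :> R); last by rewrite natr1.
  rewrite mulrDr mulr1; lra.
set b := central_avg nu th (2 ^+ j * l0) in chain *.
set B := central_avg nu th (2 ^+ k * l0) in chain *.
have B0 : 0 <= B by exact: central_avg_ge0.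
have {}chain : expR b <= expR B + cc * k%:R.
  by apply: le_trans chain _; rewrite lerD2l ler_wpM2l// ler_nat leq_subr.
have -> : expR (- B) = expR (- b) * (expR (- B) * expR b).
  by rewrite mulrC -mulrA -expRD subrr expR0 mulr1.
rewrite ler_wpM2l ?expR_ge0//.
apply: le_trans (ler_wpM2l (expR_ge0 _) chain) _.
rewrite mulrDr -expRD addNr expR0 lerD2l -[leRHS]mul1r; apply: ler_wpM2r; first exact: mulr_ge0.
by rewrite -[leRHS](@expR0 R) ler_expR oppr_le0.
Qed.

End Oscillation.

(** The scale is the smallest admissible exponent; the minimality clause orders the scales of two
    points on the same radius. *)
Lemma dyadic_scale (R : realType) (d : R) : 0 < d -> d <= 1 -> exists n : nat,
  [/\ (2 ^+ n.+1)^-1 <= d, d <= 2 * (2 ^+ n.+1)^-1 &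
      forall k, (2 ^+ k.+1)^-1 <= d -> (n <= k)%N].
Proof.
move=> d0 d1.
have ex : exists n : nat, (2 ^+ n.+1)^-1 <= d.
  have [n Hn] := exp2_small 1 d0; exists n.
  apply: le_trans (ltW Hn); rewrite mul1r.
  by rewrite lef_pV2 ?posrE ?exprn_gt0// ler_weXn2l// ler1n.
have [n Hn min] := ex_minnP ex; exists n; split => //.
case: n Hn min => [|n] Hn min; first by rewrite expr1 divff.
rewrite leNgt; apply/negP => h.
suff /min : (2 ^+ n.+1)^-1 <= d by rewrite ltnn.
apply/ltW; apply: le_lt_trans h.
by rewrite [in leRHS]exprS invfM mulrA divff// mul1r.
Qed.

(** * The self-bound for the derivative *)

Section Star.
Context {R : realType}.
Variable nu : {measure set R -> \bar R}.
Hypothesis nufin : (nu `[0%R, 1%R[%classic < +oo)%E.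
Variable C : R.
Hypothesis C0 : 0 < C.
Hypothesis avgH : forall a l : R, 0 < l -> 2 * l <= 1 ->
  `| avg nu a l - avg nu (a + l) l | <=
    C * inf [set x : R | exists c L : R,
      [/\ 0 < L <= 1, setU (carc a l) (carc (a + l) l) `<=` carc c L &
          x = expR (- avg nu c L)]].

Lemma dyadic_half (n : nat) : 2 ^+ n * (2 ^+ n.+1)^-1 = 1 / 2 :> R.
Proof. by rewrite exprS; field; rewrite expf_neq0. Qed.

Lemma dyadic_le_half (n k : nat) : (k <= n)%N -> 2 ^+ k * (2 ^+ n.+1)^-1 <= 1 / 2 :> R.
Proof.
move=> kn; rewrite -(dyadic_half n) ler_wpM2r ?invr_ge0 ?exprn_ge0//.
by rewrite ler_weXn2l// ler1n.
Qed.

(** The Poisson kernel has the factor 1 - r, comparable to the shortest scale, so [kernel_estimate]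
    leaves a bounded error even with the crude bound [C] for all oscillations, that is with c = 0.
    The 16 is 8 from the kernel times 2 from the comparison of scales. *)
Lemma poisson_central (r th : R) (m : nat) : 0 <= r -> r < 1 ->
  (2 ^+ m.+1)^-1 <= 1 - r -> 1 - r <= 2 * (2 ^+ m.+1)^-1 ->
  `|complex.Re (herglotz_int nu (r%:C * ucirc th)) - central_avg nu th (2 ^+ m.+1)^-1| <=
  184 * 16 * pi * C.
Proof.
move=> r0 r1 lr rl; set z := r%:C * ucirc th.
set l0 := (2 ^+ m.+1)^-1 in lr rl *.
have l00 : 0 < l0 by rewrite invr_gt0 exprn_gt0.
have zr : cnorm z = r by exact: cnorm_circle.
have z1 : cnorm z < 1 by rewrite zr.
have dist l x : l <= Num.max l0 `|x| -> `|x| <= 1 / 2 -> l <= cnorm (ucirc (th + x) - z).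
  by move=> lx x2; apply: le_trans lx _; exact: ucirc_sub_max.
have pi0 := pi_gt0 R.
have := @kernel_estimate R nu nufin (fun t => complex.Re (herglotz z t)) _ _ _ th m
  (8 * pi * (1 - cnorm z)) C 0 (fun k => C * expR (- central_avg nu th (2 ^+ k * l0))) _ (ltW C0) (lexx 0) _ _ _ _.
rewrite -/l0 /arc_int carc1 (_ : leb_int _ _ _ = 1); last first.
  rewrite /leb_int -[RHS]/(complex.Re (1 : R[i])) -(cintab_herglotz (th - 1 / 2) z1) //.
rewrite mulr1 => H; apply: le_trans (H _ _ _ _ _ _ _ _) _ => {H}.
- by move=> t; exact: (ccont_herglotz t z1).1.
- by exists (2 / (1 - cnorm z)) => t; apply: le_trans (normRe_le _) (cnorm_herglotz_le t z1).
- by move=> t k; rewrite /herglotz ucircDint.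
- by rewrite !mulr_ge0// ?subr_ge0 ?(ltW z1)// ltW.
- by move=> l x l_gt0 lx x2; apply: poisson_kernel_le => //; exact: dist.
- move=> l x y l_gt0 lx ly x2 y2 xy.
  rewrite (_ : y - x = (th + y) - (th + x)); last by ring.
  by apply: poisson_kernel_lip; rewrite ?lerD2l//; exact: dist.
- move=> k km; rewrite mul0r addr0 mulr1 mulr_ge0 ?expR_ge0 ?(ltW C0)//=.
  rewrite -[leRHS]mulr1 ler_wpM2l ?(ltW C0)// -expR0 ler_expR oppr_le0.
  by apply: central_avg_ge0; rewrite mulr_gt0// exprn_gt0.
- move=> k a h km ha h0 ah; apply: (osc_central C0 avgH) => //.
    by rewrite mulr_gt0// exprn_gt0.
  by have := dyadic_le_half km; rewrite -/l0; lra.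
- rewrite addr0 mulr1 ler_pdivrMr// zr.
  have : 184 * (8 * pi) * C * (1 - r) <= 184 * (8 * pi) * C * (2 * l0).
    apply: ler_wpM2l rl; apply: mulr_ge0 (ltW C0).
    exact: mulr_ge0 (ler0n _ _) (mulr_ge0 (ler0n _ _) (ltW pi0)).
  lra.
Qed.

Let cc := C / 2 * expR (C / 2).

(* In the [k]-th dyadic shell the oscillation is measured against the arc of index
   [maxn k j], so that no average over an arc shorter than the [j]-th one enters. *)
Lemma herglotz_deriv_central (r th : R) (n j : nat) : 0 <= r -> r < 1 ->
  (2 ^+ n.+1)^-1 <= 1 - r -> 1 - r <= 2 * (2 ^+ n.+1)^-1 -> (j <= n)%N ->
  (1 - r) * cnorm (herglotz_int_deriv nu (r%:C * ucirc th)) <=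
  184 * 32 * pi * (1 + cc) * C * expR (- central_avg nu th (2 ^+ j * (2 ^+ n.+1)^-1)).
Proof.
move=> r0 r1 lr rl jn; set z := r%:C * ucirc th.
set l0 := (2 ^+ n.+1)^-1 in lr rl *.
have l00 : 0 < l0 by rewrite invr_gt0 exprn_gt0.
have zr : cnorm z = r by exact: cnorm_circle.
have z1 : cnorm z < 1 by rewrite zr.
have cc0 : 0 <= cc by rewrite mulr_ge0 ?expR_ge0// divr_ge0// ltW.
have dist l x : l <= Num.max l0 `|x| -> `|x| <= 1 / 2 -> l <= cnorm (ucirc (th + x) - z).
  by move=> lx x2; apply: le_trans lx _; exact: ucirc_sub_max.
have pi0 := pi_gt0 R; have pi2 := pi_ge2 R.
pose b k := central_avg nu th (2 ^+ k * l0).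
have pos i : 0 < 2 ^+ i * l0 by rewrite mulr_gt0// exprn_gt0.
(* The projection [p] stands for the real or the imaginary part, as [kernel_estimate] is for real
   kernels. *)
have main (p : R[i] -> R) : (forall w, `|p w| <= cnorm w) -> (forall w v, p (w - v) = p w - p v) ->
    (forall t, {for t, continuous (fun t => p (herglotz_deriv z t))}) ->
    leb_int (fun t => p (herglotz_deriv z t)) (th - 1 / 2) 1 = 0 ->
    `|Rintegral nu `[0, 1[ (fun t => p (herglotz_deriv z t))| <=
      184 * (1 + cc) * (8 * pi) * (C * expR (- b j)) / l0.
  move=> p_le pB cp p0.
  have := @kernel_estimate R nu nufin (fun t => p (herglotz_deriv z t)) cp _ _ th n
    (8 * pi) (C * expR (- b j)) cc (fun k => C * expR (- b (maxn k j))) _ _ cc0 _ _ _ _.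
  rewrite -/l0 /arc_int carc1 p0 mulr0 subr0; apply.
  - exists (2 / (1 - cnorm z) ^+ 2) => t; apply: le_trans (p_le _) _.
    by apply: herglotz_deriv_le; rewrite ?subr_gt0// ucirc_sub_ge.
  - by move=> t k; rewrite /herglotz_deriv ucircDint.
  - by rewrite mulr_ge0// ltW.
  - by rewrite mulr_ge0 ?expR_ge0// ltW.
  - move=> l x l_gt0 lx x2; apply: le_trans (p_le _) _.
    apply: (le_trans (herglotz_deriv_le l_gt0 (dist _ _ lx x2))).
    by rewrite ler_wpM2r ?invr_ge0 ?exprn_ge0 ?(ltW l_gt0)//; lra.
  - move=> l x y l_gt0 lx ly x2 y2 xy; rewrite -pB; apply: le_trans (p_le _) _.
    rewrite (_ : y - x = (th + y) - (th + x)); last by ring.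
    by apply: herglotz_deriv_lip; rewrite ?lerD2l ?(ltW z1)//; exact: dist.
  - move=> k kn; rewrite mulr_ge0 ?expR_ge0 ?(ltW C0)//= -mulrA ler_wpM2l ?(ltW C0)//.
    case: (leqP j k) => jk.
      by apply: (expR_central_avg_chain nufin C0 avgH) (kn) => //; exact: dyadic_le_half.
    rewrite -[leLHS]mulr1 ler_wpM2l ?expR_ge0// lerDl.
    by rewrite mulr_ge0.
  - move=> k a h kn ha h0 ah; apply: (osc_central C0 avgH) => //.
    + have mn : (maxn k j <= n)%N by rewrite geq_max kn.
      by have := dyadic_le_half mn; rewrite -/l0; lra.
    + by apply: le_trans ha; rewrite lerB// ler_wpM2r ?(ltW l00)// ler_weXn2l ?ler1n// leq_maxl.
    + by apply: le_trans ah _; rewrite lerD2l ler_wpM2r ?(ltW l00)// ler_weXn2l ?ler1n// leq_maxl.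
have I0 := cintab_herglotz_deriv (th - 1 / 2) z1.
have h1 : `|complex.Re (herglotz_int_deriv nu z)| <= 184 * (1 + cc) * (8 * pi) * (C * expR (- b j)) / l0.
  refine (main (@complex.Re R) _ _ _ _).
  - exact: normRe_le.
  - by move=> w v; rewrite cReD cReN.
  - by move=> t; exact: (ccont_herglotz_deriv t z1).1.
  - by rewrite -[RHS]/(complex.Re (0 : R[i])) -I0.
have h2 : `|complex.Im (herglotz_int_deriv nu z)| <= 184 * (1 + cc) * (8 * pi) * (C * expR (- b j)) / l0.
  refine (main (@complex.Im R) _ _ _ _).
  - exact: normIm_le.
  - by move=> w v; rewrite cImD cImN.
  - by move=> t; exact: (ccont_herglotz_deriv t z1).2.
  - by rewrite -[RHS]/(complex.Im (0 : R[i])) -I0.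
have h : cnorm (herglotz_int_deriv nu z) <= 2 * (184 * (1 + cc) * (8 * pi) * (C * expR (- b j)) / l0).
  by apply: le_trans (cnorm_le_ReIm _) _; lra.
have r10 : 0 <= 1 - r by rewrite subr_ge0 ltW.
apply: le_trans (ler_wpM2l r10 h) _.
set Y := 184 * (1 + cc) * (8 * pi) * (C * expR (- b j)).
have cc1 : 0 <= 1 + cc by rewrite addr_ge0.
have Y0 : 0 <= Y.
  apply: mulr_ge0; last exact: mulr_ge0 (ltW C0) (expR_ge0 _).
  exact: mulr_ge0 (mulr_ge0 (ler0n _ _) cc1) (mulr_ge0 (ler0n _ _) (ltW pi0)).
(* The 32 in the statement is the 8 of the kernel, a 2 for the two components and a 2 for 1 - r
   against the shortest scale. *)
apply: (@le_trans _ _ (2 * l0 * (2 * (Y / l0)))).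
  by rewrite ler_wpM2r// mulr_ge0// divr_ge0// ltW.
have -> : 2 * l0 * (2 * (Y / l0)) = 4 * Y by field; rewrite gt_eqF.
by rewrite /Y le_eqVlt; apply/orP; left; apply/eqP; rewrite -/(b j); ring.
Qed.

Variables (f : R[i] -> R[i]) (c : R[i]).
Hypothesis c1 : cnorm c = 1.
Hypothesis fE : forall z, disk z -> f z = c * cexp (- herglotz_int nu z).

(** The points [z] and rho z lie in the same direction, so one arc plays both parts: its average
    bounds the derivative at [z] through the hypothesis, and equals -log |f(rho z)| up to a bounded
    error, which becomes the factor exp [K2]. *)
Lemma exp_herglotz_deriv_le : exists2 B, 0 <= B & forall z rho, disk z -> 0 <= rho -> rho <= 1 ->
  (1 - cnorm z) * cnorm (- herglotz_int_deriv nu z * f z) <=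
  B * (cnorm (f z) * cnorm (f (rho%:C * z))).
Proof.
have pi0 := pi_gt0 R.
have cc0 : 0 <= cc by rewrite mulr_ge0 ?expR_ge0// divr_ge0// ltW.
have K0 : 0 <= 184 * 32 * pi * (1 + cc) * C.
  apply: mulr_ge0 (ltW C0); apply: mulr_ge0; last by rewrite addr_ge0.
  exact: mulr_ge0 (mulr_ge0 (ler0n _ _) (ler0n _ _)) (ltW pi0).
have Hd := herglotz_deriv_central; have Hp := poisson_central.
move: (184 * 32 * pi * (1 + cc) * C) (184 * 16 * pi * C) K0 Hd Hp => K1 K2 K0 Hd Hp.
exists (K1 * expR K2); first exact: mulr_ge0 K0 (expR_ge0 _).
move=> z rho z1 rho0 rho1.
have [th zE] := polar_form z; set r := cnorm z in zE.
have r0 : 0 <= r by exact: cnorm_ge0.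
have r1 : r < 1 by [].
have rr1 : rho * r < 1 by apply: le_lt_trans r1; rewrite ler_piMl.
have rr0 : 0 <= rho * r by rewrite mulr_ge0.
have wE : rho%:C * z = (rho * r)%:C * ucirc th by rewrite {1}zE mulrA -rmorphM.
have [n [n1 n2 nmin]] := @dyadic_scale R (1 - r) ltac:(lra) ltac:(lra).
have [m [m1 m2 mmin]] := @dyadic_scale R (1 - rho * r) ltac:(lra) ltac:(lra).
have mn : (m <= n)%N.
  apply: mmin; apply: le_trans n1 _.
  by rewrite lerB// ler_piMl.
have D := Hd _ th _ _ r0 r1 n1 n2 (leq_subr m n).
have P := Hp _ th _ rr0 rr1 m1 m2.
rewrite -zE in D; rewrite -wE in P.
(* Going up n - m doublings from the scale of [z] reaches the scale of rho z. *)
have e : 2 ^+ (n - m) * (2 ^+ n.+1)^-1 = (2 ^+ m.+1)^-1 :> R.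
  rewrite -{2}(subnK mn) -addnS exprD invfM mulrA divff ?mul1r// expf_neq0//.
rewrite e in D.
have w1 : disk (rho%:C * z) by rewrite wE; exact: disk_real_ucirc.
rewrite mulNr cnormN cnormM mulrA (mulrC (cnorm (f z))) mulrA.
apply: ler_wpM2r; first exact: cnorm_ge0.
apply: le_trans D _; rewrite -mulrA; apply: ler_wpM2l => //.
rewrite (cnorm_exp_herglotz c1 fE w1) -expRD ler_expR.
by move: P; rewrite ler_norml => /andP[]; lra.
Qed.

End Star.

(** * Polynomial approximation with control of the Bloch seminorm *)

Section Approximation.
Context {R : realType}.
Implicit Types (f g : R[i] -> R[i]).

Lemma horner_dilate (p : {poly R[i]}) (c z : R[i]) :
  (p \Po (c *: 'X)).[z] = p.[c * z] /\ (p \Po (c *: 'X))^`().[z] = c * p^`().[c * z].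
Proof.
split; first by rewrite horner_comp hornerZ hornerX.
rewrite deriv_comp hornerM horner_comp derivZ derivX !hornerZ hornerX hornerC.
by rewrite mulr1 mulrC.
Qed.

Lemma dilate_close (F F' : R[i] -> R[i]) (s eta : R) : deriv_on_disk F F' ->
  0 <= s -> s < 1 -> 0 < eta -> exists r, [/\ 0 < r, r < 1 &
    forall z, cnorm z <= s -> cnorm (F (r%:C * z) - F z) <= eta].
Proof.
move=> dF s0 s1 eta0.
have [L L0 HL] := deriv_bounded dF s1.
have L1 : 0 < L + 1 by rewrite ltr_wpDl.
pose d := Num.min (1 / 2) (eta / (L + 1)).
have d0 : 0 < d by rewrite lt_min !divr_gt0.
have d2 : d <= 1 / 2 by rewrite ge_min lexx.
have de : d <= eta / (L + 1) by rewrite ge_min lexx orbT.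
clearbody d.
exists (1 - d); split; [lra|lra|move=> z zs].
have dd : cnorm (1 - d)%:C = 1 - d by rewrite cnorm_real ger0_norm; lra.
have z0 := cnorm_ge0 z.
have dzs : cnorm ((1 - d)%:C * z) <= s.
  by rewrite cnormM dd; apply: le_trans zs; rewrite ler_piMl//; lra.
apply: le_trans (deriv_increment dF s1 (fun y ys => (HL y ys).2) dzs zs) _.
rewrite (_ : _ - z = (- d)%:C * z); last first.
  by rewrite rmorphB rmorphN /=; ring.
rewrite cnormM cnorm_real normrN (gtr0_norm d0).
apply: (@le_trans _ _ ((L + 1) * (d * 1))).
  apply: ler_pM => //; rewrite ?mulr_ge0 ?(ltW d0) ?lerDl//.
  by rewrite ler_wpM2l ?(ltW d0)//; exact: le_trans zs (ltW s1).
by rewrite mulr1 mulrC -ler_pdivlMr.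
Qed.

(** Dilation does not increase the Bloch seminorm and makes the function analytic across the circle,
    where polynomials approximate it uniformly with its derivative. The added 1 is the approximation
    error of the derivative. *)
Lemma bloch_poly_approx (g g' : R[i] -> R[i]) (M s eta : R) : deriv_on_disk g g' ->
  (forall z, disk z -> (1 - cnorm z) * cnorm (g' z) <= M) ->
  0 <= s -> s < 1 -> 0 < eta -> exists P : {poly R[i]},
    (forall z, disk z -> (1 - cnorm z) * cnorm P^`().[z] <= M + 1) /\
    (forall z, cnorm z <= s -> cnorm (P.[z] - g z) <= eta).
Proof.
move=> dg gM s0 s1 eta0.
have eta2 : 0 < eta / 2 by rewrite divr_gt0.
have [r [r0 r1 Hr]] := dilate_close dg s0 s1 eta2.
have e0 : 0 < Num.min 1 (eta / 2) by rewrite lt_min ltr01.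
have [p Hp] := poly_approx dg (ltW r0) r1 e0.
have rr : cnorm r%:C = r by rewrite cnorm_real gtr0_norm.
exists (p \Po (r%:C *: 'X)); split => z zz; have [hE dE] := horner_dilate p r%:C z.
- have z0 := cnorm_ge0 z; have z1 : cnorm z < 1 := zz.
  have rz : cnorm (r%:C * z) <= r by rewrite cnormM rr ler_piMr// ltW.
  have rz1 : disk (r%:C * z) by exact: le_lt_trans rz r1.
  have [_ h] := Hp _ rz; rewrite dE cnormM rr.
  have rzz : cnorm (r%:C * z) <= cnorm z by rewrite cnormM rr ler_piMl// ltW.
  have h2 := gM _ rz1.
  have h3 : cnorm p^`().[r%:C * z] <= cnorm (g' (r%:C * z)) + 1.
    have := cnorm_le_sub p^`().[r%:C * z] (g' (r%:C * z)); rewrite cdistC.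
    by move: h; rewrite le_min => /andP[]; lra.
  apply: (@le_trans _ _ ((1 - cnorm (r%:C * z)) * (cnorm (g' (r%:C * z)) + 1))).
    apply: ler_pM; rewrite ?subr_ge0 ?(ltW z1) ?mulr_ge0 ?cnorm_ge0 ?(ltW r0)//; first by lra.
    by apply: le_trans h3; rewrite ler_piMl ?cnorm_ge0// ltW.
  by rewrite mulrDr mulr1; have := cnorm_ge0 (r%:C * z); lra.
- have rz : cnorm (r%:C * z) <= r.
    by rewrite cnormM rr ler_piMr// ?(ltW r0)// (le_trans zz)// ltW.
  have [h _] := Hp _ rz; have h2 := Hr _ zz.
  rewrite hE (_ : _ - _ = (p.[r%:C * z] - g (r%:C * z)) + (g (r%:C * z) - g z)); last by ring.
  apply: le_trans (cnormD _ _) _; rewrite (cdistC p.[_]).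
  by move: h; rewrite le_min => /andP[]; lra.
Qed.

(* The polynomial [q] is close to 1 / f (r z); the self-bound is used at z with
   rho = r, for f' q, and at r z with rho = 1, for f q'. *)
Lemma inverse_poly_approx (f f' : R[i] -> R[i]) (B s eta : R) : deriv_on_disk f f' ->
  (forall z, disk z -> cnorm (f z) <= 1) -> (forall z, disk z -> f z != 0) -> 0 <= B ->
  (forall z rho, disk z -> 0 <= rho -> rho <= 1 ->
    (1 - cnorm z) * cnorm (f' z) <= B * (cnorm (f z) * cnorm (f (rho%:C * z)))) ->
  0 <= s -> s < 1 -> 0 < eta -> exists q : {poly R[i]},
    (forall z, disk z -> (1 - cnorm z) * cnorm (f' z * q.[z] + f z * q^`().[z]) <= 2 * B + 1) /\
    (forall z, cnorm z <= s -> cnorm (f z * q.[z] - 1) <= eta).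
Proof.
move=> df f1 fn0 B0 star s0 s1 eta0.
have dV : deriv_on_disk (fun z => (f z)^-1) (fun z => - f' z / f z ^+ 2).
  by move=> z dz; apply: has_cderivV; [exact: fn0|exact: df].
have eta2 : 0 < eta / 2 by rewrite divr_gt0.
have [r [r0 r1 Hr]] := dilate_close dV s0 s1 eta2.
have B1 : 0 < B + 1 by rewrite ltr_wpDl.
(* The errors in [t1] and [t2] below are B e and e; the first bound fits their sum into the 1 of 2 B
   + 1. *)
have e0 : 0 < Num.min (1 / (B + 1)) (eta / 2) by rewrite lt_min !divr_gt0.
have [p Hp] := poly_approx dV (ltW r0) r1 e0.
set e := Num.min _ _ in e0 Hp.
have eB : e * (B + 1) <= 1 by rewrite -ler_pdivlMr// /e ge_min lexx.
have ee : e <= eta / 2 by rewrite /e ge_min lexx orbT.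
clearbody e.
have rr : cnorm r%:C = r by rewrite cnorm_real gtr0_norm.
exists (p \Po (r%:C *: 'X)); split => z zz; have [hE dE] := horner_dilate p r%:C z; rewrite hE ?dE.
- have z0 := cnorm_ge0 z; have z1 : cnorm z < 1 := zz.
  set w := r%:C * z.
  have rz : cnorm w <= r by rewrite cnormM rr ler_piMr// ltW.
  have w1 : disk w by exact: le_lt_trans rz r1.
  have wz : cnorm w <= cnorm z by rewrite cnormM rr ler_piMl// ltW.
  have [h h'] := Hp _ rz.
  have fw0 : 0 < cnorm (f w) by rewrite cnorm_gt0 fn0.
  have fz1 := f1 _ zz; have fz0 := cnorm_ge0 (f z).
  have st1 := star _ _ zz (ltW r0) (ltW r1); rewrite -/w in st1.
  have st2 := star _ _ w1 ler01 (lexx 1); rewrite mul1r in st2.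
  have q1 : cnorm p.[w] <= (cnorm (f w))^-1 + e.
    by have := cnorm_le_sub p.[w] (f w)^-1; rewrite cdistC cnormV; lra.
  have q2 : cnorm p^`().[w] <= cnorm (f' w) / cnorm (f w) ^+ 2 + e.
    have := cnorm_le_sub p^`().[w] (- f' w / f w ^+ 2).
    by rewrite cdistC cnormf cnormN cnormX; lra.
  have t1 : (1 - cnorm z) * (cnorm (f' z) * cnorm p.[w]) <= B + B * e.
    rewrite mulrA; apply: (@le_trans _ _ (B * (cnorm (f z) * cnorm (f w)) * ((cnorm (f w))^-1 + e))).
      by apply: ler_pM; rewrite ?mulr_ge0 ?cnorm_ge0// subr_ge0 ltW.
    have -> : B * (cnorm (f z) * cnorm (f w)) * ((cnorm (f w))^-1 + e) =
        B * cnorm (f z) + B * e * (cnorm (f z) * cnorm (f w)).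
      (* The factor |f(w)| of the self-bound has cancelled the reciprocal contributed by [q]. *)
      by field; rewrite gt_eqF.
    have f2 : cnorm (f z) * cnorm (f w) <= 1 by rewrite mulr_ile1 ?(ltW fw0) ?f1.
    apply: lerD; first by rewrite ler_piMr.
    by rewrite ler_piMr// mulr_ge0// ltW.
  have t2 : (1 - cnorm z) * (cnorm (f z) * (r * cnorm p^`().[w])) <= B + e.
    apply: (@le_trans _ _ ((1 - cnorm w) * (1 * (1 * cnorm p^`().[w])))).
      apply: ler_pM; rewrite ?mulr_ge0 ?cnorm_ge0 ?(ltW r0) ?subr_ge0 ?(ltW z1) ?lerB//.
      by apply: ler_pM; rewrite ?mulr_ge0 ?cnorm_ge0 ?(ltW r0)// ler_wpM2r ?cnorm_ge0// ltW.
    have w0 : 0 <= 1 - cnorm w by rewrite subr_ge0 ltW.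
    rewrite !mul1r; apply: le_trans (ler_wpM2l w0 q2) _.
    rewrite mulrDr; apply: lerD.
      by rewrite mulrA ler_pdivrMr ?exprn_gt0// expr2.
    by rewrite ler_piMl ?(ltW e0)//; have := cnorm_ge0 w; lra.
  have c1 : 0 <= 1 - cnorm z by rewrite subr_ge0 ltW.
  apply: le_trans (ler_wpM2l c1 (cnormD _ _)) _.
  by rewrite mulrDr !cnormM rr; lra.
- have rz : cnorm (r%:C * z) <= r.
    by rewrite cnormM rr ler_piMr// ?(ltW r0)// (le_trans zz)// ltW.
  have zd : disk z by exact: le_lt_trans zz s1.
  have [h _] := Hp _ rz; have h2 := Hr _ zz.
  have fz := fn0 _ zd.
  rewrite (_ : _ - 1 = f z * ((p.[r%:C * z] - (f (r%:C * z))^-1) + ((f (r%:C * z))^-1 - (f z)^-1))); last first.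
    by rewrite addrA subrK mulrBr divff.
  rewrite cnormM -[leRHS]mul1r; apply: ler_pM; rewrite ?cnorm_ge0 ?f1//.
  by apply: le_trans (cnormD _ _) _; rewrite (cdistC p.[_]); lra.
Qed.

End Approximation.

(** * Weak-star approximation and cyclicity *)

Section Cyclicity.
Context {R : realType}.

(* If the limit does not exist, [lim] is the junk value 0. *)
Lemma lim_left_small (F : R -> R) (s e : R) : s < 1 -> 0 <= e ->
  (forall r, s <= r -> r < 1 -> `|F r| <= e) -> `|lim (F @ (1 : R)^'-)| <= e.
Proof.
move=> s1 e0 Fe.
have nearF : \forall r \near (1 : R)^'-, `|F r| <= e.
  near=> r; apply: Fe; last by near: r; exact: nbhs_left_lt.
  by near: r; apply: nbhs_left_ge.
have [cF|/dvgP->] := pselect (cvg (F @ (1 : R)^'-)); last by rewrite normr0.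
rewrite ler_norml; apply/andP; split.
- by apply: limr_ge => //; apply: filterS nearF => r; rewrite ler_norml => /andP[].
- by apply: limr_le => //; apply: filterS nearF => r; rewrite ler_norml => /andP[].
Unshelve. all: by end_near. Qed.

(** [bpair] takes the limits of the real and the imaginary part separately; each is at most [e],
    whence the factor 2. *)
Lemma bpair_small (h h' g g' : R[i] -> R[i]) (s e : R) : deriv_on_disk h h' ->
  deriv_on_disk g g' -> 0 <= s -> s < 1 -> 0 <= e ->
  (forall r, s <= r -> r < 1 -> cnorm (cintab 0 1 (pair_integrand h g r)) <= e) ->
  cnorm (bpair h g) <= 2 * e.
Proof.
move=> dh dg s0 s1 e0 H.
have co r : s <= r -> r < 1 -> contab 0 1 (pair_integrand h g r).
  by move=> sr r1 t _ _; apply: ccont_pair_integrand dh dg _ r1; exact: le_trans sr.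
have bnd (p : R[i] -> R) : (forall w, `|p w| <= cnorm w) ->
    (forall r, s <= r -> r < 1 -> forall t, 0 <= t -> t <= 1 -> {for t, continuous (fun t => p (pair_integrand h g r t))}) ->
    (forall r, \int[lebesgue_measure]_(t in `[0, 1]) p (pair_integrand h g r t) =
        p (cintab 0 1 (pair_integrand h g r))) ->
    `|lim ((fun r => Rintegral (@lebesgue_measure R) `[0, 1[
              (fun t => p (pair_integrand h g r t))) @ (1:R)^'-)| <= e.
  move=> pn cp pE; apply: (lim_left_small s1 e0) => r sr r1.
  have ip : lebesgue_measure.-integrable `[0, 1] (EFin \o (fun t => p (pair_integrand h g r t))).
    by apply: integrable_itv_cont; exact: cp.
  rewrite Rintegral_itv_bndo_bndc ?pE; first by apply: le_trans (pn _) (H _ sr r1).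
  by apply: integrableS ip => //; apply: subset_itvl; rewrite bnd_simp.
apply: le_trans (cnorm_le_ReIm _) _; rewrite mulr_natl mulr2n; apply: lerD.
- apply: (bnd (@complex.Re R)) => //; first exact: normRe_le.
  by move=> r sr r1 t t0 t1; exact: (co r sr r1 t t0 t1).1.
- apply: (bnd (@complex.Im R)) => //; first exact: normIm_le.
  by move=> r sr r1 t t0 t1; exact: (co r sr r1 t t0 t1).2.
Qed.

Lemma pairing_small_family (n : nat) (gs : 'I_n -> R[i] -> R[i]) (M eps : R) :
  (forall k, W1 (gs k)) -> 0 <= M -> 0 < eps ->
  exists s eta : R, [/\ 0 <= s, s < 1, 0 < eta, eta <= 1 &
    forall h h', deriv_on_disk h h' ->
      (forall z, disk z -> (1 - cnorm z) * cnorm (h' z) <= M) ->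
      (forall z, cnorm z <= s -> cnorm (h z) <= eta) ->
      forall k r, s <= r -> r < 1 -> cnorm (cintab 0 1 (pair_integrand h (gs k) r)) <= eps].
Proof.
move=> gW M0 eps0.
have /choice[se Hse] : forall k, exists se : R * R, [/\ 0 <= se.1, se.1 < 1, 0 < se.2 &
    forall h h', deriv_on_disk h h' ->
      (forall z, disk z -> (1 - cnorm z) * cnorm (h' z) <= M) ->
      (forall z, cnorm z <= se.1 -> cnorm (h z) <= se.2) ->
      forall r, se.1 <= r -> r < 1 -> cnorm (cintab 0 1 (pair_integrand h (gs k) r)) <= eps].
  by move=> k; have [s [eta ?]] := pairing_small (gW k) M0 eps0; exists (s, eta).
(* The neutral values 0 and 1 settle the empty family and give the bounds 0 <= s and eta <= 1. *)
pose s := \big[Num.max/0]_k (se k).1; pose eta := \big[Num.min/1]_k (se k).2.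
have sk k : (se k).1 <= s by exact: le_bigmax.
have ek k : eta <= (se k).2 by exact: bigmin_le.
exists s, eta; split.
- exact: bigmax_ge_id.
- by apply: bigmax_lt => // k _; have [] := Hse k.
- by apply: lt_bigmin => // k _; have [] := Hse k.
- exact: bigmin_le_id.
- move=> h h' dh hM hs k r sr r1; have [_ _ _ H] := Hse k; apply: (H h h') => //.
    by move=> z zk; apply: le_trans (hs z _) (ek k); exact: le_trans zk (sk k).
  exact: le_trans (sk k) sr.
Qed.

(** Write P q f - g as P (q f - 1) + (P - g). Choosing [P] before [q] fixes the sup norms of [P] and
    [P'], hence a Bloch bound for the first summand that holds for all admissible [q]; only then is
    the required accuracy of [q] known. *)
Lemma cyclic_bloch_of_self_bound (f f' : R[i] -> R[i]) (B : R) : deriv_on_disk f f' ->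
  (forall z, disk z -> cnorm (f z) <= 1) -> (forall z, disk z -> f z != 0) -> 0 <= B ->
  (forall z rho, disk z -> 0 <= rho -> rho <= 1 ->
    (1 - cnorm z) * cnorm (f' z) <= B * (cnorm (f z) * cnorm (f (rho%:C * z)))) ->
  cyclic_bloch f.
Proof.
move=> df f1 fn0 B0 star g [g' [dg [M gM]]] n gs gW eps eps0.
have d0 : disk (0 : R[i]) by rewrite /disk /= cnorm0.
have M0 : 0 <= M.
  by apply: le_trans (gM _ d0); rewrite cnorm0 subr0 mul1r cnorm_ge0.
have e8 : 0 < eps / 8 by rewrite divr_gt0.
have N0 : 0 <= M + 1 + M by rewrite !addr_ge0.
have [s [eta [s0 s1 eta0 _ Hs]]] := pairing_small_family gW N0 e8.
have [P [PM Pg]] := bloch_poly_approx dg gM s0 s1 eta0.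
have dP := deriv_on_disk_poly P.
have dPg := deriv_on_diskB dP dg.
have {Hs} HPg : forall k r, s <= r -> r < 1 ->
    cnorm (cintab 0 1 (pair_integrand (fun z => P.[z] - g z) (gs k) r)) <= eps / 8.
  apply: (Hs _ _ dPg) => // z zd; have z1 : cnorm z < 1 := zd.
  have c1 : 0 <= 1 - cnorm z by rewrite subr_ge0 ltW.
  apply: le_trans (ler_wpM2l c1 (cnormB _ _)) _; rewrite mulrDr.
  by apply: lerD; [exact: PM|exact: gM].
have [K K0 HK] := poly_bounded P; have [K' K'0 HK'] := poly_bounded P^`().
pose N1 := 2 * B + 1; have N10 : 0 <= N1 by rewrite /N1; lra.
(* The Bloch bound for P (q f - 1) by the product rule; N1 + 1 bounds (1 - |z|) |q f - 1|, as shown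
   in [k_le]. *)
have N20 : 0 <= K' * (N1 + 1) + K * N1 by apply: addr_ge0; apply: mulr_ge0 => //; rewrite addr_ge0.
have [s' [eta' [s'0 s'1 eta'0 eta'1 Hs]]] := pairing_small_family gW N20 e8.
have K1 : 0 < K + 1 by rewrite ltr_wpDl.
(* Dividing by K + 1 leaves room for the multiplication by [P]. *)
have ex0 : 0 < eta' / (K + 1) by rewrite divr_gt0.
have [q [qM q1]] := inverse_poly_approx df f1 fn0 B0 star s'0 s'1 ex0.
have dk : deriv_on_disk (fun z => f z * q.[z]) (fun z => f' z * q.[z] + f z * q^`().[z]).
  by move=> z zd; apply: has_cderivM; [exact: df|exact: has_cderiv_poly].
have dk1 : deriv_on_disk (fun z => f z * q.[z] - 1) (fun z => f' z * q.[z] + f z * q^`().[z]).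
  move=> z zd; have := has_cderivD (dk _ zd) (has_cderiv_cst (-1) z).
  by rewrite addr0.
(* The derivative is at most N1 / (1 - |z|) along the segment from 0 to [z]; the 1 is for the value
   at 0. *)
have k_le z : disk z -> (1 - cnorm z) * cnorm (f z * q.[z] - 1) <= N1 + 1.
  move=> zd; have z1 : cnorm z < 1 := zd.
  have c0 : 0 < 1 - cnorm z by rewrite subr_gt0.
  have kd y : cnorm y <= cnorm z -> cnorm (f' y * q.[y] + f y * q^`().[y]) <= N1 / (1 - cnorm z).
    move=> yz; rewrite ler_pdivlMr// mulrC.
    apply: le_trans (qM y (le_lt_trans yz z1)); rewrite ler_wpM2r ?cnorm_ge0// lerB//.
  have z00 : cnorm (0 : R[i]) <= cnorm z by rewrite cnorm0 cnorm_ge0.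
  have h := deriv_increment dk z1 kd (lexx _) z00.
  have h0 : cnorm (f 0 * q.[0] - 1) <= 1.
    apply: le_trans (q1 0 _) _; first by rewrite cnorm0.
    by rewrite ler_pdivrMr// mul1r (le_trans eta'1)// lerDr.
  have h2 : (1 - cnorm z) * cnorm (f z * q.[z] - f 0 * q.[0]) <= N1.
    apply: le_trans (ler_wpM2l (ltW c0) h) _; rewrite subr0 mulrA (mulrC (1 - _)) divfK ?gt_eqF//.
    by rewrite ler_piMr// ltW.
  rewrite (_ : f z * q.[z] - 1 = (f z * q.[z] - f 0 * q.[0]) + (f 0 * q.[0] - 1)); last by ring.
  apply: le_trans (ler_wpM2l (ltW c0) (cnormD _ _)) _; rewrite mulrDr; apply: lerD => //.
  rewrite -[leRHS]mulr1; apply: ler_pM; rewrite ?cnorm_ge0 ?(ltW c0)//.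
  by rewrite gerBl cnorm_ge0.
have dPk : deriv_on_disk (fun z => P.[z] * (f z * q.[z] - 1))
    (fun z => P^`().[z] * (f z * q.[z] - 1) + P.[z] * (f' z * q.[z] + f z * q^`().[z])).
  by move=> z zd; apply: has_cderivM; [exact: has_cderiv_poly|exact: dk1].
have HPk : forall k r, s' <= r -> r < 1 ->
    cnorm (cintab 0 1 (pair_integrand (fun z => P.[z] * (f z * q.[z] - 1)) (gs k) r)) <= eps / 8.
  apply: (Hs _ _ dPk) => z zd.
    have z1 : cnorm z < 1 := zd; have zl := ltW z1.
    have c0 : 0 <= 1 - cnorm z by rewrite subr_ge0 ltW.
    apply: le_trans (ler_wpM2l c0 (cnormD _ _)) _; rewrite !cnormM mulrDr !(mulrCA (1 - _)).
    by apply: lerD; apply: ler_pM; rewrite ?mulr_ge0 ?cnorm_ge0 ?HK ?HK' ?k_le ?qM.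
  have zl : cnorm z <= 1 := le_trans zd (ltW s'1).
  rewrite cnormM; apply: (@le_trans _ _ ((K + 1) * (eta' / (K + 1)))).
    apply: ler_pM; rewrite ?cnorm_ge0 ?q1//.
    by apply: le_trans (HK _ zl) _; rewrite lerDl.
  by rewrite mulrC divfK// gt_eqF.
exists (P * q) => k.
pose h1 z := P.[z] * (f z * q.[z] - 1); pose h2 z := P.[z] - g z.
have hE : (fun z => (P * q).[z] * f z - g z) = (fun z => h1 z + h2 z).
  by apply/funext => z; rewrite /h1 /h2 hornerM; ring.
have dh : deriv_on_disk (fun z => h1 z + h2 z)
    (fun z => (P^`().[z] * (f z * q.[z] - 1) + P.[z] * (f' z * q.[z] + f z * q^`().[z])) +
              (P^`().[z] - g' z)).
  by move=> z zd; apply: has_cderivD; [exact: dPk|exact: dPg].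
have [gk' [dgk _]] := gW k.
pose t := Num.max s s'.
have ts : s <= t by rewrite le_max lexx.
have ts' : s' <= t by rewrite le_max lexx orbT.
have t0 : 0 <= t by exact: le_trans ts.
have t1 : t < 1 by rewrite gt_max s1.
(* Two summands of eps / 8 each, doubled by [bpair_small]. *)
rewrite hE; apply: (@le_lt_trans _ _ (2 * (eps / 4))); last by lra.
apply: (bpair_small dh dgk t0 t1); first by lra.
move=> r tr r1; have r0 := le_trans t0 tr.
rewrite (_ : cintab 0 1 _ = cintab 0 1 (pair_integrand h1 (gs k) r) + cintab 0 1 (pair_integrand h2 (gs k) r)).
  apply: le_trans (cnormD _ _) _.
  have := HPk k r (le_trans ts' tr) r1; have := HPg k r (le_trans ts tr) r1.
  rewrite -/h1 -/h2; lra.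
rewrite -cintabD; last 2 first.
- by move=> x _ _; exact: (ccont_pair_integrand x dPk dgk).
- by move=> x _ _; exact: (ccont_pair_integrand x dPg dgk).
by apply: eq_cintab => x _ _; rewrite !pair_integrandE mulrDl.
Qed.

End Cyclicity.

Theorem theorem1p7 (R : realType) (f : R[i] -> R[i])
  (nu : {measure set R -> \bar R}) :
  Hinf_unit_ball f ->
  (forall z, disk z -> f z != 0) ->
  HN_measure f nu ->
  (exists C : R, 0 < C /\
     forall a l : R, 0 < l -> 2 * l <= 1 ->
       `| avg nu a l - avg nu (a + l) l | <=
         C * inf [set x : R | exists c L : R,
                   [/\ 0 < L <= 1,
                        setU (carc a l) (carc (a + l) l) `<=` carc c L &
                        x = expR (- avg nu c L)]]) ->
  cyclic_bloch f.
Proof.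
move=> [_ f1] fn0 [_ [nufin [c [c1 fE]]]] [C [C0 avgH]].
have [B B0 star] := exp_herglotz_deriv_le nufin C0 avgH c1 fE.
apply: cyclic_bloch_of_self_bound f1 fn0 B0 star.
by move=> z zd; exact: (has_cderiv_exp_herglotz nufin fE zd).
Qed.
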